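(* Let $\alpha\in\mathbb{Z}^\ell_{\ge0}$, $\eta=(\alpha^+)'$ (the conjugate of the partition $\alpha^+$) and $m=|\alpha|$. If $m\le\ell$, put $\mu=1^m0^{\ell-m}$; then \[ \tilde E_\alpha(x_1,\dots,x_\ell;q)=H(\Delta'_\ell(\eta);\mu;\tilde{\mathsf p}(\alpha))(x_1,\dots,x_\ell;q). \] If $m>\ell$, put $\mu=1^m$; then \[ \tilde E_\alpha(x_1,\dots,x_\ell;q)=H(\Delta'(\eta);\mu;\tilde{\mathsf p}(\alpha,0^{m-\ell}))(x_1,\dots,x_m;q)\big|_{x_{\ell+1}=\cdots=x_m=0}. \]
   Context: For $n\ge1$: $\pi_i(f)=\frac{x_if-x_{i+1}s_i(f)}{x_i-x_{i+1}}$ on polynomials in $x_1,\dots,x_n$; $H_n$ the 0-Hecke monoid on $\bar s_1,\dots,\bar s_{n-1}$ ($\bar s_i^2=\bar s_i$, commutation, braid), $\pi_w$ along any expression; $H_n$ acts on $\mathbb{Z}^n$ by $\bar s_i\beta=s_i\beta$ if $\beta_i\ge\beta_{i+1}$, else $\beta$. $\beta^+$ is the weakly decreasing rearrangement; $\mathsf p(\beta)$ (resp. $\tilde{\mathsf p}(\beta)$) is the shortest (resp. longest) element $z$ of $H_n$ with $z\beta^+=\beta$. Key polynomials $\kappa_\beta=\pi_{\mathsf p(\beta)}\mathbf x^{\beta^+}$, $\beta\in\mathbb{Z}^n$, form a basis of Laurent polynomials; $\mathrm{poly}(\kappa_\beta)=\kappa_\beta$ if $\beta\ge0$ and $0$ otherwise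 (linear, coefficientwise in $q$). A root ideal is an upper order ideal $\Psi$ of $\Delta^+_n=\{(i,j):1\le i<j\le n\}$ under $(a,b)\le(c,d)$ iff $a\ge c,b\le d$; $\mathrm{nr}(\Psi)_i=|\{j\in\{i,\dots,n\}:(i,j)\notin\Psi\}|$ for $i\in[n-1]$, and $\Psi=\{(i,j):j\ge i+\mathrm{nr}(\Psi)_i\}$. $H(\Psi;\gamma;w)=\pi_w\mathrm{poly}\big(\prod_{(i,j)\in\Psi}(1-qx_i/x_j)^{-1}\mathbf x^\gamma\big)$ in $n$ variables. For a partition $\eta=(\eta_1,\dots,\eta_k)$ of $m$, $\Delta'(\eta)\subset\Delta^+_m$ is the root ideal with $\mathrm{nr}(\Delta'(\eta))=\big((\eta_1)^{\eta_2},\eta_1,\eta_1-1,\dots,\eta_2+1,(\eta_2)^{\eta_3},\eta_2,\eta_2-1,\dots,\eta_3+1,\dots,(\eta_{k-1})^{\eta_k},\eta_{k-1},\dots,\eta_k+1,\eta_k,\eta_k-1,\dots,2\big)$, where $(a)^b$ means $a$ repeated $b$ times. For $\ell\ge m$, $\Delta'_\ell(\eta)=\Delta'(\eta)\sqcup\{(i,j)\in\Delta^+_\ell:j>m\}$. $\Phi$ on polynomials in $x_1,\dots,x_\ell$: ring map $x_i\mapsto x_{i+1}$ ($i<\ell$), $x_\ell\mapsto qx_1$. The renormalized $t=0$ nonsymmetric Macdonald polynomials $\tilde E_\beta(x_1,\dots,x_\ell;q)$, $\beta\in\mathbb{Z}^\ell_{\ge0}$, are determined by $\tilde E_{(0,\dots,0)}=1$,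 $\tilde E_{\bar s_i\beta}=\pi_i(\tilde E_\beta)$ for $i\in[\ell-1]$, and $\tilde E_{(\beta_\ell+1,\beta_1,\dots,\beta_{\ell-1})}=x_1\Phi(\tilde E_\beta)$; they satisfy $E_\beta(\mathbf x;q,0)=q^{\sum_i\binom{\beta_i}2}\tilde E_\beta(\mathbf x;q^{-1})$ for the nonsymmetric Macdonald polynomials $E_\beta(\mathbf x;q,t)$. *)

(* Defs.v *)
From HB Require Import structures.
From mathcomp Require Import all_boot all_order all_algebra perm.
From mathcomp Require Import mpoly.
From mathcomp Require Import generic_quotient boolp classical_sets.

Set Implicit Arguments.
Unset Strict Implicit.
Unset Printing Implicit Defensive.

Import Order.TTheory GRing.Theory Num.Theory.
Local Open Scope ring_scope.
Local Open Scope quotient_scope.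

(* All indices are 0-based: [i : 'I_n.-1] stands for the index i+1 of the     *)
(* generator exchanging the positions i+1 and i+2, whose 0-based names are    *)
(* [lo i] and [hi i].                                                         *)

Lemma lo_subproof n (i : 'I_n.-1) : (i < n)%N.
Proof. exact: leq_trans (ltn_ord i) (leq_pred n). Qed.

Lemma hi_subproof n (i : 'I_n.-1) : (i.+1 < n)%N.
Proof. by rewrite -ltn_predRL. Qed.

Definition lo n (i : 'I_n.-1) : 'I_n := Ordinal (lo_subproof i).
Definition hi n (i : 'I_n.-1) : 'I_n := Ordinal (hi_subproof i).

Section HeckeMonoid.
Variable n : nat.

Inductive hecke_cong : seq 'I_n.-1 -> seq 'I_n.-1 -> Prop :=
| hecke_idem i : hecke_cong [:: i; i] [:: i]
| hecke_comm (i j : 'I_n.-1) : (i.+1 < j)%N -> hecke_cong [:: i; j] [:: j; i]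
| hecke_braid (i j : 'I_n.-1) :
    j = i.+1 :> nat -> hecke_cong [:: i; j; i] [:: j; i; j]
| hecke_refl u : hecke_cong u u
| hecke_sym u v : hecke_cong u v -> hecke_cong v u
| hecke_trans v u w : hecke_cong u v -> hecke_cong v w -> hecke_cong u w
| hecke_cat u u' v v' :
    hecke_cong u u' -> hecke_cong v v' -> hecke_cong (u ++ v) (u' ++ v').

Definition hecke_eqv (u v : seq 'I_n.-1) : bool := `[< hecke_cong u v >].

Lemma hecke_eqv_refl : reflexive hecke_eqv.
Proof. by move=> u; apply/asboolP; apply: hecke_refl. Qed.

Lemma hecke_eqv_sym : ssrbool.symmetric hecke_eqv.
Proof. by move=> u v; apply/asboolP/asboolP; apply: hecke_sym. Qed.

Lemma hecke_eqv_trans : transitive hecke_eqv.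
Proof.
move=> v u w /asboolP uv /asboolP vw; apply/asboolP.
exact: hecke_trans uv vw.
Qed.

Canonical hecke_equiv :=
  EquivRel hecke_eqv hecke_eqv_refl hecke_eqv_sym hecke_eqv_trans.

Definition hecke := {eq_quot hecke_eqv}.
HB.instance Definition _ : EqQuotient _ hecke_eqv hecke := EqQuotient.on hecke.
HB.instance Definition _ := Choice.on hecke.

Lemma hecke_expr_exists (z : hecke) :
  exists k, `[< exists u : seq 'I_n.-1, \pi_hecke u = z /\ size u = k >].
Proof.
by exists (size (repr z)); apply/asboolP; exists (repr z); rewrite reprK.
Qed.

Definition hecke_len (z : hecke) : nat := ex_minn (hecke_expr_exists z).

End HeckeMonoid.

Section HeckeAction.
Variables (d : Order.disp_t) (T : orderType d) (n : nat).
Implicit Types (b : n.-tuple T) (z : hecke n).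

Definition sact (i : 'I_n.-1) b : n.-tuple T :=
  [tuple tnth b (tperm (lo i) (hi i) k) | k < n].

Definition sbar_act (i : 'I_n.-1) b : n.-tuple T :=
  if (tnth b (hi i) <= tnth b (lo i))%O then sact i b else b.

Definition hecke_act z b : n.-tuple T := foldr sbar_act b (repr z).

Definition decr b : n.-tuple T := [tuple of sort (fun x y => (y <= x)%O) b].

Definition is_shortest b z : Prop :=
  hecke_act z (decr b) = b /\
  forall z', hecke_act z' (decr b) = b -> (hecke_len z <= hecke_len z')%N.

Definition is_longest b z : Prop :=
  hecke_act z (decr b) = b /\
  forall z', hecke_act z' (decr b) = b -> (hecke_len z' <= hecke_len z)%N.

Definition pshort b : hecke n := xget (\pi_(hecke n) [::]) (is_shortest b).
Definition plong b : hecke n := xget (\pi_(hecke n) [::]) (is_longest b).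

End HeckeAction.

Section Demazure.
Variables (R : idomainType) (n : nat).

Definition ratfun := {fraction {mpoly R[n]}}.

Definition xvar (i : 'I_n) : ratfun := FracField.tofrac 'X_i.

Definition fsym (s : 'S_n) (f : ratfun) : ratfun :=
  FracField.tofrac (msym s \n_(repr f)) / FracField.tofrac (msym s \d_(repr f)).

Definition dem (i : 'I_n.-1) (f : ratfun) : ratfun :=
  (xvar (lo i) * f - xvar (hi i) * fsym (tperm (lo i) (hi i)) f)
  / (xvar (lo i) - xvar (hi i)).

Definition demw (z : hecke n) (f : ratfun) : ratfun := foldr dem f (repr z).

(* the unique polynomial equal to f, when f is one *)
Definition to_mpoly (f : ratfun) : {mpoly R[n]} :=
  xget 0 (fun g => FracField.tofrac g = f).

End Demazure.

Section Catalan.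
Variable n : nat.
Local Notation LF := (ratfun int n).

Definition xmon (g : n.-tuple int) : LF := \prod_(i < n) xvar int i ^ tnth g i.

Definition key (b : n.-tuple int) : LF := demw (pshort b) (xmon (decr b)).

(* The linear map fixing the key polynomials indexed by nonnegative weights   *)
(* and killing the others; f ranges over the Laurent polynomials, which are   *)
(* the f having an expansion as below, and then h does not depend on it.      *)
Definition polypart (f : LF) : LF :=
  xget 0 (fun h => exists (S : seq (n.-tuple int)) (c : n.-tuple int -> int),
    [/\ uniq S, f = \sum_(b <- S) key b *~ c b &
        h = \sum_(b <- S | all (fun k => 0 <= k) b) key b *~ c b]).

(* The coefficient of q^d in \prod_((i,j) in Psi) (1 - q x_i/x_j)^-1; each    *)
(* geometric series in q can be truncated after q^d.                          *)
Definition root_series (Psi : {set 'I_n * 'I_n}) (d : nat) : LF :=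
  (\prod_(ij in Psi)
     \poly_(k < d.+1) ((xvar int ij.1 / xvar int ij.2) ^+ k))`_d.

(* the coefficient of q^d in H(Psi; g; w) *)
Definition catalanH (Psi : {set 'I_n * 'I_n}) (g : n.-tuple int) (w : hecke n)
    (d : nat) : {mpoly int[n]} :=
  to_mpoly (demw w (polypart (root_series Psi d * xmon g))).

End Catalan.

Definition conj_part (s : seq nat) : seq nat :=
  [seq count (fun a => j < a)%N s | j <- iota 0 (head 0%N s)].

(* [:: a; a - 1; ...; b] *)
Definition down (a b : nat) : seq nat := rev (iota b (a.+1 - b)).

Fixpoint nr_Delta' (eta : seq nat) : seq nat :=
  match eta with
  | [::] => [::]
  | [:: a] => down a 2
  | a :: ((b :: _) as eta') => nseq b a ++ down a b.+1 ++ nr_Delta' eta'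
  end.

Definition Delta' (m : nat) (eta : seq nat) : {set 'I_m * 'I_m} :=
  [set ij : 'I_m * 'I_m | (ij.1 < ij.2)%N &&
    (ij.1 + nth 0 (nr_Delta' eta) ij.1 <= ij.2)%N].

Definition Delta'ext (l m : nat) (eta : seq nat) : {set 'I_l * 'I_l} :=
  [set ij : 'I_l * 'I_l | (ij.1 < ij.2)%N &&
    ((m <= ij.2)%N || (ij.1 + nth 0 (nr_Delta' eta) ij.1 <= ij.2)%N)].

Section Macdonald.
Variable l : nat.
Local Notation A := {mpoly {poly int}[l.+1]}.

(* the variable of the coefficient ring {poly int} is q *)
Definition Phi (f : A) : A :=
  f \mPo [tuple if i == ord_max then ('X)%:MP * 'X_ord0 else 'X_(ordS i)
         | i < l.+1].

Definition rot_up (b : l.+1.-tuple nat) : l.+1.-tuple nat :=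
  [tuple (tnth b (ord_pred i) + (i == ord0))%N | i < l.+1].

Definition is_Etilde (E : l.+1.-tuple nat -> A) : Prop :=
  [/\ E [tuple of nseq l.+1 0%N] = 1,
      forall (i : 'I_l) b,
        FracField.tofrac (E (sbar_act (n := l.+1) i b))
        = dem (n := l.+1) i (FracField.tofrac (E b)) &
      forall b, E (rot_up b) = 'X_ord0 * Phi (E b)].

End Macdonald.

Definition qcoef (n d : nat) (f : {mpoly {poly int}[n]}) : {mpoly int[n]} :=
  map_mpoly (coefp d) f.

Definition pad (l m : nat) (b : l.-tuple nat) : m.-tuple nat :=
  [tuple nth 0%N b i | i < m].

Definition mu (n m : nat) : n.-tuple int := [tuple (i < m)%N%:Z | i < n].

(* the substitution x_{l+1} = ... = x_m = 0 *)
Definition set_tail0 (l m : nat) (f : {mpoly int[m]}) : {mpoly int[l]} :=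
  f \mPo [tuple if insub (i : nat) is Some j then 'X_(j : 'I_l) else 0 | i < m].

(* Main.v *)
(* Write pi_i for the Demazure operators and n_1, n_2, ... for the row data of *)
(* the root ideal. The polynomial part commutes with the pi_i, kills every     *)
(* monomial whose last nonzero exponent is negative, and may be applied before *)
(* multiplying by inverse variables. If pi_w absorbs on the right the          *)
(* generators fixing the positions above n_1, then it symmetrizes the          *)
(* factor in x_2, ..., x_n, and since                                          *)
(*   pi_j ... pi_{n-1} P = sum_k x_n^k poly (h_k (1/x_j, ..., 1/x_{n-1}) P)    *)
(* for P free of x_n and symmetric in x_j, ..., x_{n-1}, the first row of the  *)
(* root ideal can be traded for the operator x_1 Phi:                          *)
(*   H (Psi; mu; w) = pi_w x_1 Phi pi_{w_0 (n_1, ..., n-1)} poly (rest),       *)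
(* where the rest is the series of the ideal without its first row. Iterating, *)
(* H becomes a word in the pi_i and x_1 Phi, and for Delta'(eta) this word     *)
(* builds alpha^+ from 0 along the recursion defining E. When m > l, setting   *)
(* the last variable to 0 turns the last pi_i into the identity and commutes   *)
(* with all other letters of the word.                                         *)

From Pilot Require Import Defs.
From HB Require Import structures.
From mathcomp Require Import all_boot all_order all_algebra perm.
From mathcomp Require Import mpoly.
From mathcomp Require Import generic_quotient boolp classical_sets.
From mathcomp Require Import zify ring.
Import Pilot.Defs.

Set Implicit Arguments.
Unset Strict Implicit.
Unset Printing Implicit Defensive.

Import Order.TTheory GRing.Theory Num.Theory.
Local Open Scope ring_scope.
Local Open Scope quotient_scope.

Local Notation tofrac := FracField.tofrac.

(** * The 0-Hecke monoid *)

(** Both sides are the same word in the operators [dem] and f -> x_1 [Phi] f, applied to 1. For E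
    this is the defining recursion: [E_Gp] identifies E at alpha^+ with [Gp], an alternation of x_1
    [Phi] with longest Demazure operators read off the row data, and the Demazure operator of the
    longest element carrying alpha^+ to alpha does the rest ([E_word]). That the row data of
    Delta'(eta) produce alpha^+ is [steps_aseq].

    For H the same word comes from [rotation], an induction on the rows. The first row contributes
    powers of x_1 times shifted complete symmetric functions in inverse variables ([row0_series]).
    The other rows are the shift of a smaller ideal without its last column ([rest_series]), a
    column that the polynomial part kills anyway ([polypart_gser]). [expand] recognizes the sum over
    the powers of the last variable as a chain of Demazure operators, and [Phi] turns the k-th power
    of that variable into q^k x_1^k ([qcoef_Phi]). The symmetrization this needs is free because the
    longest element absorbs every generator fixing alpha^+ ([plongP]).

    The polynomial part is controlled through keys: the 0-Hecke monoid acts faithfully on a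
    decreasing sequence ([hecke_cong_rho]), so keys depend on their weight only
    ([foldr_dem_dominant]); [dem] permutes them ([dem_key]); they are independent ([key_indep]); and
    the span of those with a negative entry is stable under [dem] and inverse variables
    ([negkeys_xinv]). When m exceeds the number of variables, [stl_Gp] removes the extra variables
    one at a time. *)

Definition wordn n (s : seq nat) : seq 'I_n.-1 := pmap insub s.

(** Words over all naturals, with out-of-range letters erased, let one word serve for every number
    of variables; the case of too few variables compares n with n - 1. *)
Definition ncong n (u v : seq nat) := hecke_cong (wordn n u) (wordn n v).

Lemma wordn_cat n u v : wordn n (u ++ v) = wordn n u ++ wordn n v.
Proof. exact: pmap_cat. Qed.

Lemma wordn_rev n u : wordn n (rev u) = rev (wordn n u).
Proof.
elim: u => //= x u IH; rewrite rev_cons -cats1 wordn_cat IH /=.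
by case: insubP => //= [i _ _|_]; rewrite ?cats0 // rev_cons -cats1.
Qed.

Lemma wordn_val n (u : seq 'I_n.-1) : wordn n (map val u) = u.
Proof. by elim: u => //= x u IH; rewrite /wordn /= valK /=; congr cons. Qed.

Lemma val_wordn n u : all (fun k => k < n.-1)%N u -> map val (wordn n u) = u.
Proof.
elim: u => //= x u IH /andP[xn /IH uE].
by rewrite /wordn /= insubT /=; congr cons.
Qed.

Lemma ncong_refl n u : ncong n u u. Proof. exact: hecke_refl. Qed.
Lemma ncong_sym n u v : ncong n u v -> ncong n v u.
Proof. exact: hecke_sym. Qed.
Lemma ncong_trans n v u w : ncong n u v -> ncong n v w -> ncong n u w.
Proof. exact: hecke_trans. Qed.
Lemma ncong_cat n u u' v v' :
  ncong n u u' -> ncong n v v' -> ncong n (u ++ v) (u' ++ v').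
Proof. by rewrite /ncong !wordn_cat; apply: hecke_cat. Qed.
Lemma ncong_catl n u v v' : ncong n v v' -> ncong n (u ++ v) (u ++ v').
Proof. by apply: ncong_cat; apply: ncong_refl. Qed.
Lemma ncong_catr n u u' v : ncong n u u' -> ncong n (u ++ v) (u' ++ v).
Proof. by move=> ?; apply: ncong_cat => //; apply: ncong_refl. Qed.
Lemma ncong_cons n x u v : ncong n u v -> ncong n (x :: u) (x :: v).
Proof. exact: (@ncong_catl n [:: x]). Qed.

Lemma ncong_idem n i : ncong n [:: i; i] [:: i].
Proof.
rewrite /ncong /=; case: insubP => //= *; first exact: hecke_idem.
exact: hecke_refl.
Qed.

Lemma ncong_comm n i j : (i.+1 < j)%N -> ncong n [:: i; j] [:: j; i].
Proof.
rewrite /ncong /= => ij; case: insubP => [a _ ai|_]; case: insubP => [b _ bj|_] /=;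
  try exact: hecke_refl.
by apply: hecke_comm; rewrite ai bj.
Qed.

(* A letter out of range is erased by [wordn], and then the braid relation    *)
(* degenerates into idempotency.                                              *)
Lemma ncong_braid n i : ncong n [:: i; i.+1; i] [:: i.+1; i; i.+1].
Proof.
rewrite /ncong /=; case: insubP => [a _ ai|ai]; case: insubP => [b bn bj|_] /=.
- by apply: hecke_braid; rewrite ai bj.
- exact: hecke_idem.
- by move: ai bn; lia.
- exact: hecke_refl.
Qed.

Lemma ncong_rotl n r w : all (fun x => (x.+1 < r)%N || (r.+1 < x)%N) w ->
  ncong n (r :: w) (w ++ [:: r]).
Proof.
elim: w => [_|x w IH /= /andP[xr /IH rw]]; first exact: ncong_refl.
apply: (@ncong_trans _ (x :: r :: w)); last exact: ncong_cons.
apply: (@ncong_catr _ [:: r; x] [:: x; r] w).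
by case/orP: xr => ?; [apply/ncong_sym|]; apply: ncong_comm.
Qed.

(** The letter commutes with the first t letters, forms a braid with the next two, and the lowered
    letter that comes out commutes with the rest. *)
Lemma ncong_cycle n i t k : (t.+1 < k)%N ->
  ncong n ((i + t.+1)%N :: iota i k) (iota i k ++ [:: (i + t)%N]).
Proof.
move=> tk; have -> : k = (t + (2 + (k - t - 2)))%N by lia.
rewrite !iotaD; set a := iota i t; set c := iota _ (k - t - 2).
have -> : iota (i + t) 2 = [:: (i + t); (i + t).+1]%N by [].
have -> : (i + t.+1 = (i + t).+1)%N by lia.
apply: (@ncong_trans _ (a ++ [:: (i + t).+1; (i + t); (i + t).+1]%N ++ c)).
  rewrite -[[:: _; _; _] ++ c]/([:: (i + t).+1]%N ++ [:: _; _] ++ c) [X in ncong _ _ X]catA.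
  apply: (@ncong_catr _ (_ :: a)); apply: ncong_rotl.
  by apply/allP => x; rewrite mem_iota; lia.
rewrite -!catA; apply: ncong_catl.
apply: (@ncong_trans _ ([:: (i + t); (i + t).+1; (i + t)]%N ++ c)).
  exact/ncong_catr/ncong_sym/ncong_braid.
apply: (@ncong_catl _ [:: _; _] ((i + t)%N :: c)); apply: ncong_rotl.
by apply/allP => x; rewrite mem_iota; lia.
Qed.

(* Normal forms of the submonoid generated by the first k generators: products *)
(* (s_{i_k} ... s_{k-1}) ... (s_{i_1} ... s_0).                                *)
Inductive hecke_nf : nat -> seq nat -> Prop :=
| hecke_nf0 : hecke_nf 0 [::]
| hecke_nfS k i u : (i <= k.+1)%N -> hecke_nf k u ->
    hecke_nf k.+1 (iota i (k.+1 - i) ++ u).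

(** Against the leftmost block, starting at i, the letter r commutes if r + 1 < i, prolongs the
    block if r + 1 = i, is absorbed if r = i, and crosses as r - 1 if r > i. The alternative on the
    size later shows that a generator which does not lengthen is absorbed. *)
Lemma hecke_nf_cons n k u r : hecke_nf k u -> (r < k)%N ->
  exists u', [/\ hecke_nf k u', ncong n (r :: u) u' &
                 u' = u \/ size u' = (size u).+1].
Proof.
move=> nfu; elim: nfu r => {k u} [//|k i u ik nfu IH] r rk.
have [ri|ir] := ltnP r.+1 i.
  have rk' : (r < k)%N by lia.
  have [u' [nfu' cu su]] := IH _ rk'.
  exists (iota i (k.+1 - i) ++ u'); split; first exact: hecke_nfS.
    apply: (@ncong_trans _ (iota i (k.+1 - i) ++ r :: u)); last exact: ncong_catl.
    rewrite -cat_cons -[r :: u]cat1s catA; apply/ncong_catr/ncong_rotl.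
    by apply/allP => x; rewrite mem_iota; lia.
  by case: su => [->|su]; [left|right; rewrite !size_cat su addnS].
have [ri|ri] := eqVneq r.+1 i.
  exists (iota r (k.+1 - r) ++ u); split.
  - by apply: hecke_nfS => //; apply: ltnW.
  - by rewrite -ri subSS subSn //; apply: ncong_refl.
  - by right; rewrite !size_cat !size_iota; lia.
have [rE|rni] := eqVneq r i.
  rewrite {}rE in rk *; exists (iota i (k.+1 - i) ++ u); split; [exact: hecke_nfS| |by left].
  rewrite subSn //; exact: (@ncong_catr _ [:: i; i] [:: i] _ (ncong_idem _ _)).
have rk' : (r.-1 < k)%N by lia.
have [u' [nfu' cu su]] := IH _ rk'.
exists (iota i (k.+1 - i) ++ u'); split; first exact: hecke_nfS.
  apply: (@ncong_trans _ (iota i (k.+1 - i) ++ r.-1 :: u)); last exact: ncong_catl.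
  rewrite -cat_cons -[r.-1 :: u]cat1s catA; apply: ncong_catr.
  have -> : (r = i + (r - i - 1).+1)%N by lia.
  have -> : ((i + (r - i - 1).+1).-1 = i + (r - i - 1))%N by lia.
  by apply: ncong_cycle; lia.
by case: su => [->|su]; [left|right; rewrite !size_cat su addnS].
Qed.

(** * The faithful action of the monoid on sequences *)

Definition nswap (i t : nat) : nat :=
  if t == i then i.+1 else if t == i.+1 then i else t.

Section FunAction.
Variables (d : Order.disp_t) (T : orderType d).
Implicit Types p : nat -> T.

(** The action of a generator, on infinite sequences so that no index bounds enter the relations. *)
Definition fbar (i : nat) p : nat -> T :=
  fun t => if (p i.+1 <= p i)%O then p (nswap i t) else p t.

Definition fact (u : seq nat) p : nat -> T := foldr fbar p u.

Lemma fact_cat u v p : fact (u ++ v) p = fact u (fact v p).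
Proof. exact: foldr_cat. Qed.

Lemma nswapL i : nswap i i = i.+1. Proof. by rewrite /nswap eqxx. Qed.
Lemma nswapR i : nswap i i.+1 = i.
Proof. by rewrite /nswap eqxx gtn_eqF. Qed.
Lemma nswapD i t : t != i -> t != i.+1 -> nswap i t = t.
Proof. by rewrite /nswap => /negPf -> /negPf ->. Qed.

Lemma fbar_id i p : (p i <= p i.+1)%O -> fbar i p = p.
Proof.
move=> le; apply/funext => t; rewrite /fbar; case: ifP => // ge.
have e : p i = p i.+1 by apply/le_anti; rewrite le ge.
by rewrite /nswap; do 2?[case: eqP => [->|_]] => //.
Qed.

Lemma fbar_swap i p : (p i.+1 <= p i)%O -> fbar i p = p \o nswap i.
Proof. by move=> ge; apply/funext => t; rewrite /fbar ge. Qed.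

Lemma fbar_idem i p : fbar i (fbar i p) = fbar i p.
Proof.
have [le|/ltW ge] := leP (p i) (p i.+1); first by rewrite !(fbar_id le).
by apply: fbar_id; rewrite (fbar_swap ge) /= nswapL nswapR.
Qed.

Lemma fbar_out i t p : t != i -> t != i.+1 -> fbar i p t = p t.
Proof. by move=> ti ti1; rewrite /fbar nswapD //; case: ifP. Qed.

Lemma fbar_comm i j p : (i.+1 < j)%N -> fbar i (fbar j p) = fbar j (fbar i p).
Proof.
move=> ij.
have oj t : (t < j)%N -> nswap j t = t by move=> ?; rewrite nswapD //; lia.
have oi t : (i.+1 < t)%N -> nswap i t = t by move=> ?; rewrite nswapD //; lia.
have [xi|/ltW xi] := leP (p i) (p i.+1); have [xj|/ltW xj] := leP (p j) (p j.+1).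
- by rewrite !(fbar_id xi, fbar_id xj).
- by rewrite (fbar_id xi) fbar_id // fbar_swap //= !oj //; lia.
- rewrite (fbar_id xj) [RHS]fbar_id // fbar_swap //= !oi //; lia.
rewrite (fbar_swap xi) (fbar_swap xj) !fbar_swap /= ?oi ?oj //; try lia.
apply/funext => t /=; congr p; rewrite /nswap.
have := ij; do ![case: eqP] => //; lia.
Qed.

(** Both words sort the entries i, i + 1, i + 2 increasingly; the cases are their relative
    orders. *)
Lemma fbar_braid i p :
  fbar i (fbar i.+1 (fbar i p)) = fbar i.+1 (fbar i (fbar i.+1 p)).
Proof.
have E0 : nswap i.+1 i = i by rewrite nswapD //; lia.
have E2 : nswap i i.+2 = i.+2 by rewrite nswapD //; lia.
have E := (E0, E2, nswapL, nswapR).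
have [xy|/[dup] yx' /ltW yx] := leP (p i) (p i.+1).
  rewrite (fbar_id xy).
  have [yz|/[dup] zy' /ltW zy] := leP (p i.+1) (p i.+2).
    by rewrite !(fbar_id xy, fbar_id yz).
  set q := fbar i.+1 p; have qE : q = p \o nswap i.+1 by exact: fbar_swap.
  have [xz|/[dup] zx' /ltW zx] := leP (p i) (p i.+2).
    have -> : fbar i q = q by apply: fbar_id; rewrite qE /= !E.
    by rewrite fbar_id // qE /= !E.
  have rE : fbar i q = q \o nswap i by apply: fbar_swap; rewrite qE /= !E.
  by rewrite [RHS]fbar_id // rE qE /= !E.
set q := fbar i p; have qE : q = p \o nswap i by exact: fbar_swap.
have [xz|/[dup] zx' /ltW zx] := leP (p i) (p i.+2).
  have yz := le_trans yx xz.
  have eq : fbar i.+1 q = q by apply: fbar_id; rewrite qE /= !E.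
  by rewrite !eq (fbar_id yz) -/q eq; apply: fbar_id; rewrite qE /= !E.
have rE : fbar i.+1 q = q \o nswap i.+1 by apply: fbar_swap; rewrite qE /= !E.
have [yz|/[dup] zy' /ltW zy] := leP (p i.+1) (p i.+2).
  by rewrite (fbar_id yz) -/q fbar_id // rE qE /= !E.
rewrite fbar_swap; last by rewrite rE qE /= !E.
rewrite (fbar_swap zy) (@fbar_swap i); last by rewrite /= !E.
rewrite [RHS]fbar_swap; last by rewrite /= !E.
rewrite rE qE; apply/funext => t /=; congr p.
rewrite /nswap; do ![case: eqP] => //; lia.
Qed.

End FunAction.

Lemma fact_cong d (T : orderType d) n (u v : seq 'I_n.-1) (p : nat -> T) :
  hecke_cong u v -> fact (map val u) p = fact (map val v) p.
Proof.
move=> c; elim: c p => {u v} /=.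
- by move=> i p; apply: fbar_idem.
- by move=> i j ij p; apply: fbar_comm.
- by move=> i j -> p; apply: fbar_braid.
- by [].
- by move=> u v _ IH p; rewrite IH.
- by move=> v u w _ IH1 _ IH2 p; rewrite IH1.
- by move=> u u' v v' _ IH1 _ IH2 p; rewrite !map_cat !fact_cat IH1 IH2.
Qed.

Lemma nth_sbar_act d (T : orderType d) n (x0 : T) (i : 'I_n.-1) (b : n.-tuple T) :
  nth x0 (sbar_act i b) = fbar i (nth x0 b).
Proof.
have lohi : (tnth b (lo i) = nth x0 b i) * (tnth b (hi i) = nth x0 b i.+1).
  by split; rewrite (tnth_nth x0).
rewrite /sbar_act !lohi; apply/funext => t; rewrite /fbar; case: ifP => // _.
have [tn|nt] := ltnP t n; last first.
  rewrite !nth_default ?size_tuple // /nswap; have := hi_subproof i.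
  by move: nt; case: eqP => [->|]; first lia; case: eqP => [->|]; lia.
have := tnth_nth x0 (sact i b) (Ordinal tn) => /= <-.
rewrite tnth_mktuple (tnth_nth x0); congr nth.
have [/(congr1 val) /= ti|ti] := eqVneq (Ordinal tn) (lo i).
  have -> : Ordinal tn = lo i by [apply: val_inj]; rewrite tpermL.
  by rewrite [in RHS]ti nswapL.
have [/(congr1 val) /= ti'|ti'] := eqVneq (Ordinal tn) (hi i).
  have -> : Ordinal tn = hi i by [apply: val_inj]; rewrite tpermR.
  by rewrite [in RHS]ti' nswapR.
by rewrite tpermD 1?eq_sym // nswapD.
Qed.

Definition wact d (T : orderType d) n (u : seq 'I_n.-1) (b : n.-tuple T) :=
  foldr (@sbar_act d T n) b u.

Lemma nth_wact d (T : orderType d) n (x0 : T) (u : seq 'I_n.-1) (b : n.-tuple T) :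
  nth x0 (wact u b) = fact (map val u) (nth x0 b).
Proof. by elim: u => //= i u IH; rewrite nth_sbar_act IH. Qed.

Lemma wact_cat d (T : orderType d) n (u v : seq 'I_n.-1) (b : n.-tuple T) :
  wact (u ++ v) b = wact u (wact v b).
Proof. exact: foldr_cat. Qed.

Lemma eq_tuple_nth T n (x0 : T) (b c : n.-tuple T) :
  nth x0 b = nth x0 c -> b = c.
Proof. by move=> bc; apply: eq_from_tnth => i; rewrite !(tnth_nth x0) bc. Qed.

Lemma wact_cong d (T : orderType d) n (u v : seq 'I_n.-1) (b : n.-tuple T) :
  hecke_cong u v -> wact u b = wact v b.
Proof.
case: n u v b => [|n] u v b c; first by rewrite (tuple0 (wact u b)) (tuple0 (wact v b)).
by apply: (@eq_tuple_nth _ _ (tnth b ord0)); rewrite !nth_wact (fact_cong _ c).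
Qed.

Lemma hecke_piP n (u v : seq 'I_n.-1) :
  \pi_(hecke n) u = \pi_(hecke n) v <-> hecke_cong u v.
Proof.
split=> [/eqP|c]; first by rewrite eqmodE => /asboolP.
by apply/eqP; rewrite eqmodE; apply/asboolP.
Qed.

Lemma hecke_reprP n (u : seq 'I_n.-1) : hecke_cong (repr (\pi_(hecke n) u)) u.
Proof. by apply/hecke_piP; rewrite reprK. Qed.

Lemma hecke_act_pi d (T : orderType d) n (u : seq 'I_n.-1) (b : n.-tuple T) :
  hecke_act (\pi_(hecke n) u) b = wact u b.
Proof. exact/wact_cong/hecke_reprP. Qed.

Lemma fact_out d (T : orderType d) k u (p : nat -> T) t :
  all (fun x => x < k)%N u -> (k < t)%N -> fact u p t = p t.
Proof.
elim: u => //= x u IH /andP[xk uk] kt.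
by rewrite fbar_out ?IH //; lia.
Qed.

(* The product s_i ... s_{i+k-1} moves the smallest of the entries i, ..., i+k *)
(* from the last position to the first.                                        *)
Lemma fact_cycle d (T : orderType d) i k (p : nat -> T) :
  (forall t, (i <= t < i + k)%N -> (p (i + k)%N <= p t)%O) ->
  fact (iota i k) p = fun t => if (t < i)%N then p t else
    if t == i then p (i + k)%N else if (t <= i + k)%N then p t.-1 else p t.
Proof.
elim: k i => [|k IH] i pm /=.
  rewrite addn0; apply/funext => t.
  by case: ltngtP => // ->.
rewrite IH; last by move=> t ti; rewrite addSnnS; apply: pm; lia.
rewrite fbar_swap; last first.
  by rewrite !ltnn eqxx ltnSn /= addSnnS; apply: pm; lia.
apply/funext => t /=; rewrite addSnnS.
have [->|ti] := eqVneq t i; first by rewrite nswapL !ltnn eqxx.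
have [->|ti1] := eqVneq t i.+1.
  rewrite nswapR ltnSn; have -> : (i.+1 < i)%N = false by lia.
  by have -> : (i.+1 <= i + k.+1)%N by lia.
rewrite nswapD //.
have -> : (t < i.+1)%N = (t < i)%N by lia.
by rewrite (negPf ti1).
Qed.

Lemma hecke_nf_lt k u : hecke_nf k u -> all (fun x => x < k)%N u.
Proof.
elim=> // {}k i {}u ik _ IH; rewrite all_cat; apply/andP; split.
  by apply/allP => x; rewrite mem_iota; lia.
by apply: sub_all IH => x /ltnW.
Qed.

Lemma fact_rho_ge N k u : all (fun x => x < k)%N u ->
  forall t, (t <= k)%N -> (N - k <= fact u (fun t => N - t) t)%N.
Proof.
elim: u => [_ t tk|x u IH /= /andP[xk uk] t tk]; first by rewrite /=; lia.
rewrite /fbar; case: ifP => _; apply: IH => //; rewrite /nswap.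
by case: eqP; [lia|case: eqP; lia].
Qed.

(** On the decreasing sequence N - t, the leftmost block carries the smallest value among those
    moved to the position where the block starts. That position reveals i, and deleting the value
    leaves the image under the rest of the word. *)
Lemma hecke_nf_inj N k u v : (k <= N)%N -> hecke_nf k u -> hecke_nf k v ->
  fact u (fun t => N - t)%N = fact v (fun t => N - t)%N -> u = v.
Proof.
move=> kN nfu; elim: nfu kN v => {k u} [|k i u ik nfu IH] kN v nfv.
  by inversion nfv.
inversion nfv as [|k' i' v' i'k nfv' E1 E2] => {k' E1 nfv}; subst v.
rewrite !fact_cat.
have cyc w j : hecke_nf k w -> (j <= k.+1)%N ->
    fact (iota j (k.+1 - j)) (fact w (fun t => N - t)%N) =
    fun t => if (t < j)%N then fact w (fun t => N - t)%N t else
      if t == j then (N - k.+1)%N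
      else if (t <= k.+1)%N then fact w (fun t => N - t)%N t.-1
      else fact w (fun t => N - t)%N t.
  move=> /hecke_nf_lt lw jk; rewrite fact_cycle; last first.
    move=> t; rewrite subnKC // => /andP[_ tk].
    rewrite (fact_out _ lw) //; apply: leq_trans (fact_rho_ge _ lw _) => //.
    by rewrite leq_sub2l.
  by rewrite subnKC // (fact_out _ lw).
have gew w t : hecke_nf k w -> (t <= k)%N ->
    (N - k.+1 < fact w (fun t => N - t)%N t)%N.
  move=> /hecke_nf_lt lw tk; apply: leq_trans (fact_rho_ge _ lw tk); lia.
rewrite !cyc // => e.
have ii' : i = i'.
  have /= := congr1 (@^~ i) e; rewrite ltnn eqxx.
  case: ltngtP => // [ii' h|i'i].
    by have := @gew v' i nfv'; rewrite -h; lia.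
  by rewrite ik => h; have := @gew v' i.-1 nfv'; rewrite -h; lia.
subst i'; congr (_ ++ _); apply: IH => //; first exact: ltnW.
apply/funext => t; have [tk|kt] := leqP t k; last first.
  by rewrite (fact_out _ (hecke_nf_lt nfu)) // (fact_out _ (hecke_nf_lt nfv')).
have [ti|it] := ltnP t i; first by have /= := congr1 (@^~ t) e; rewrite ti.
have /= := congr1 (@^~ t.+1) e; rewrite ltnNge (leq_trans it) //=.
by rewrite gtn_eqF ?ltnS ?tk.
Qed.

Lemma hecke_nf_exists n (u : seq 'I_n.-1) :
  exists v, [/\ hecke_nf n.-1 v, hecke_cong u (wordn n v) & (size v <= size u)%N].
Proof.
elim: u => [|i u [v [nfv cv sv]]].
  exists [::]; split=> //; last exact: hecke_refl.
  elim: (n.-1) => [|k IH]; first exact: hecke_nf0.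
  by have := hecke_nfS (leqnn k.+1) IH; rewrite subnn.
have [v' [nfv' cv' sv']] := hecke_nf_cons n nfv (ltn_ord i).
exists v'; split=> //=; last by case: sv' => ->; rewrite ?ltnS // ltnW.
apply: hecke_trans cv'; rewrite -[wordn n _]/(wordn n ([:: val i] ++ v)) wordn_cat.
rewrite -cat1s; apply: hecke_cat => //.
by have := wordn_val [:: i] => /= ->; apply: hecke_refl.
Qed.

(** Every word has a normal form, and normal forms are told apart by their effect on this one
    sequence; congruence becomes a computation. *)
Lemma hecke_cong_rho n (u v : seq 'I_n.-1) :
  fact (map val u) (fun t => n.-1 - t)%N = fact (map val v) (fun t => n.-1 - t)%N ->
  hecke_cong u v.
Proof.
have [u' [nfu cu _]] := hecke_nf_exists u.
have [v' [nfv cv _]] := hecke_nf_exists v.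
rewrite (fact_cong _ cu) (fact_cong _ cv) !val_wordn; try exact: hecke_nf_lt.
move=> /(hecke_nf_inj (leqnn _) nfu nfv) uv; subst v'.
by apply: hecke_trans cu _; apply: hecke_sym.
Qed.

Lemma hecke_nf_uniq n u v : hecke_nf n.-1 u -> hecke_nf n.-1 v -> ncong n u v -> u = v.
Proof.
move=> nfu nfv /(@fact_cong _ nat) c; apply: (hecke_nf_inj (leqnn _) nfu nfv).
by have := c (fun t => n.-1 - t)%N; rewrite !val_wordn //; apply: hecke_nf_lt.
Qed.

Lemma hecke_len_le n (u : seq 'I_n.-1) : (hecke_len (\pi_(hecke n) u) <= size u)%N.
Proof.
rewrite /hecke_len; case: ex_minnP => k _; apply; apply/asboolP.
by exists u.
Qed.

(** Normalizing never lengthens a word and normal forms are unique, so no representative is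
    shorter. *)
Lemma hecke_len_nf n v : hecke_nf n.-1 v ->
  hecke_len (\pi_(hecke n) (wordn n v)) = size v.
Proof.
move=> nfv; apply/eqP; rewrite eqn_leq; apply/andP; split.
  by apply: leq_trans (hecke_len_le _) _; rewrite size_pmap count_size.
rewrite /hecke_len; case: ex_minnP => k /asboolP[u [/hecke_piP uv <-]] _.
have [v' [nfv' cv' sv']] := hecke_nf_exists u.
suff -> : v = v' by [].
by apply: (hecke_nf_uniq nfv nfv'); apply: hecke_trans (hecke_sym uv) cv'.
Qed.

Lemma hecke_nf_size k u : hecke_nf k u -> (size u <= k * k)%N.
Proof.
elim=> // {}k i {}u ik _ IH; rewrite size_cat size_iota; nia.
Qed.

Lemma hecke_len_bound n (z : hecke n) : (hecke_len z <= n.-1 * n.-1)%N.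
Proof.
rewrite -[z]reprK; have [v [nfv /hecke_piP -> _]] := hecke_nf_exists (repr z).
by rewrite hecke_len_nf //; apply: hecke_nf_size.
Qed.

Lemma hecke_len_cons n (i : 'I_n.-1) (u : seq 'I_n.-1) :
  (hecke_len (\pi_(hecke n) (i :: u)) <= hecke_len (\pi_(hecke n) u))%N ->
  hecke_cong (i :: u) u.
Proof.
have [v [nfv cv _]] := hecke_nf_exists u.
have [v' [nfv' cv' sv']] := hecke_nf_cons n nfv (ltn_ord i).
have ciu : hecke_cong (i :: u) (wordn n v').
  apply: hecke_trans cv'; rewrite -[wordn n _]/(wordn n ([:: val i] ++ v)) wordn_cat.
  rewrite -cat1s; apply: hecke_cat => //.
  by have := wordn_val [:: i] => /= ->; apply: hecke_refl.
case: sv' => [vv'|sv'].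
  by move=> _; subst v'; apply: hecke_trans ciu _; apply: hecke_sym.
move/hecke_piP: (ciu) => ->; move/hecke_piP: (cv) => ->.
by rewrite !hecke_len_nf // sv' ltnn.
Qed.

Lemma hecke_cong_rev n (u v : seq 'I_n.-1) :
  hecke_cong u v -> hecke_cong (rev u) (rev v).
Proof.
elim=> {u v}.
- by move=> i; apply: hecke_idem.
- by move=> i j ij; apply: hecke_sym; apply: hecke_comm.
- by move=> i j ij; apply: hecke_braid.
- by move=> u; apply: hecke_refl.
- by move=> u v _ IH; apply: hecke_sym.
- by move=> v u w _ IH1 _ IH2; apply: hecke_trans IH1 IH2.
- by move=> u u' v v' _ IH1 _ IH2; rewrite !rev_cat; apply: hecke_cat.
Qed.

Lemma hecke_len_rev n (u : seq 'I_n.-1) :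
  hecke_len (\pi_(hecke n) (rev u)) = hecke_len (\pi_(hecke n) u).
Proof.
wlog suff: u / (hecke_len (\pi_(hecke n) (rev u)) <= hecke_len (\pi_(hecke n) u))%N.
  move=> H; apply/eqP; rewrite eqn_leq H //=.
  by rewrite -{1}[u]revK H.
rewrite {2}/hecke_len; case: ex_minnP => k /asboolP[v [/hecke_piP vu <-]] _.
have /hecke_piP <- := hecke_cong_rev vu.
by apply: leq_trans (hecke_len_le _) _; rewrite size_rev.
Qed.

Lemma hecke_len_rcons n (u : seq 'I_n.-1) (i : 'I_n.-1) :
  (hecke_len (\pi_(hecke n) (rcons u i)) <= hecke_len (\pi_(hecke n) u))%N ->
  hecke_cong (rcons u i) u.
Proof.
rewrite -hecke_len_rev -(hecke_len_rev u) rev_rcons => /hecke_len_cons.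
by move=> /hecke_cong_rev; rewrite rev_cons !revK.
Qed.

(** * Elements of maximal length and stabilizers of dominant weights *)

Lemma exists_longest n (P : hecke n -> Prop) : (exists z, P z) ->
  exists2 z, P z & forall z', P z' -> (hecke_len z' <= hecke_len z)%N.
Proof.
move=> [z Pz].
have ex : exists k, `[< exists2 z, P z & hecke_len z = k >].
  by exists (hecke_len z); apply/asboolP; exists z.
have ub k : `[< exists2 z, P z & hecke_len z = k >] -> (k <= n.-1 * n.-1)%N.
  by move=> /asboolP[z' _ <-]; apply: hecke_len_bound.
case: (ex_maxnP ex ub) => k /asboolP[y Py <-] ymax.
by exists y => // z' Pz'; apply: ymax; apply/asboolP; exists z'.
Qed.

Lemma parabolic_longest n (J : pred 'I_n.-1) :
  exists t, all J t /\ forall i, J i -> hecke_cong (i :: t) t.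
Proof.
have [|z [t Jt zt] tmax] :=
  @exists_longest n (fun z => exists2 t, all J t & z = \pi_(hecke n) t).
  by exists (\pi_(hecke n) [::]), [::].
exists t; split=> // i Ji; apply: hecke_len_cons; rewrite -zt; apply: tmax.
by exists (i :: t) => //=; rewrite Ji.
Qed.

Lemma big_lohi (R : Type) (idx : R) (op : Monoid.com_law idx) n (i : 'I_n.-1)
    (F : 'I_n -> R) :
  \big[op/idx]_k F k =
  op (F (lo i)) (op (F (hi i)) (\big[op/idx]_(k | (k != lo i) && (k != hi i)) F k)).
Proof.
have hl : hi i != lo i by rewrite -val_eqE /= gtn_eqF.
by rewrite (bigD1 (lo i)) // (bigD1 (hi i)).
Qed.

Lemma perm_sact d (T : orderType d) n (i : 'I_n.-1) (b : n.-tuple T) :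
  perm_eq (sact i b) b.
Proof. by apply/tuple_permP; exists (tperm (lo i) (hi i)). Qed.

Lemma sact_inv d (T : orderType d) n (i : 'I_n.-1) (b : n.-tuple T) :
  sact i (sact i b) = b.
Proof. by apply: eq_from_tnth => k; rewrite !tnth_mktuple tpermK. Qed.

Lemma perm_sbar_act d (T : orderType d) n (i : 'I_n.-1) (b : n.-tuple T) :
  perm_eq (sbar_act i b) b.
Proof. by rewrite /sbar_act; case: ifP => // _; apply: perm_sact. Qed.

Definition dominant d (T : orderType d) n (b : n.-tuple T) :=
  forall i : 'I_n.-1, (tnth b (hi i) <= tnth b (lo i))%O.

Lemma dominant_sorted d (T : orderType d) n (b : n.-tuple T) :
  dominant b <-> sorted (fun x y => (y <= x)%O) b.
Proof.
case: n b => [|n] b; first by split=> [_|_ []//]; rewrite tuple0.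
have x0 := tnth b ord0; split.
  move=> dom; apply/(sortedP x0) => k; rewrite size_tuple => kn.
  have kn' : (k < n.+1.-1)%N by [].
  by have := dom (Ordinal kn'); rewrite !(tnth_nth x0).
move=> /(sortedP x0) so i; rewrite !(tnth_nth x0) /=; apply: so.
by rewrite size_tuple (hi_subproof (n := n.+1)).
Qed.

Lemma decr_dominant d (T : orderType d) n (b : n.-tuple T) : dominant (decr b).
Proof.
by apply/dominant_sorted/sort_sorted => x y; apply: le_total.
Qed.

Lemma decr_uniq d (T : orderType d) n (b c : n.-tuple T) :
  dominant c -> perm_eq c b -> decr b = c.
Proof.
move=> /dominant_sorted so pe; apply: val_inj => /=.
have tr : transitive (fun x y : T => (y <= x)%O).
  by move=> y x z yx zy; apply: le_trans yx.
have an : antisymmetric (fun x y : T => (y <= x)%O).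
  by move=> x y /andP[yx xy]; apply/le_anti; rewrite xy.
have to : total (fun x y : T => (y <= x)%O) by move=> x y; apply: le_total.
apply: (sorted_eq tr an) => //; first exact: sort_sorted.
by rewrite perm_sort perm_sym.
Qed.

Lemma decr_perm d (T : orderType d) n (b c : n.-tuple T) :
  perm_eq b c -> decr b = decr c.
Proof.
move=> bc; apply: decr_uniq; first exact: decr_dominant.
by rewrite perm_sort perm_sym.
Qed.

Lemma decr_id d (T : orderType d) n (b : n.-tuple T) : dominant b -> decr b = b.
Proof. by move=> dom; apply: decr_uniq. Qed.

Lemma ltn_count_lt d (T : orderType d) (s : seq T) (x y : T) :
  x \in s -> (x < y)%O -> (count (fun z => z < x)%O s < count (fun z => z < y)%O s)%N.
Proof.
move=> xs xy; elim: s xs => //= z s IH.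
have sub : subpred (fun z => z < x)%O (fun z => z < y)%O.
  by move=> w wx; apply: lt_trans xy.
have le := sub_count sub s.
rewrite inE => /orP[/eqP <-|/IH {}IH]; first by rewrite ltxx xy add1n ltnS.
case zx: (z < x)%O; last by rewrite add0n; apply: leq_trans IH _; rewrite leq_addl.
by rewrite (lt_trans zx xy) ltn_add2l.
Qed.

Lemma wact_decr_exists d (T : orderType d) n (b : n.-tuple T) :
  exists u, wact u (decr b) = b.
Proof.
pose r x := count (fun z => z < x)%O b.
(* [r] ranks the entries, and [M] is large when large entries stand to the right, so undoing an
   ascent lowers it. *)
pose M (c : n.-tuple T) := (\sum_(k < n) k * r (tnth c k))%N.
suff H N (c : n.-tuple T) : perm_eq c b -> (M c < N)%N -> exists u, wact u (decr b) = c.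
  by apply: (H (M b).+1).
elim: N c => // N IH c cb Mc.
have [/existsP[i]|/existsPn dom] :=
  boolP [exists i : 'I_n.-1, (tnth c (lo i) < tnth c (hi i))%O]; last first.
  exists [::]; apply: decr_uniq => // i.
  by rewrite leNgt; apply: dom.
move=> lt.
have cE : c = sbar_act i (sact i c).
  by rewrite /sbar_act !tnth_mktuple tpermL tpermR ltW // sact_inv.
have [||u uE] := IH (sact i c); last by exists (i :: u); rewrite /= uE -cE.
  exact: perm_trans (perm_sact _ _) cb.
rewrite ltnS in Mc; apply: leq_trans Mc.
have rlt : (r (tnth c (lo i)) < r (tnth c (hi i)))%N.
  by apply: ltn_count_lt => //; rewrite -(perm_mem cb) mem_tnth.
have S (F : 'I_n -> nat) : (\sum_k F k = F (lo i) + (F (hi i) +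
    \sum_(k | (k != lo i) && (k != hi i)) F k))%N := big_lohi addn i F.
rewrite /M !S !tnth_mktuple tpermL tpermR.
rewrite (eq_bigr (fun k : 'I_n => k * r (tnth c k))%N); last first.
  by move=> k /andP[kl kh]; rewrite tnth_mktuple tpermD // eq_sym.
move: (\sum_(k | _) _)%N rlt; have : nat_of_ord (hi i) = (nat_of_ord (lo i)).+1 by [].
move: (nat_of_ord (lo i)) (nat_of_ord (hi i)) (r (tnth c (lo i))) (r (tnth c (hi i))).
by move=> a h x y -> s; rewrite !mulSn; lia.
Qed.

(** Appending a generator that fixes [decr b] gives another element carrying it to [b]. It cannot be
    longer than the longest one, hence the generator is absorbed. *)
Lemma plongP d (T : orderType d) n (b : n.-tuple T) :
  wact (repr (plong b)) (decr b) = b /\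
  forall i : 'I_n.-1, tnth (decr b) (hi i) = tnth (decr b) (lo i) ->
    hecke_cong (rcons (repr (plong b)) i) (repr (plong b)).
Proof.
have [|z zb zmax] := @exists_longest n (fun z => hecke_act z (decr b) = b).
  have [u ub] := wact_decr_exists b.
  by exists (\pi_(hecke n) u); rewrite hecke_act_pi.
have [pb pmax] : is_longest b (plong b) by rewrite /plong; apply: (@xgetI _ _ _ z).
split=> // i ii; apply: hecke_len_rcons; rewrite reprK; apply: pmax.
rewrite hecke_act_pi -cats1 wact_cat /=.
suff -> : sbar_act i (decr b) = decr b by [].
rewrite /sbar_act; case: ifP => // _; apply: eq_from_tnth => k.
rewrite tnth_mktuple; case: tpermP => [->|->|] //.
Qed.

Lemma pshortP d (T : orderType d) n (b : n.-tuple T) :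
  wact (repr (pshort b)) (decr b) = b.
Proof.
pose P k := `[< exists2 z : hecke n, hecke_act z (decr b) = b & hecke_len z = k >].
have ex : exists k, P k.
  have [u ub] := wact_decr_exists b.
  exists (hecke_len (\pi_(hecke n) u)); apply/asboolP.
  by exists (\pi_(hecke n) u); rewrite ?hecke_act_pi.
case: (ex_minnP ex) => k /asboolP[z zb zk] kmin.
have [] // : is_shortest b (pshort b).
rewrite /pshort; apply: (@xgetI _ _ _ z); split=> // z' zb'.
by rewrite zk; apply: kmin; apply/asboolP; exists z'.
Qed.

(* [p] lists the ranks of the entries of [la], ties being broken from left to  *)
(* right.                                                                      *)
Definition is_std d (T : orderType d) n (la : nat -> T) (p : nat -> nat) :=
  forall s t, (s < t < n)%N -> p s != p t /\ (p s < p t)%N = (la s <= la t)%O.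

(** Breaking ties from left to right makes [la] and [p] have the same strict descents, so the
    generator really moves both or neither. *)
Lemma is_std_fbar d (T : orderType d) n (la : nat -> T) p i : (i.+1 < n)%N ->
  is_std n la p -> is_std n (fbar i la) (fbar i p).
Proof.
move=> iN std; have [|pne ple] := std i i.+1; first by rewrite ltnSn.
have [le|lt] := leP (la i) (la i.+1).
  rewrite (fbar_id le) fbar_id //.
  by rewrite leEnat ltnW // ple.
have plt : (p i.+1 < p i)%N by move: ple; rewrite leNgt lt /=; move: pne; lia.
have pge : (p i.+1 <= p i)%O by rewrite leEnat ltnW.
rewrite (fbar_swap (ltW lt)) (fbar_swap pge) => s t st /=.
have [/andP[/eqP -> /eqP ->]|ne] := boolP ((s == i) && (t == i.+1)).
  by rewrite nswapL nswapR eq_sym pne plt ltW.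
by apply: std; move: st ne; rewrite /nswap; do ![case: eqP] => //=; lia.
Qed.

Lemma is_std_fact d (T : orderType d) n (la : nat -> T) p u :
  all (fun i => i.+1 < n)%N u -> is_std n la p -> is_std n (fact u la) (fact u p).
Proof.
by move=> au std; elim: u au => //= i u IH /andP[iN /IH]; apply: is_std_fbar.
Qed.

Lemma fact_lt n u (p : nat -> nat) : all (fun i => i.+1 < n)%N u ->
  (forall t, t < n -> p t < n)%N -> forall t, (t < n -> fact u p t < n)%N.
Proof.
move=> au pn; elim: u au => //= i u IH /andP[iN /IH {}IH] t tn.
rewrite /fbar; case: ifP => _; apply: IH => //; rewrite /nswap.
by do ![case: eqP] => //; lia.
Qed.

(** Being injective into the first n integers, [p t] counts the s with [p s < p t], and these
    comparisons are dictated by [la]. *)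
Lemma is_std_uniq d (T : orderType d) n (la : nat -> T) p p' :
  is_std n la p -> is_std n la p' -> (forall t, t < n -> p t < n)%N ->
  (forall t, t < n -> p' t < n)%N -> forall t, (t < n)%N -> p t = p' t.
Proof.
move=> std std' pn pn' t tn.
have rank (q : nat -> nat) : is_std n la q -> (forall t, t < n -> q t < n)%N ->
    q t = #|[set s : 'I_n | (q s < q t)%N]|.
  move=> stdq qn; pose f (s : 'I_n) := Ordinal (qn s (ltn_ord s)).
  have fi : injective f.
    move=> s s' /(congr1 val) /= e; apply: val_inj => /=.
    case: (ltngtP s s') => // ss'.
      by have [|] := stdq s s'; rewrite ?ss' ?e ?eqxx /=.
    by have [|] := stdq s' s; rewrite ?ss' ?e ?eqxx /=.
  have -> : [set s : 'I_n | (q s < q t)%N] = f @^-1: [set x : 'I_n | (x < q t)%N].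
    by apply/setP => s; rewrite !inE.
  rewrite card_preimset // -sum1_card.
  under eq_bigl => x do rewrite inE.
  by rewrite big_ord_narrow ?sum1_card ?card_ord // ltnW ?qn.
rewrite (rank p) // (rank p') //; apply: eq_card => s; rewrite !inE.
case: (ltngtP s t) => st.
- have [|_ ->] := std s t; first by rewrite st tn.
  by have [|_ ->] := std' s t; first by rewrite st tn.
- have [|ne e] := std t s; first by rewrite st ltn_ord.
  have [|ne' e'] := std' t s; first by rewrite st ltn_ord.
  move: ne ne' (etrans e (esym e')); clear.
  by move: (p s) (p t) (p' s) (p' t); lia.
- by rewrite st !ltnn.
Qed.

(** Take the longest word on the generators fixing [la]. Since it absorbs each of them on the left,
    they all fix its image of the decreasing sequence, which is therefore increasing on every run of
    equal entries of [la]. *)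
Lemma std_exists d (T : orderType d) n (la : n.-tuple T) (x0 : T) : dominant la ->
  exists t : seq 'I_n.-1,
    all (fun i : 'I_n.-1 => tnth la (hi i) == tnth la (lo i)) t /\
    is_std n (nth x0 la) (fact (map val t) (fun t => n.-1 - t)%N).
Proof.
move=> dom.
have [t [Jt tmax]] := @parabolic_longest n (fun i => tnth la (hi i) == tnth la (lo i)).
exists t; split=> //; set p := fact _ _.
have inv s s' : (s < s' < n)%N -> p s != p s' /\
    ((nth x0 la s' < nth x0 la s)%O -> (p s' < p s)%N).
  rewrite /p; elim: t Jt {tmax p} s s' => [_|i t IH /= /andP[/eqP ii /IH {}IH]] s s' ss'.
    by rewrite /=; split; [|move=> _]; lia.
  rewrite !(tnth_nth x0) /= in ii.
  rewrite /fbar; case: ifP => _; last exact: IH.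
  have lanswap k : nth x0 la (nswap i k) = nth x0 la k.
    by rewrite /nswap; do ?case: eqP => [->|_]; rewrite ?ii.
  have iN := hi_subproof i.
  rewrite -(lanswap s) -(lanswap s').
  have [/andP[/eqP -> /eqP ->]|ne] := boolP ((s == i) && (s' == i.+1)).
    rewrite nswapL nswapR ii ltxx; split=> //.
    by have [|] := IH i i.+1; rewrite ?ltnSn // eq_sym.
  by apply: IH; move: ss' ne iN; rewrite /nswap; do ![case: eqP] => //=; lia.
have asc (i : 'I_n.-1) : nth x0 la i.+1 = nth x0 la i -> (p i < p i.+1)%N.
  move=> ii; have iN := hi_subproof i.
  have ci : hecke_cong (i :: t) t by apply: tmax; rewrite !(tnth_nth x0) /= ii.
  have [|ne _] := inv i i.+1; first by rewrite ltnSn.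
  have := fact_cong (fun t => n.-1 - t)%N ci; rewrite /= -/p => /(congr1 (@^~ (val i))).
  by rewrite /fbar nswapL leEnat; case: leqP ne => // _ /eqP ne /esym.
move=> s s' /andP[ss' sn]; have [|ne lt] := inv s s'; first by rewrite ss'.
split=> //.
have mono a b : (a <= b < n)%N -> (nth x0 la b <= nth x0 la a)%O.
  elim: b => [|b IH]; first by rewrite leqn0 => /andP[/eqP ->].
  case/andP; rewrite leq_eqVlt => /orP[/eqP -> //|ab bn].
  apply: le_trans (IH _); last by rewrite -ltnS ab ltnW.
  have bn' : (b < n.-1)%N by rewrite ltn_predRL.
  by have := dom (Ordinal bn'); rewrite !(tnth_nth x0).
have [la_lt|la_le] := ltP (nth x0 la s') (nth x0 la s).
  by have := lt la_lt; lia.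
have {la_le} la_eq : nth x0 la s' = nth x0 la s.
  by apply/le_anti; rewrite la_le andbT mono // ltnW.
suff H b : (s < b <= s')%N -> (p s < p b)%N by apply: H; rewrite ss' leqnn.
elim: b => // b IH /andP[sb bs'].
have bn : (b < n.-1)%N by move: sn bs'; lia.
have cst c : (s <= c <= s')%N -> nth x0 la c = nth x0 la s.
  move=> /andP[sc cs]; apply/le_anti; rewrite mono ?sc ?(leq_ltn_trans cs) //=.
  by rewrite -la_eq mono // cs.
have /= lt1 : (p (Ordinal bn) < p (Ordinal bn).+1)%N.
  by apply: asc; rewrite /= !cst //; lia.
have [e|sb'] := eqVneq s b; first by rewrite {1}e.
have IHb : (p s < p b)%N by apply: IH; lia.
exact: ltn_trans IHb lt1.
Qed.

(** Followed by [t], both words send the decreasing sequence to the standardization of the common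
    weight. Standardizations are unique and the action on this sequence is faithful. *)
Lemma hecke_cong_dominant d (T : orderType d) n (la : n.-tuple T) (u v : seq 'I_n.-1) :
  dominant la -> wact u la = wact v la ->
  exists t : seq 'I_n.-1,
    all (fun i : 'I_n.-1 => tnth la (hi i) == tnth la (lo i)) t /\
    hecke_cong (u ++ t) (v ++ t).
Proof.
case: n la u v => [|n] la u v dom uv.
  exists [::]; split=> //.
  by case: u {uv} => [|[]//]; case: v => [|[]//]; apply: hecke_refl.
pose x0 := tnth la ord0; have [t [Jt std]] := std_exists x0 dom.
exists t; split=> //; apply: hecke_cong_rho; rewrite !map_cat !fact_cat.
set q := fact (map val t) _ in std *.
have au (w : seq 'I_n.+1.-1) : all (fun i => i.+1 < n.+1)%N (map val w).
  by apply/allP => x /mapP[i _ ->]; rewrite ltnS; apply: ltn_ord.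
have rn k : (k < n.+1 -> n.+1.-1 - k < n.+1)%N by move=> _; rewrite ltnS leq_subr.
have qn := fact_lt (au t) rn.
apply/funext => k; have [kn|nk] := ltnP k n.+1; last first.
  have av (w : seq 'I_n.+1.-1) : all (fun i => i < n)%N (map val w).
    by apply/allP => x /mapP[i _ ->]; apply: ltn_ord.
  by rewrite !(fact_out _ (av _)).
have e : fact (map val u) (nth x0 la) = fact (map val v) (nth x0 la).
  by rewrite -!nth_wact uv.
have su := is_std_fact (au u) std; have sv := is_std_fact (au v) std.
rewrite -e in sv; exact: (is_std_uniq su sv (fact_lt (au u) qn) (fact_lt (au v) qn)).
Qed.

(** * Demazure operators on rational functions *)

Lemma frac_repr (D : idomainType) (f : {fraction D}) :
  f = tofrac \n_(repr f) / tofrac \d_(repr f).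
Proof.
have d0 : tofrac \d_(repr f) != 0 by rewrite tofrac_eq0 denom_ratioP.
apply: (mulIf d0); rewrite mulfVK //.
rewrite -{1}[f]reprK; unlock FracField.tofrac; rewrite -[LHS]FracField.pi_mul.
apply/eqP; rewrite FracField.equivf_def /FracField.mulf.
by rewrite !numden_Ratio ?mulf_neq0 ?oner_neq0 ?denom_ratioP // !mulr1 mulrC.
Qed.

Lemma msym_neq0 (R : idomainType) n (s : 'S_n) (a : {mpoly R[n]}) :
  a != 0 -> msym s a != 0.
Proof.
move=> a0; apply: contraNneq a0 => a0.
by apply/eqP/(@inj_msym _ _ s); rewrite a0 msym0.
Qed.

Lemma div_tofrac_eq (D : idomainType) (a b c d : D) : b != 0 -> d != 0 ->
  (tofrac a / tofrac b == tofrac c / tofrac d) = (a * d == c * b).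
Proof.
move=> b0 d0; rewrite -[RHS]tofrac_eq !tofracM; apply: eqr_div; by rewrite tofrac_eq0.
Qed.

(** [fsym] is defined through a chosen representative; cross-multiplication shows that the choice is
    immaterial, which yields the morphism laws. *)
Lemma fsym_frac (R : idomainType) n (s : 'S_n) (a b : {mpoly R[n]}) : b != 0 ->
  fsym s (tofrac a / tofrac b) = tofrac (msym s a) / tofrac (msym s b).
Proof.
move=> b0; rewrite /fsym; move: (frac_repr (tofrac a / tofrac b)).
move: (repr _) => r; move: (denom_ratioP r) => d0.
move=> /eqP; rewrite div_tofrac_eq // => /eqP e.
by apply/eqP; rewrite div_tofrac_eq ?msym_neq0 // -!msymM e.
Qed.

Section Fsym.
Variables (R : idomainType) (n : nat).
Implicit Types (f g : ratfun R n) (s : 'S_n).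

Lemma ratfunP f : exists (a b : {mpoly R[n]}), b != 0 /\ f = tofrac a / tofrac b.
Proof.
by exists \n_(repr f), \d_(repr f); split; [apply: denom_ratioP|apply: frac_repr].
Qed.

Lemma fsym_tofrac s (a : {mpoly R[n]}) : fsym s (tofrac a) = tofrac (msym s a).
Proof.
have := @fsym_frac R n s a 1 (oner_neq0 _).
by rewrite msym1 !tofrac1 !divr1.
Qed.

Lemma fsymB s : {morph @fsym R n s : f g / f - g}.
Proof.
move=> f g; have [a [b [b0 ->]]] := ratfunP f; have [c [d [d0 ->]]] := ratfunP g.
rewrite (fsym_frac s _ b0) (fsym_frac s _ d0) -!mulNr -!tofracN.
rewrite !addf_div ?tofrac_eq0 ?msym_neq0 // -!tofracM -!tofracD.
by rewrite fsym_frac ?mulf_neq0 // msymD !msymM msymN.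
Qed.

Lemma fsymM s : {morph @fsym R n s : f g / f * g}.
Proof.
move=> f g; have [a [b [b0 ->]]] := ratfunP f; have [c [d [d0 ->]]] := ratfunP g.
rewrite (fsym_frac s _ b0) (fsym_frac s _ d0) !mulf_div -!tofracM.
by rewrite fsym_frac ?mulf_neq0 // !msymM.
Qed.

Lemma fsym1 s : fsym s 1 = 1 :> ratfun R n.
Proof. by rewrite -tofrac1 fsym_tofrac msym1. Qed.

HB.instance Definition _ s :=
  GRing.isZmodMorphism.Build (ratfun R n) (ratfun R n) (@fsym R n s) (fsymB s).
HB.instance Definition _ s :=
  GRing.isMonoidMorphism.Build (ratfun R n) (ratfun R n) (@fsym R n s)
    (fsym1 s, fsymM s).

Lemma fsymD s : {morph @fsym R n s : f g / f + g}.
Proof. exact: raddfD. Qed.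

Lemma msymXU s i : msym s 'X_i = 'X_(s i) :> {mpoly R[n]}.
Proof. by rewrite /msym mmapX mmap1U. Qed.

Lemma fsym_xvar s i : fsym s (xvar R i) = xvar R (s i).
Proof. by rewrite fsym_tofrac msymXU. Qed.

Lemma fsym_comp (s t : 'S_n) f : fsym s (fsym t f) = fsym (t * s)%g f.
Proof.
have [a [b [b0 ->]]] := ratfunP f.
by rewrite !fsym_frac ?msym_neq0 // !msymMm.
Qed.

Lemma fsym_id f : fsym 1%g f = f.
Proof. by have [a [b [b0 ->]]] := ratfunP f; rewrite !fsym_frac // !msym1m. Qed.

Lemma fsym_tpermK i j f : fsym (tperm i j) (fsym (tperm i j) f) = f.
Proof. by rewrite fsym_comp tperm2 fsym_id. Qed.

Lemma xvar_neq0 i : xvar R i != 0 :> ratfun R n.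
Proof.
rewrite tofrac_eq0; apply/eqP => /(congr1 (mcoeff U_(i)%MM)) /eqP.
by rewrite mcoeffX eqxx mcoeff0 oner_eq0.
Qed.

Lemma xvar_inj : injective (@xvar R n).
Proof.
move=> i j /eqP; rewrite tofrac_eq => /eqP /(congr1 (mcoeff U_(i)%MM)).
rewrite !mcoeffX eqxx; case: (@eqP _ U_(j)%MM U_(i)%MM) => [e _|_ /eqP].
  have := congr1 (fun m : 'X_{1..n} => m j) e; rewrite /= !mnm1E eqxx.
  by case: eqP.
by rewrite oner_eq0.
Qed.

Lemma xvarB_neq0 (i : 'I_n.-1) : xvar R (lo i) - xvar R (hi i) != 0.
Proof.
rewrite subr_eq0; apply/eqP => /xvar_inj /(congr1 val) /= /eqP.
by rewrite ltn_eqF.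
Qed.

Lemma dem_is_zmod_morphism (i : 'I_n.-1) : zmod_morphism (@dem R n i).
Proof. by move=> f g; rewrite /dem rmorphB /= -mulrBl; congr (_ / _); ring. Qed.

HB.instance Definition _ (i : 'I_n.-1) :=
  GRing.isZmodMorphism.Build (ratfun R n) (ratfun R n) (@dem R n i)
    (dem_is_zmod_morphism i).

Lemma dem_eqP (i : 'I_n.-1) f g :
  dem i f = g <-> (xvar R (lo i) - xvar R (hi i)) * g =
     xvar R (lo i) * f - xvar R (hi i) * fsym (tperm (lo i) (hi i)) f.
Proof.
rewrite /dem; split=> [<-|<-]; first by rewrite mulrC divfK ?xvarB_neq0.
by rewrite mulrAC divff ?mul1r ?xvarB_neq0.
Qed.

Lemma dem_mulsym (i : 'I_n.-1) c f :
  fsym (tperm (lo i) (hi i)) c = c -> dem i (c * f) = c * dem i f.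
Proof. by move=> cs; rewrite /dem rmorphM /= cs; ring. Qed.

Lemma dem_sym (i : 'I_n.-1) f :
  fsym (tperm (lo i) (hi i)) f = f -> dem i f = f.
Proof. by move=> fs; apply/dem_eqP; rewrite fs -mulrBl. Qed.

Lemma fsymV s f : fsym s f^-1 = (fsym s f)^-1.
Proof. exact: fmorphV. Qed.

Lemma fsym_dem (i : 'I_n.-1) f :
  fsym (tperm (lo i) (hi i)) (dem i f) = dem i f.
Proof.
rewrite /dem fsymM fsymV !fsymB !(fsymM _ (xvar R _)) fsym_tpermK !fsym_xvar tpermL tpermR.
by rewrite -[X in _ / X = _]opprB invrN mulrN -mulNr opprB.
Qed.

Lemma dem_idem (i : 'I_n.-1) f : dem i (dem i f) = dem i f.
Proof. exact/dem_sym/fsym_dem. Qed.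

Lemma dem_fsym_conj (i j : 'I_n.-1) (s : 'S_n) f :
  s (lo i) = lo j -> s (hi i) = hi j -> fsym s (dem i f) = dem j (fsym s f).
Proof.
move=> sl sh; rewrite /dem fsymM fsymV !fsymB !(fsymM _ (xvar R _)) !fsym_xvar sl sh !fsym_comp.
by rewrite -sl -sh -tpermJ conjgE !mulgA mulgV mul1g.
Qed.

End Fsym.

Lemma tperm_braid (T : finType) (x y z : T) : x != y -> y != z -> x != z ->
  (tperm x y * tperm y z * tperm x y = tperm y z * tperm x y * tperm y z)%g.
Proof.
move=> xy yz xz.
have E (s t : {perm T}) : (s^-1 = s -> s * t * s = t ^ s)%g by move=> {1}<-; rewrite conjgE mulgA.
rewrite !E ?tpermV // !tpermJ tpermR tpermL.
by rewrite !tpermD // 1?eq_sym.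
Qed.

Lemma dem_comm_alg (F : fieldType) (A B C D f sf tf stf : F) :
  A - B != 0 -> C - D != 0 ->
  (A * ((C * f - D * tf) / (C - D)) - B * ((C * sf - D * stf) / (C - D))) / (A - B)
  = (C * ((A * f - B * sf) / (A - B)) - D * ((A * tf - B * stf) / (A - B))) / (C - D).
Proof. by move=> ab cd; field; rewrite ab cd. Qed.

(** With s, t the two transpositions, the letters a, b, c, d, e, g stand for f, sf, tf, stf, tsf,
    stsf. *)
Lemma dem_braid_alg (F : fieldType) (x y z a b c d e g : F) :
  x - y != 0 -> y - z != 0 -> x - z != 0 ->
  (x * ((y * ((x * a - y * b) / (x - y)) - z * ((x * c - z * e) / (x - z))) / (y - z))
   - y * ((x * ((x * a - y * b) / (x - y)) - z * ((y * d - z * g) / (y - z))) / (x - z)))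
   / (x - y)
  = (y * ((x * ((y * a - z * c) / (y - z)) - y * ((x * b - z * d) / (x - z))) / (x - y))
   - z * ((x * ((y * a - z * c) / (y - z)) - z * ((x * e - y * g) / (x - y))) / (x - z)))
   / (y - z).
Proof. by move=> xy yz xz; field; rewrite xy yz xz. Qed.

Section Dem.
Variables (R : idomainType) (n : nat).
Implicit Types (f g : ratfun R n) (i j : 'I_n.-1).

Lemma fsym_dem_gen (s : 'S_n) i f :
  fsym s (dem i f) = (xvar R (s (lo i)) * fsym s f -
    xvar R (s (hi i)) * fsym s (fsym (tperm (lo i) (hi i)) f)) /
    (xvar R (s (lo i)) - xvar R (s (hi i))).
Proof.
by rewrite /dem fsymM fsymV !fsymB !(fsymM _ (xvar R _)) !fsym_xvar.
Qed.

Lemma dem_comm i j f : (i.+1 < j)%N -> dem i (dem j f) = dem j (dem i f).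
Proof.
move=> ij; rewrite {1}/dem [RHS]/dem !fsym_dem_gen.
have ne (a b : 'I_n) : (a < b)%N -> (a != b) * (b != a).
  by move=> ab; rewrite -!val_eqE ltn_eqF // gtn_eqF.
have h1 : (lo i < lo j)%N by rewrite /=; lia.
have h2 : (lo i < hi j)%N by rewrite /=; lia.
have h3 : (hi i < lo j)%N by rewrite /=; lia.
have h4 : (hi i < hi j)%N by rewrite /=; lia.
rewrite !tpermD ?(ne _ _ h1) ?(ne _ _ h2) ?(ne _ _ h3) ?(ne _ _ h4) //.
have -> : fsym (tperm (lo j) (hi j)) (fsym (tperm (lo i) (hi i)) f) =
          fsym (tperm (lo i) (hi i)) (fsym (tperm (lo j) (hi j)) f).
  rewrite !fsym_comp; congr (Defs.fsym _ f).
  by rewrite conjgC tpermJ !tpermD ?(ne _ _ h1) ?(ne _ _ h2) ?(ne _ _ h3) ?(ne _ _ h4).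
by apply: dem_comm_alg; apply: xvarB_neq0.
Qed.

Lemma dem_braid i j f : j = i.+1 :> nat ->
  dem i (dem j (dem i f)) = dem j (dem i (dem j f)).
Proof.
move=> ij; have lj : lo j = hi i by apply: val_inj.
pose x := lo i; pose y := hi i; pose z := hi j.
have xy : x != y by rewrite -val_eqE /= ltn_eqF.
have yz : y != z by rewrite -val_eqE /= ij ltn_eqF.
have xz : x != z by rewrite -val_eqE /= ij ltn_eqF // ltnW.
have [yx zy zx] : [/\ y != x, z != y & z != x] by split; rewrite eq_sym.
pose s := tperm x y; pose t := tperm y z.
have demi h : dem i h = (xvar R x * h - xvar R y * fsym s h) / (xvar R x - xvar R y) by [].
have demj h : dem j h = (xvar R y * h - xvar R z * fsym t h) / (xvar R y - xvar R z).
  by rewrite /dem lj.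
have nz (a b : 'I_n) : a != b -> xvar R a - xvar R b != 0.
  by move=> ab; rewrite subr_eq0; apply: contra_neq ab => /xvar_inj.
have G w a b h : a != b -> fsym w ((xvar R a * h - xvar R b * fsym (tperm a b) h) / (xvar R a - xvar R b))
   = (xvar R (w a) * fsym w h - xvar R (w b) * fsym w (fsym (tperm a b) h)) / (xvar R (w a) - xvar R (w b)).
  by move=> _; rewrite fsymM fsymV !fsymB !(fsymM _ (xvar R _)) !fsym_xvar.
have sx : s x = y by rewrite tpermL. have sy : s y = x by rewrite tpermR.
have sz : s z = z by rewrite tpermD.
have tx : t x = x by rewrite tpermD. have ty : t y = z by rewrite tpermL.
have tz : t z = y by rewrite tpermR.
have tdi h : fsym t (dem i h) = (xvar R x * fsym t h - xvar R z * fsym t (fsym s h)) / (xvar R x - xvar R z).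
  by rewrite demi G // tx ty.
have sdj h : fsym s (dem j h) = (xvar R x * fsym s h - xvar R z * fsym s (fsym t h)) / (xvar R x - xvar R z).
  by rewrite demj G // sy sz.
have stdi : fsym s (fsym t (dem i f)) = (xvar R y * fsym s (fsym t f) - xvar R z * fsym s (fsym t (fsym s f))) / (xvar R y - xvar R z).
  by rewrite tdi fsymM fsymV !fsymB !(fsymM _ (xvar R _)) !fsym_xvar sx sz.
have tsdj : fsym t (fsym s (dem j f)) = (xvar R x * fsym t (fsym s f) - xvar R y * fsym t (fsym s (fsym t f))) / (xvar R x - xvar R y).
  by rewrite sdj fsymM fsymV !fsymB !(fsymM _ (xvar R _)) !fsym_xvar tx tz.
have sts : fsym t (fsym s (fsym t f)) = fsym s (fsym t (fsym s f)).
  by rewrite !fsym_comp !mulgA /s /t tperm_braid.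
have si h : fsym s (dem i h) = dem i h by exact: fsym_dem.
have tj h : fsym t (dem j h) = dem j h by rewrite /t /z /y -lj fsym_dem.
rewrite (demi (dem j (dem i f))) (sdj (dem i f)) si stdi (demj (dem i f)) tdi (demi f).
rewrite (demj (dem i (dem j f))) (tdi (dem j f)) tj tsdj (demi (dem j f)) sdj (demj f) sts.
exact: dem_braid_alg (nz _ _ xy) (nz _ _ yz) (nz _ _ xz).
Qed.

Lemma foldr_dem_cong (u v : seq 'I_n.-1) f : hecke_cong u v ->
  foldr (@dem R n) f u = foldr (@dem R n) f v.
Proof.
move=> c; elim: c f => {u v} /=.
- by move=> i f; apply: dem_idem.
- by move=> i j ij f; apply: dem_comm.
- by move=> i j ij f; apply: dem_braid.
- by [].
- by move=> u v _ IH f; rewrite IH.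
- by move=> v u w _ IH1 _ IH2 f; rewrite IH1.
- by move=> u u' v v' _ IH1 _ IH2 f; rewrite !foldr_cat IH1 IH2.
Qed.

Lemma dem_mulX i (j : 'I_n) f : exists c,
  dem i (xvar R j * f) = xvar R j * dem i f +
     tofrac c * fsym (tperm (lo i) (hi i)) f.
Proof.
have [->|jl] := eqVneq j (lo i).
  exists 'X_(hi i); apply/dem_eqP; rewrite fsymM fsym_xvar tpermL mulrDr mulrCA.
  rewrite -[tofrac 'X_(hi i)]/(xvar R (hi i)).
  rewrite (iffLR (dem_eqP i f _) erefl); ring.
have [->|jh] := eqVneq j (hi i).
  exists (- 'X_(hi i)); apply/dem_eqP; rewrite fsymM fsym_xvar tpermR mulrDr mulrCA tofracN.
  rewrite -[tofrac 'X_(hi i)]/(xvar R (hi i)).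
  rewrite (iffLR (dem_eqP i f _) erefl); ring.
exists 0; rewrite tofrac0 mul0r addr0 dem_mulsym // fsym_xvar tpermD // eq_sym //.
Qed.

(** The polynomials satisfying [Q], multiplication by which preserves integrality, are closed under
    products. The twisted Leibniz rule [dem_mulX] puts every variable among them. *)
Lemma dem_poly i (a : {mpoly R[n]}) : exists g : {mpoly R[n]}, dem i (tofrac a) = tofrac g.
Proof.
pose P (a : {mpoly R[n]}) := exists g : {mpoly R[n]}, dem i (tofrac a) = tofrac g.
pose Q (b : {mpoly R[n]}) := forall a, P a -> P (b * a).
have QX (j : 'I_n) : Q 'X_j.
  move=> b [g gE]; rewrite /P tofracM -[tofrac 'X_j]/(xvar R j).
  have [c ->] := dem_mulX i j (tofrac b).
  exists ('X_j * g + c * msym (tperm (lo i) (hi i)) b).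
  by rewrite gE fsym_tofrac tofracD !tofracM.
have Q1 : Q 1 by move=> b; rewrite mul1r.
have QM b c : Q b -> Q c -> Q (b * c) by move=> Qb Qc d Pd; rewrite -mulrA; apply/Qb/Qc.
have P1 : P 1 by exists 1; rewrite tofrac1 dem_sym // fsym1.
have PX m : P 'X_[m].
  suff QXm : Q 'X_[m] by rewrite -[X in P X]mulr1; apply: QXm.
  rewrite mpolyXE_id; apply: (big_ind Q) => // j _.
  by elim: (m j) => [|k IH]; rewrite ?expr0 // exprS; apply: QM.
rewrite [a]mpolyE; apply: (big_ind P).
- by exists 0; rewrite tofrac0 raddf0.
- by move=> b c [g gE] [h hE]; exists (g + h); rewrite !tofracD raddfD /= gE hE.
- move=> m _; have [g gE] := PX m; exists (a@_m *: g).
  by rewrite -!mul_mpolyC !tofracM dem_mulsym ?gE // fsym_tofrac /msym mmapC.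
Qed.

Lemma to_mpolyK (a : {mpoly R[n]}) : to_mpoly (tofrac a) = a.
Proof.
rewrite /to_mpoly; apply: xget_unique => // b /eqP.
by rewrite tofrac_eq => /eqP.
Qed.

Definition mdem i (a : {mpoly R[n]}) : {mpoly R[n]} := to_mpoly (dem i (tofrac a)).

Lemma mdemE i a : tofrac (mdem i a) = dem i (tofrac a).
Proof. by rewrite /mdem; have [g ->] := dem_poly i a; rewrite to_mpolyK. Qed.

Lemma foldr_mdemE u a : tofrac (foldr mdem a u) = foldr (@dem R n) (tofrac a) u.
Proof. by elim: u => //= i u <-; rewrite mdemE. Qed.

Lemma tofrac_inj : injective (@tofrac {mpoly R[n]}).
Proof. by move=> a b /eqP; rewrite tofrac_eq => /eqP. Qed.

(** This division-free form can be pushed through maps such as [qcoef] and [stl]. *)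
Lemma mdem_eqP i (a b : {mpoly R[n]}) :
  mdem i a = b <-> ('X_(lo i) - 'X_(hi i)) * b =
    'X_(lo i) * a - 'X_(hi i) * msym (tperm (lo i) (hi i)) a.
Proof.
have -> : (mdem i a = b) <-> dem i (tofrac a) = tofrac b.
  by rewrite -mdemE; split=> [->//|/tofrac_inj].
rewrite dem_eqP fsym_tofrac /xvar -!tofracM -!tofracB -tofracM.
by split=> [/tofrac_inj|->].
Qed.

Lemma foldr_mdem_cong (u v : seq 'I_n.-1) a : hecke_cong u v ->
  foldr mdem a u = foldr mdem a v.
Proof. by move=> c; apply: tofrac_inj; rewrite !foldr_mdemE; apply: foldr_dem_cong. Qed.

Lemma mdem_sym i a : mdem i a = a -> msym (tperm (lo i) (hi i)) a = a.
Proof.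
move=> e; apply: tofrac_inj; rewrite -fsym_tofrac -{1}e mdemE fsym_dem -mdemE.
by rewrite e.
Qed.

End Dem.

(** * Laurent monomials and key polynomials *)

Lemma geom_alg (F : fieldType) (x y m : F) (a : int) (d : nat) :
  x != 0 -> y != 0 ->
  (x - y) * (\sum_(k < d.+1) x ^ (a + (d - k)%N%:Z) * (y ^ (a + k%:Z) * m)) =
  x * (x ^ (a + d%:Z) * (y ^ a * m)) - y * (y ^ (a + d%:Z) * (x ^ a * m)).
Proof.
move=> x0 y0; under eq_bigr => k _ do rewrite !expfzDr // -!exprnP.
rewrite !expfzDr // -!exprnP; move: (x ^ a) (y ^ a) => u v.
transitivity ((x - y) * (\sum_(k < d.+1) x ^+ (d - k) * y ^+ k) * (u * v * m)).
  rewrite -mulrA; congr (_ * _); rewrite mulr_suml; apply: eq_bigr => k _.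
  by move: (x ^+ _) (y ^+ _) => p q; ring.
by rewrite -[d]/(d.+1.-1) -subrXX !exprS; ring.
Qed.

Section Laurent.
Variable n : nat.
Local Notation LF := (ratfun int n).
Local Notation wt := (n.-tuple int).
Implicit Types (f h : LF) (g : wt) (i : 'I_n.-1).

Inductive zspan (G : LF -> Prop) : LF -> Prop :=
| zspan0 : zspan G 0
| zspan_gen f : G f -> zspan G f
| zspanB f h : zspan G f -> zspan G h -> zspan G (f - h).

Lemma zspanN G f : zspan G f -> zspan G (- f).
Proof. by move=> Gf; rewrite -sub0r; apply: zspanB => //; apply: zspan0. Qed.

Lemma zspanD G f h : zspan G f -> zspan G h -> zspan G (f + h).
Proof. by move=> Gf Gh; rewrite -[h]opprK; apply/zspanB/zspanN. Qed.

Lemma zspan_sum G (I : Type) (r : seq I) (P : pred I) (F : I -> LF) :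
  (forall k, P k -> zspan G (F k)) -> zspan G (\sum_(k <- r | P k) F k).
Proof. by move=> GF; apply: big_ind => //; [apply: zspan0|move=> *; apply: zspanD]. Qed.

Lemma zspan_additive G (M : LF -> Prop) (phi : {additive LF -> LF}) :
  (forall f, G f -> zspan M (phi f)) -> forall f, zspan G f -> zspan M (phi f).
Proof.
move=> GM f; elim=> {f} [|f /GM //|f h _ IHf _ IHh]; first by rewrite raddf0; apply: zspan0.
by rewrite raddfB; apply: zspanB.
Qed.

Lemma zspan_sub (G G' : LF -> Prop) f :
  (forall h, G h -> zspan G' h) -> zspan G f -> zspan G' f.
Proof. by move=> GG; elim=> *; [apply: zspan0|apply: GG|apply: zspanB]. Qed.

Definition mspan (C : wt -> Prop) := zspan (fun f => exists2 g, C g & f = xmon g).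

Lemma mspan_xmon (C : wt -> Prop) g : C g -> mspan C (xmon g).
Proof. by move=> Cg; apply: zspan_gen; exists g. Qed.

Lemma mspan_sub (C C' : wt -> Prop) f :
  (forall g, C g -> C' g) -> mspan C f -> mspan C' f.
Proof. by move=> CC; apply: zspan_sub => h [g /CC Cg ->]; apply: mspan_xmon. Qed.

Definition addw (g g' : wt) : wt := [tuple tnth g k + tnth g' k | k < n].

Lemma xmonM g g' : xmon g * xmon g' = xmon (addw g g').
Proof.
rewrite /xmon -big_split /=; apply: eq_bigr => k _.
by rewrite tnth_mktuple expfzDr ?xvar_neq0.
Qed.

Lemma mspanM (C C' C'' : wt -> Prop) f h :
  (forall g g', C g -> C' g' -> C'' (addw g g')) ->
  mspan C f -> mspan C' h -> mspan C'' (f * h).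
Proof.
move=> CC Cf Ch; elim: Cf => {f} [|f [g Cg ->]|f f' _ IH _ IH'].
- by rewrite mul0r; apply: zspan0.
- elim: Ch => {h} [|h [g' Cg' ->]|h h' _ IH _ IH'].
  + by rewrite mulr0; apply: zspan0.
  + by rewrite xmonM; apply/mspan_xmon/CC.
  + by rewrite mulrBr; apply: zspanB.
- by rewrite mulrBl; apply: zspanB.
Qed.

Definition setlh i g (a b : int) : wt :=
  [tuple if k == lo i then a else if k == hi i then b else tnth g k | k < n].

Lemma lo_neq_hi i : hi i != lo i.
Proof. by rewrite -val_eqE /= gtn_eqF. Qed.

Lemma setlh_lo i g a b : tnth (setlh i g a b) (lo i) = a.
Proof. by rewrite tnth_mktuple eqxx. Qed.

Lemma setlh_hi i g a b : tnth (setlh i g a b) (hi i) = b.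
Proof. by rewrite tnth_mktuple (negPf (lo_neq_hi i)) eqxx. Qed.

Lemma setlh_other i g a b k : k != lo i -> k != hi i ->
  tnth (setlh i g a b) k = tnth g k.
Proof. by rewrite tnth_mktuple => /negPf -> /negPf ->. Qed.

Lemma setlh_id i g : setlh i g (tnth g (lo i)) (tnth g (hi i)) = g.
Proof.
apply: eq_from_tnth => k; rewrite tnth_mktuple.
by case: eqP => [->//|_]; case: eqP => [->|].
Qed.

Lemma sact_setlh i g : sact i g = setlh i g (tnth g (hi i)) (tnth g (lo i)).
Proof.
apply: eq_from_tnth => k; rewrite !tnth_mktuple.
case: tpermP => [->|->|/eqP/negPf -> /eqP/negPf -> //].
  by rewrite eqxx.
by rewrite (negPf (lo_neq_hi i)) eqxx.
Qed.

Definition xrest i g : LF :=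
  \prod_(k | (k != lo i) && (k != hi i)) xvar int k ^ tnth g k.

Lemma xmon_setlh i g a b :
  xmon (setlh i g a b) = xvar int (lo i) ^ a * (xvar int (hi i) ^ b * xrest i g).
Proof.
rewrite /xmon (big_lohi _ i) /= setlh_lo setlh_hi; congr (_ * (_ * _)).
by apply: eq_bigr => k /andP[kl kh]; rewrite setlh_other.
Qed.

Lemma fsymXz s (f : LF) (z : int) : fsym s (f ^ z) = fsym s f ^ z.
Proof. exact: fmorphXz. Qed.

Lemma fsym_xrest i g : fsym (tperm (lo i) (hi i)) (xrest i g) = xrest i g.
Proof.
rewrite /xrest (rmorph_prod (@fsym int n _)) /=; apply: eq_bigr => k /andP[kl kh].
by rewrite fsymXz fsym_xvar tpermD // eq_sym.
Qed.

Lemma dem_xmon i g (a : int) (d : nat) :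
  dem i (xmon (setlh i g (a + d%:Z) a)) =
  \sum_(k < d.+1) xmon (setlh i g (a + (d - k)%N%:Z) (a + k%:Z)).
Proof.
under eq_bigr => k _ do rewrite xmon_setlh.
apply/dem_eqP; rewrite xmon_setlh.
rewrite !(fsymM _ (xvar int _ ^ _)) fsym_xrest !fsymXz !fsym_xvar tpermL tpermR.
exact: geom_alg (xvar_neq0 _ _) (xvar_neq0 _ _).
Qed.

Lemma dem_xmon_eq i g : tnth g (lo i) = tnth g (hi i) -> dem i (xmon g) = xmon g.
Proof.
move=> e; have := dem_xmon i g (tnth g (hi i)) 0.
by rewrite addr0 big_ord1 addr0 -{1 3}e setlh_id.
Qed.

(** A monomial plus its swap is symmetric, hence fixed by [dem i]; this reduces ascents to
    descents. *)
Lemma dem_xmon_swap i g : dem i (xmon g) =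
  xmon g + xmon (sact i g) - dem i (xmon (sact i g)).
Proof.
have s : fsym (tperm (lo i) (hi i)) (xmon g) = xmon (sact i g).
  rewrite -{1}(setlh_id i g) sact_setlh !xmon_setlh.
  rewrite !(fsymM _ (xvar int _ ^ _)) fsym_xrest !fsymXz !fsym_xvar tpermL tpermR.
  by rewrite mulrCA.
apply/eqP; rewrite eq_sym subr_eq -raddfD /= eq_sym; apply/eqP.
by rewrite dem_sym // fsymD -s fsym_tpermK addrC.
Qed.

End Laurent.

Lemma xinv_alg1 (F : fieldType) (x y f sf : F) : x != 0 -> y != 0 -> x - y != 0 ->
  x^-1 * ((x * f - y * sf) / (x - y)) =
  (x * (y^-1 * f) - y * (x^-1 * sf)) / (x - y) + - (y^-1 * f).
Proof. by move=> x0 y0 xy; field; rewrite x0 y0 xy. Qed.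

Lemma xinv_alg2 (F : fieldType) (x y f sf : F) : x != 0 -> y != 0 -> x - y != 0 ->
  y^-1 * ((x * f - y * sf) / (x - y)) =
  (x * (x^-1 * f) - y * (y^-1 * sf)) / (x - y) + y^-1 * f.
Proof. by move=> x0 y0 xy; field; rewrite x0 y0 xy. Qed.

(** * Key polynomials and the span of those with a negative entry *)

Section Keys.
Variable n : nat.
Local Notation LF := (ratfun int n).
Local Notation wt := (n.-tuple int).
Implicit Types (f h : LF) (g : wt) (i : 'I_n.-1).

(** The shift by k makes the measure drop strictly when an ascent is filled or merely swapped: the
    two shifted entries get closer at constant sum. *)
Let meas g : nat := absz (\sum_(k < n) (tnth g k + k%:Z) ^+ 2).

Lemma meas_setlh i g a b : tnth g (lo i) < a <= tnth g (hi i) ->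
  a + b = tnth g (lo i) + tnth g (hi i) -> (meas (setlh i g a b) < meas g)%N.
Proof.
move=> ab abE; rewrite /meas -ltz_nat !gez0_abs; try by apply: sumr_ge0 => k _; apply: sqr_ge0.
have S (F : 'I_n -> int) : \sum_k F k = F (lo i) + (F (hi i) +
    \sum_(k | (k != lo i) && (k != hi i)) F k) := big_lohi _ i F.
rewrite !S setlh_lo setlh_hi.
rewrite (eq_bigr (fun k : 'I_n => (tnth g k + k%:Z) ^+ 2)); last first.
  by move=> k /andP[kl kh]; rewrite setlh_other.
have bE : b = tnth g (lo i) + tnth g (hi i) - a by rewrite -abE; ring.
rewrite bE {bE abE S}; have -> : (hi i : nat)%:Z = (lo i : nat)%:Z + 1 by rewrite /=; lia.
move: (\sum_(k | _) _) ((lo i : nat)%:Z) (tnth g (lo i)) (tnth g (hi i)) ab.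
by move=> s t x y /andP[xa ay]; rewrite !expr2; nia.
Qed.

(* Each non-dominant monomial is, up to monomials that are closer to           *)
(* the dominant chamber, the image of such a monomial under a Demazure         *)
(* operator.                                                                   *)
Lemma dem_span_ind (J : pred 'I_n.-1) (C : wt -> Prop) (M : LF -> Prop) :
  M 0 -> (forall f h, M f -> M h -> M (f - h)) ->
  (forall i f, J i -> M f -> M (dem i f)) ->
  (forall g i, J i -> C g -> tnth g (lo i) < tnth g (hi i) ->
     forall a b, tnth g (lo i) < a <= tnth g (hi i) ->
       a + b = tnth g (lo i) + tnth g (hi i) -> C (setlh i g a b)) ->
  (forall g, C g -> (forall i, J i -> tnth g (hi i) <= tnth g (lo i)) -> M (xmon g)) ->
  forall g, C g -> M (xmon g).
Proof.
move=> M0 MB Mdem Ccl Mdom g.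
have [N] := ubnP (meas g); elim: N g => // N IH g; rewrite ltnS => mg Cg.
have [/existsP[i /andP[Ji lt]]|/existsPn dom] :=
  boolP [exists i : 'I_n.-1, J i && (tnth g (lo i) < tnth g (hi i))]; last first.
  by apply: Mdom => // i Ji; have := dom i; rewrite Ji /= -leNgt.
pose a := tnth g (lo i); pose d := `|tnth g (hi i) - a|%N.
have dE : tnth g (hi i) = a + d%:Z by rewrite /d; move: lt; rewrite -/a; lia.
have Mset k : (k < d)%N -> M (xmon (setlh i g (a + (d - k)%N%:Z) (a + k%:Z))).
  move=> kd; have h1 : tnth g (lo i) < a + (d - k)%N%:Z <= tnth g (hi i).
    by rewrite dE -/a; lia.
  have h2 : a + (d - k)%N%:Z + (a + k%:Z) = tnth g (lo i) + tnth g (hi i).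
    by rewrite dE -/a; lia.
  by apply: IH; [apply: leq_trans (meas_setlh h1 h2) mg|apply: Ccl h1 h2].
have d0 : (0 < d)%N by move: lt; rewrite dE -/a; lia.
(* The last term of the string formula is [xmon g]. Solving for it leaves terms, and an argument of
   [dem i], that are closer to dominance. *)
have := dem_xmon i g a d; rewrite big_ord_recr /= subnn addr0 -dE setlh_id => /esym/(canRL (addKr _)) ->.
have MD f h : M f -> M h -> M (f + h).
  by move=> Mf Mh; rewrite -[h]opprK -[- h]sub0r; apply: (MB) => //; apply: (MB).
rewrite addrC; apply: (MB).
  by apply: Mdem => //; have := Mset 0%N d0; rewrite subn0 addr0 -dE.
by apply: big_ind => // k _; apply: Mset.
Qed.

(** All monomials produced lie on the segment between the weight and its swap, which the closure
    condition on [C] describes. *)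
Lemma mspan_dem (C : wt -> Prop) i f :
  (forall g a b, C g -> Num.min (tnth g (lo i)) (tnth g (hi i)) <= a ->
    a <= Num.max (tnth g (lo i)) (tnth g (hi i)) ->
    a + b = tnth g (lo i) + tnth g (hi i) -> C (setlh i g a b)) ->
  mspan C f -> mspan C (dem i f).
Proof.
move=> Ccl; apply: zspan_additive => {f} f [g Cg ->].
have Cs : C (sact i g).
  by rewrite sact_setlh; apply: Ccl => //; [rewrite ge_min lexx orbT|rewrite le_max lexx orbT|rewrite addrC].
wlog ge : g Cg Cs / tnth g (hi i) <= tnth g (lo i).
  move=> H; have [ge|/ltW le] := leP (tnth g (hi i)) (tnth g (lo i)); first exact: H.
  rewrite /= dem_xmon_swap; apply: zspanB.
    by apply: zspanD; apply: mspan_xmon.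
  apply: H => //; first by rewrite sact_inv.
  by rewrite sact_setlh setlh_lo setlh_hi.
pose a := tnth g (hi i); pose d := `|tnth g (lo i) - a|%N.
have dE : tnth g (lo i) = a + d%:Z by rewrite /d; move: ge; rewrite -/a; lia.
rewrite /= -{1}(setlh_id i g) dE -/a dem_xmon; apply: zspan_sum => k _.
have := ltn_ord k; rewrite ltnS => kd.
apply/mspan_xmon/Ccl => //.
- by rewrite ge_min -/a; apply/orP; right; lia.
- by rewrite le_max dE; apply/orP; left; lia.
- by rewrite dE -/a; lia.
Qed.

(** Generators fixing [la] fix [xmon la], so the trailing word of [hecke_cong_dominant] can be
    inserted on both sides for free. Hence a key may be computed along any word leading to its
    weight. *)
Lemma foldr_dem_dominant (la : wt) u v : dominant la -> wact u la = wact v la ->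
  foldr (@dem int n) (xmon la) u = foldr (@dem int n) (xmon la) v.
Proof.
move=> dom uv; have [t [Jt c]] := hecke_cong_dominant dom uv.
have tla : foldr (@dem int n) (xmon la) t = xmon la.
  by elim: t Jt {c} => //= i t IH /andP[/eqP e /IH ->]; apply: dem_xmon_eq.
by rewrite -{1 2}tla -!foldr_cat; apply: foldr_dem_cong.
Qed.

Lemma key_dominant g : dominant g -> key g = xmon g.
Proof.
move=> dom; rewrite /key /demw (decr_id dom); have := pshortP g.
by rewrite (decr_id dom) => /(@foldr_dem_dominant _ _ [::] dom).
Qed.

Lemma dem_key i g : dem i (key g) = key (sbar_act i g).
Proof.
have de : decr (sbar_act i g) = decr g by apply/decr_perm/perm_sbar_act.
rewrite /key /demw de; apply: (@foldr_dem_dominant _ (i :: _)).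
  exact: decr_dominant.
by rewrite /= pshortP -de pshortP.
Qed.

Definition nonneg g : Prop := forall k, 0 <= tnth g k.

Lemma nonnegP g : reflect (nonneg g) (all (fun k => 0 <= k) g).
Proof.
apply: (iffP idP) => [/allP h k|h]; first by apply: h; rewrite mem_tnth.
by apply/allP => x /tnthP[k ->].
Qed.

Lemma nonneg_perm g g' : perm_eq g g' -> nonneg g -> nonneg g'.
Proof. by move=> /perm_all pe /nonnegP h; apply/nonnegP; rewrite -pe. Qed.

Definition negkeys := zspan (fun f => exists2 g, ~ nonneg g & f = key g).
Definition poskeys := zspan (fun f => exists2 g, nonneg g & f = key g).

Lemma negkeys_dem i f : negkeys f -> negkeys (dem i f).
Proof.
apply: zspan_additive => {f} f [g ng ->] /=; rewrite dem_key; apply: zspan_gen.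
exists (sbar_act i g) => // /(nonneg_perm _) H; apply/ng/H/perm_sbar_act.
Qed.

Lemma poskeys_dem i f : poskeys f -> poskeys (dem i f).
Proof.
apply: zspan_additive => {f} f [g ng ->] /=; rewrite dem_key; apply: zspan_gen.
exists (sbar_act i g) => //; apply: (@nonneg_perm g) => //.
by rewrite perm_sym; apply: perm_sbar_act.
Qed.

Definition negtail g : Prop :=
  exists2 p, tnth g p < 0 & forall t : 'I_n, (p < t)%N -> tnth g t = 0.

(** Filling an ascent keeps the last nonzero exponent negative, perhaps one place further right, and
    a dominant monomial with a negative entry is its own key. *)
Lemma negkeys_xmon g : negtail g -> negkeys (xmon g).
Proof.
apply: (@dem_span_ind predT negtail negkeys); [exact: zspan0|exact: zspanB| | | ].
- by move=> i f _; apply: negkeys_dem.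
- move=> {}g i _ [p gp gt] lt a b /andP[la ah] abE.
  have bE : b = tnth g (lo i) + tnth g (hi i) - a by rewrite -abE; ring.
  have [ph|ph] := eqVneq p (hi i).
    exists (hi i); first by rewrite setlh_hi; move: gp; rewrite ph; lia.
    move=> t ht; rewrite setlh_other ?gt ?ph //.
      by rewrite -val_eqE /= gtn_eqF // ltnW.
    by rewrite -val_eqE /= gtn_eqF.
  have [pl|pl] := eqVneq p (lo i).
    have h0 : tnth g (hi i) = 0 by apply: gt; rewrite pl /=.
    exists (hi i); first by rewrite setlh_hi; move: gp ah; rewrite pl h0; lia.
    move=> t ht; rewrite setlh_other ?gt ?pl //; first exact: ltnW.
      by rewrite -val_eqE /= gtn_eqF // ltnW.
    by rewrite -val_eqE /= gtn_eqF.
  have [hp|] := ltnP (hi i) p.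
    exists p; first by rewrite setlh_other.
    move=> t pt; rewrite setlh_other ?gt //; rewrite -val_eqE /= gtn_eqF //.
      by move: hp pt => /=; lia.
    by move: hp pt => /=; lia.
  move=> ple; have plt : (p < lo i)%N.
    by move: ple ph pl; rewrite -!val_eqE /=; lia.
  have : tnth g (lo i) = 0 /\ tnth g (hi i) = 0 by split; apply: gt => //=; apply: ltnW.
  by case=> l0 h0; move: lt; rewrite l0 h0 ltxx.
- move=> {}g [p gp _] dom; rewrite -key_dominant; last by move=> i; apply: dom.
  by apply: zspan_gen; exists g => // /(_ p); rewrite leNgt gp.
Qed.

Lemma nonneg_setlh g i a b : nonneg g -> 0 <= a <= tnth g (lo i) + tnth g (hi i) ->
  a + b = tnth g (lo i) + tnth g (hi i) -> nonneg (setlh i g a b).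
Proof.
move=> ng /andP[a0 ah] abE k; rewrite tnth_mktuple; case: eqP => // _.
by case: eqP => // _; rewrite -(lerD2l a) addr0 abE.
Qed.

Lemma poskeys_mspan f : mspan nonneg f -> poskeys f.
Proof.
apply: zspan_sub => h [g ng ->]; apply: (@dem_span_ind predT nonneg poskeys) => //.
- exact: zspan0.
- by move=> *; apply: zspanB.
- by move=> i h' _; apply: poskeys_dem.
- move=> {ng}g i _ ng lt a b /andP[la ah] abE; apply: nonneg_setlh => //.
  by have := ng (lo i); move: la ah; lia.
- move=> {ng}g ng dom; rewrite -key_dominant; last by move=> i; apply: dom.
  by apply: zspan_gen; exists g.
Qed.

Lemma mspan_nonneg_dem i f : mspan nonneg f -> mspan nonneg (dem i f).
Proof.
apply: mspan_dem => g a b ng; rewrite ge_min le_max => amin amax abE.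
apply: nonneg_setlh => //; have := ng (lo i); have := ng (hi i).
by case/orP: amin; case/orP: amax; lia.
Qed.

Lemma mspan_nonneg_key g : nonneg g -> mspan nonneg (key g).
Proof.
move=> ng; rewrite /key /demw; elim: (repr _) => /= [|i u IH].
  apply: mspan_xmon; apply: nonneg_perm ng.
  by rewrite perm_sym perm_sort.
exact: mspan_nonneg_dem.
Qed.

Lemma poskeysE f : poskeys f <-> mspan nonneg f.
Proof.
split; last exact: poskeys_mspan.
by apply: zspan_sub => h [g ng ->]; apply: mspan_nonneg_key.
Qed.

Lemma key_spans g : exists p v,
  [/\ poskeys p, negkeys v & xmon g = p + v].
Proof.
apply: (@dem_span_ind predT (fun=> True)
  (fun f => exists p v, [/\ poskeys p, negkeys v & f = p + v])) => //.
- by exists 0, 0; rewrite addr0; split=> //; apply: zspan0.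
- move=> f h [p [v [Pp Vv ->]]] [p' [v' [Pp' Vv' ->]]].
  by exists (p - p'), (v - v'); split; [exact: zspanB|exact: zspanB|ring].
- move=> i f _ [p [v [Pp Vv ->]]]; exists (dem i p), (dem i v).
  by split; [apply: poskeys_dem|apply: negkeys_dem|rewrite raddfD].
- move=> {}g _ dom; rewrite -key_dominant; last by move=> i; apply: dom.
  have [ng|ng] := boolP (all (fun k => 0 <= k) g).
    exists (key g), 0; rewrite addr0; split=> //; last exact: zspan0.
    by apply: zspan_gen; exists g => //; apply/nonnegP.
  exists 0, (key g); rewrite add0r; split=> //; first exact: zspan0.
  by apply: zspan_gen; exists g => //; apply/nonnegP.
Qed.

Definition decw g (j : 'I_n) : wt := [tuple tnth g k - (k == j)%:Z | k < n].

Lemma xinv_xmon g j : (xvar int j)^-1 * xmon g = xmon (decw g j).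
Proof.
rewrite /xmon (bigD1 j) // [RHS](bigD1 j) //= mulrA; congr (_ * _).
  by rewrite tnth_mktuple eqxx expfzDr ?xvar_neq0 // mulrC.
by apply: eq_bigr => k /negPf kj; rewrite tnth_mktuple kj subr0.
Qed.

Lemma xinv_dem i j f : exists k1 k2 (e : int),
  (xvar int j)^-1 * dem i f = dem i ((xvar int k1)^-1 * f) + ((xvar int k2)^-1 * f) *~ e.
Proof.
have x0 := xvar_neq0 int (lo i); have y0 := xvar_neq0 int (hi i).
have xy := xvarB_neq0 int i.
have [->|jl] := eqVneq j (lo i).
  exists (hi i), (hi i), (-1); rewrite mulrN1z /dem (fsymM _ (xvar int _)^-1) fsymV fsym_xvar tpermR.
  exact: (@xinv_alg1 _ (xvar int (lo i)) (xvar int (hi i)) f _ x0 y0 xy).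
have [->|jh] := eqVneq j (hi i).
  exists (lo i), (hi i), 1; rewrite mulr1z /dem (fsymM _ (xvar int _)^-1) fsymV fsym_xvar tpermL.
  exact: (@xinv_alg2 _ (xvar int (lo i)) (xvar int (hi i)) f _ x0 y0 xy).
exists j, j, 0; rewrite mulr0z addr0 dem_mulsym // fsymV fsym_xvar tpermD // eq_sym //.
Qed.

Lemma zspanMz G f (e : int) : zspan G f -> zspan G (f *~ e).
Proof.
move=> Gf; have P k : zspan G (f *+ k).
  by elim: k => [|k IH]; [exact: zspan0|rewrite mulrS; apply: zspanD].
by case: e => k; [exact: P|apply/zspanN/P].
Qed.

(** [xinv_dem] moves the inverse variable through the word of a key, at the cost of other inverse
    variables only. It reaches the dominant monomial, whose last exponent is negative and stays
    so. *)
Lemma negkeys_xinv f j : negkeys f -> negkeys ((xvar int j)^-1 * f).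
Proof.
elim=> {f} [|f [g ng ->]|f h _ IHf _ IHh].
- by rewrite mulr0; apply: zspan0.
- rewrite /key /demw; elim: (repr _) j => [|i u IH] j /=; last first.
    have [k1 [k2 [e ->]]] := xinv_dem i j (foldr (@dem int n) (xmon (decr g)) u).
    by apply: zspanD; [apply/negkeys_dem/IH|apply/zspanMz/IH].
  rewrite xinv_xmon; apply: negkeys_xmon.
  have n0 : (n.-1 < n)%N by rewrite ltn_predL; apply: leq_ltn_trans (ltn_ord j).
  have lastP (t : 'I_n) : (t <= Ordinal n0)%N by rewrite -ltnS prednK // (leq_ltn_trans _ (ltn_ord j)).
  exists (Ordinal n0); last by move=> t; rewrite ltnNge lastP.
  rewrite tnth_mktuple; set la := decr g.
  suff : tnth la (Ordinal n0) < 0 by case: (_ == _) => /=; lia.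
  rewrite ltNge; apply/negP => la0; apply: ng.
  apply: (@nonneg_perm la); first by rewrite perm_sort.
  move=> k; apply: le_trans la0 _.
  have so : sorted (fun x y : int => (y <= x)%O) la by apply/dominant_sorted/decr_dominant.
  rewrite !(tnth_nth 0); apply: (sorted_leq_nth _ _ 0 so) => //.
  + by move=> y x z yx zy; apply: le_trans yx.
  + by rewrite inE size_tuple.
  + by rewrite inE size_tuple.
- by rewrite mulrBr; apply: zspanB.
Qed.

End Keys.

(** * Linear independence of the key polynomials *)

Section Box.
Variables (n M : nat).
Local Notation LF := (ratfun int n).
Local Notation wt := (n.-tuple int).
Local Notation box := (n.-tuple 'I_(2 * M).+1).
Local Notation N := #|{: box}|.

(** The exponents between -M and M form a finite set stable under the action, on which keys and
    monomials span each other; independence becomes a matrix question. *)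
Definition emb (t : box) : wt := [tuple (tnth t k : nat)%:Z - M%:Z | k < n].
Definition boxed (g : wt) := forall k, - M%:Z <= tnth g k <= M%:Z.

Lemma emb_inj : injective emb.
Proof.
move=> t t' e; apply: eq_from_tnth => k; apply: val_inj.
have := congr1 (fun g => tnth g k) e; rewrite !tnth_mktuple => /addIr.
by case.
Qed.

Lemma boxed_emb t : boxed (emb t).
Proof. by move=> k; rewrite tnth_mktuple; have := ltn_ord (tnth t k); lia. Qed.

Lemma emb_boxed g : boxed g -> exists t, emb t = g.
Proof.
move=> bg; exists [tuple inord (absz (tnth g k + M%:Z)) | k < n].
apply: eq_from_tnth => k; rewrite !tnth_mktuple; have := bg k.
by move=> /andP[? ?]; rewrite inordK; lia.
Qed.

Lemma zspan_fin (T : finType) (F : T -> LF) (Q : T -> Prop) f :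
  zspan (fun f => exists2 t, Q t & f = F t) f ->
  exists c : T -> int, f = \sum_t F t *~ c t /\ forall t, c t != 0 -> Q t.
Proof.
elim=> {f} [|f [t Qt ->]|f h _ [c [-> cQ]] _ [c' [-> cQ']]].
- by exists (fun=> 0); split; [rewrite big1|move=> t; rewrite eqxx].
- exists (fun t' => if t' == t then 1 else 0); split.
    rewrite (bigD1 t) //= eqxx mulr1z big1 ?addr0 // => t' /negPf ->.
    by rewrite mulr0z.
  by move=> t'; case: (t' =P t) => [-> //|_]; rewrite eqxx.
- exists (fun t => c t - c' t); split.
    by rewrite -sumrB; apply: eq_bigr => t _; rewrite mulrzBr.
  move=> t; have [c0|c0 _] := eqVneq (c t) 0; last exact: cQ.
  by rewrite c0 sub0r oppr_eq0; apply: cQ'.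
Qed.

Let mm (j : 'I_N) : LF := xmon (emb (enum_val j)).
Let kk (j : 'I_N) : LF := key (emb (enum_val j)).

Lemma xmon_indep (c : 'I_N -> int) : \sum_j mm j *~ c j = 0 -> forall j, c j = 0.
Proof.
(* Multiplication by [X] turns the Laurent monomials of the box into distinct ordinary ones. *)
pose X : LF := \prod_(k < n) xvar int k ^+ M.
pose mt (t : box) : 'X_{1..n} := [multinom nat_of_ord (tnth t k) | k < n].
have mtE t : xmon (emb t) * X = tofrac 'X_[mt t].
  rewrite mpolyXE_id rmorph_prod -big_split /=; apply: eq_bigr => k _.
  rewrite tnth_mktuple mnmE tofracXn -[tofrac _]/(xvar int k).
  rewrite (exprnP _ M) -expfzDr ?xvar_neq0 // subrK.
  by rewrite -exprnP.
have mt_inj : injective mt.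
  move=> t t' e; apply: eq_from_tnth => k; apply: val_inj => /=.
  by have := congr1 (fun m : 'X_{1..n} => m k) e; rewrite /= !mnmE.
move=> /(congr1 (fun f => f * X)); rewrite mul0r mulr_suml => e j.
have : tofrac (\sum_j 'X_[mt (enum_val j)] *~ c j) = 0 :> LF.
  rewrite raddf_sum -[RHS]e; apply: eq_bigr => k _.
  by rewrite raddfMz /= -mtE mulrzAl.
move=> /eqP; rewrite tofrac_eq0 => /eqP /(congr1 (mcoeff (mt (enum_val j)))).
rewrite mcoeff0 raddf_sum (bigD1 j) //= big1 => [|k kj].
  by rewrite addr0 raddfMz /= mcoeffX eqxx intz.
rewrite raddfMz /= mcoeffX; case: eqP => [/mt_inj/enum_val_inj ekj|_].
  by rewrite ekj eqxx in kj.
by rewrite mul0rz.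
Qed.

Lemma kk_span i : exists c : 'I_N -> int, kk i = \sum_j mm j *~ c j.
Proof.
have : mspan boxed (kk i).
  rewrite /kk /key /demw; set g := emb _.
  have bg : boxed (decr g).
    move=> k; have : tnth (decr g) k \in (g : seq int).
      by have := mem_tnth k (decr g); rewrite mem_sort.
    by move=> /tnthP[k' ->]; apply: boxed_emb.
  elim: (repr _) => /= [|a u IH]; first exact: mspan_xmon.
  apply: mspan_dem IH => g' p q bg'; rewrite ge_min le_max => pmin pmax pq k.
  rewrite tnth_mktuple; have := bg' (lo a); have := bg' (hi a).
  case: eqP => _; first by case/orP: pmin; case/orP: pmax; lia.
  by case: eqP => // _; case/orP: pmin; case/orP: pmax; lia.
move=> sp; have [|c [-> _]] := @zspan_fin _ mm (fun=> True) (kk i); last by exists c.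
apply: zspan_sub sp => h [g /emb_boxed[t <-] ->]; apply: zspan_gen.
by exists (enum_rank t) => //; rewrite /mm enum_rankK.
Qed.

Lemma mm_span i : exists c : 'I_N -> int, mm i = \sum_j kk j *~ c j.
Proof.
have [|c [-> _]] := @zspan_fin _ kk (fun=> True) (mm i); last by exists c.
have kkb g : boxed g -> zspan (fun f => exists2 t, True & f = kk t) (key g).
  move=> /emb_boxed[t <-]; apply: zspan_gen.
  by exists (enum_rank t) => //; rewrite /kk enum_rankK.
apply: (@dem_span_ind n predT boxed) => //; last exact: boxed_emb.
- exact: zspan0.
- by move=> *; apply: zspanB.
- move=> a f _; apply: zspan_additive => {f} f [t _ ->] /=.
  rewrite dem_key; apply: kkb => k.
  have : tnth (sbar_act a (emb (enum_val t))) k \in (emb (enum_val t) : seq int).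
    by rewrite -(perm_mem (perm_sbar_act a _)) mem_tnth.
  by move=> /tnthP[k' ->]; apply: boxed_emb.
- move=> g a _ bg lt p q /andP[lp ph] pq k; rewrite tnth_mktuple.
  have := bg (lo a); have := bg (hi a).
  by case: eqP => [_|_]; [|case: eqP => // _]; lia.
- move=> g bg dom; rewrite -key_dominant; last by move=> a; apply: dom.
  exact: kkb.
Qed.

(** Independence of monomials makes one product of the two square transition matrices the identity,
    hence also the other. A relation between keys becomes a relation between monomials, and the
    matrix can be cancelled. *)
Lemma key_indep (c : 'I_N -> int) : \sum_j kk j *~ c j = 0 -> forall j, c j = 0.
Proof.
have /choice[A AE] := kk_span; have /choice[B BE] := mm_span.
pose MA := \matrix_(i, j) A i j; pose MB := \matrix_(i, j) B i j.
have BA : MB *m MA = 1%:M.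
  apply/matrixP => i j; rewrite !mxE; apply/eqP; rewrite -subr_eq0; apply/eqP.
  move: j; apply: xmon_indep.
  under eq_bigr => j _ do rewrite mulrzBr.
  rewrite sumrB; apply/eqP; rewrite subr_eq0; apply/eqP.
  rewrite [RHS](bigD1 i) //= eqxx mulr1z [X in _ = _ + X]big1 ?addr0; last first.
    by move=> j ji; rewrite eq_sym (negPf ji) mulr0z.
  rewrite BE; under [RHS]eq_bigr => k _ do rewrite AE.
  under [RHS]eq_bigr => k _ do rewrite mulrz_suml.
  rewrite exchange_big /=; apply: eq_bigr => j _; rewrite mulrz_sumr.
  by apply: eq_bigr => k _; rewrite !mxE mulrC mulrzA.
have AB := mulmx1C BA.
move=> e; have cA : (\row_j c j) *m MA = 0.
  apply/rowP => j; rewrite !mxE; move: j; apply: xmon_indep.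
  rewrite -[RHS]e; under [RHS]eq_bigr => k _ do rewrite AE.
  under [RHS]eq_bigr => k _ do rewrite mulrz_suml.
  rewrite exchange_big /=; apply: eq_bigr => j _; rewrite mulrz_sumr.
  by apply: eq_bigr => k _; rewrite !mxE mulrC mulrzA.
move=> j; have := congr1 (fun m => (m *m MB) 0 j) cA.
by rewrite -mulmxA AB mulmx1 mul0mx !mxE.
Qed.

Lemma key_emb_indep (c : box -> int) :
  \sum_t key (emb t) *~ c t = 0 -> forall t, c t = 0.
Proof.
rewrite (reindex (enum_val : 'I_N -> box)) /=; last first.
  by apply: onW_bij; apply: enum_val_bij.
by move=> /key_indep H t; rewrite -(enum_rankK t) H.
Qed.

End Box.

(** * The polynomial part *)

Section PolyPart.
Variable n : nat.
Local Notation LF := (ratfun int n).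
Local Notation wt := (n.-tuple int).
Implicit Types (f h p v : LF) (g : wt).

(** Valid for all large [M], so that two expansions can be compared in a common box. *)
Lemma key_zspan_box (Q : wt -> Prop) f :
  zspan (fun f => exists2 g, Q g & f = key g) f ->
  exists M0, forall M, (M0 <= M)%N ->
    exists c : n.-tuple 'I_(2 * M).+1 -> int,
      f = \sum_t key (emb t) *~ c t /\ forall t, c t != 0 -> Q (emb t).
Proof.
move=> sp; suff [M0 H] : exists M0, forall M, (M0 <= M)%N ->
    zspan (fun f => exists2 t : n.-tuple 'I_(2 * M).+1, Q (emb t) & f = key (emb t)) f.
  by exists M0 => M /H /zspan_fin.
elim: sp => {f} [|f [g Qg ->]|f h _ [M1 H1] _ [M2 H2]].
- by exists 0%N => M _; apply: zspan0.
- exists (\sum_k absz (tnth g k))%N => M MM.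
  have [|t tE] := @emb_boxed n M g; last by apply: zspan_gen; exists t; rewrite tE.
  move=> k; suff : (absz (tnth g k) <= M)%N by lia.
  by apply: leq_trans MM; rewrite (bigD1 k) //= leq_addr.
- exists (maxn M1 M2) => M; rewrite geq_max => /andP[/H1 Hf /H2 Hh].
  exact: zspanB.
Qed.

Lemma poskeys_negkeys_disjoint f : poskeys f -> negkeys f -> f = 0.
Proof.
move=> /key_zspan_box[M1 H1] /key_zspan_box[M2 H2].
have [c [fE cP]] := H1 _ (leq_maxl M1 M2).
have [c' [fE' cP']] := H2 _ (leq_maxr M1 M2).
have cc' t : c t = c' t.
  apply/eqP; rewrite -subr_eq0; apply/eqP; move: t; apply: key_emb_indep.
  under eq_bigr => t _ do rewrite mulrzBr.
  by rewrite sumrB -fE -fE' subrr.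
rewrite fE big1 // => t _; have [->|ct] := eqVneq (c t) 0; first by rewrite mulr0z.
by case: (cP' t); [rewrite -cc'|exact: cP].
Qed.

(** Independence of the keys makes the expansion chosen by [polypart] irrelevant: only the splitting
    into nonnegative and negative keys counts, and later arguments use only that. *)
Lemma polypart_unique p v : mspan (@nonneg n) p -> negkeys v -> polypart (p + v) = p.
Proof.
move=> /poskeysE Pp Vv; apply: xget_unique; last first.
  move=> h [S [c [uS pvE hE]]].
  have Ph : poskeys h.
    rewrite hE; apply: zspan_sum => b /nonnegP nb; apply/zspanMz/zspan_gen.
    by exists b.
  have Vh : negkeys (p + v - h).
    rewrite pvE hE (bigID (fun b => all (fun k => 0 <= k) (b : wt))) /= addrAC subrr add0r.
    by apply: zspan_sum => b /nonnegP nb; apply/zspanMz/zspan_gen; exists b.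
  apply/eqP; rewrite -subr_eq0; apply/eqP.
  apply: poskeys_negkeys_disjoint; first exact: zspanB.
  (* The same element is a combination of nonnegative keys on the left and of negative keys on the
     right, hence zero. *)
  have -> : h - p = v - (p + v - h) by ring.
  exact: zspanB.
have [M1 H1] := key_zspan_box Pp; have [M2 H2] := key_zspan_box Vv.
have [c [pE cP]] := H1 _ (leq_maxl M1 M2).
have [c' [vE cP']] := H2 _ (leq_maxr M1 M2).
set M := maxn M1 M2 in c pE cP c' vE cP'.
pose C (b : wt) := if [pick t : n.-tuple 'I_(2 * M).+1 | emb t == b] is Some t
  then c t + c' t else 0.
have CE t : C (emb t) = c t + c' t.
  rewrite /C; case: pickP => [t' /eqP/emb_inj -> //|/(_ t)].
  by rewrite eqxx.
exists [seq emb t | t <- index_enum [the finType of n.-tuple 'I_(2 * M).+1]], C; split.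
- rewrite map_inj_uniq; [exact: index_enum_uniq|exact: emb_inj].
- rewrite big_map pE vE -big_split /=; apply: eq_bigr => t _.
  by rewrite CE mulrzDr.
- rewrite big_map pE (bigID (fun t : n.-tuple 'I_(2 * M).+1 => all (fun k => 0 <= k) (emb t))) /=.
  rewrite [X in _ + X]big1 ?addr0.
    apply: eq_bigr => t /(nonnegP (emb t)) nt; rewrite CE.
    have [->|ct'] := eqVneq (c' t) 0; first by rewrite addr0.
    by have := cP' _ ct' nt.
  move=> t nt; have [->|ct] := eqVneq (c t) 0; first by rewrite mulr0z.
  by case/(nonnegP (emb t)): nt; apply: cP.
Qed.

Definition laurent := mspan (fun _ : wt => True).

Lemma laurent_decomp f : laurent f ->
  exists p v, [/\ mspan (@nonneg n) p, negkeys v, f = p + v & polypart f = p].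
Proof.
move=> Lf; suff [p [v [Pp Vv ->]]] : exists p v, [/\ mspan (@nonneg n) p, negkeys v & f = p + v].
  by exists p, v; split=> //; apply: polypart_unique.
elim: Lf => {f} [|f [g _ ->]|f h _ [p [v [Pp Vv ->]]] _ [p' [v' [Pp' Vv' ->]]]].
- by exists 0, 0; rewrite addr0; split=> //; apply: zspan0.
- have [p [v [Pp Vv ->]]] := key_spans g.
  by exists p, v; split=> //; apply/poskeysE.
- by exists (p - p'), (v - v'); split; [exact: zspanB|exact: zspanB|ring].
Qed.

Lemma polypart_id p : mspan (@nonneg n) p -> polypart p = p.
Proof. by move=> Pp; rewrite -{1}[p]addr0; apply: polypart_unique => //; apply: zspan0. Qed.

Lemma polypart_neg v : negkeys v -> polypart v = 0.
Proof. by move=> Vv; rewrite -[v]add0r; apply: polypart_unique => //; apply: zspan0. Qed.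

Lemma polypartB f h : laurent f -> laurent h ->
  polypart (f - h) = polypart f - polypart h.
Proof.
move=> /laurent_decomp[p [v [Pp Vv -> ->]]] /laurent_decomp[p' [v' [Pp' Vv' -> ->]]].
have -> : p + v - (p' + v') = (p - p') + (v - v') by ring.
by apply: polypart_unique; apply: zspanB.
Qed.

Lemma polypart0 : polypart (0 : LF) = 0.
Proof. by apply: polypart_id; apply: zspan0. Qed.

Lemma polypartD f h : laurent f -> laurent h ->
  polypart (f + h) = polypart f + polypart h.
Proof.
move=> Lf Lh; rewrite -[h]opprK polypartB //; last exact: zspanN.
rewrite -{1}[- h]sub0r polypartB ?polypart0 //; last exact: zspan0.
by rewrite sub0r !opprK.
Qed.

Lemma polypart_sum (I : Type) (r : seq I) (P : pred I) (F : I -> LF) :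
  (forall k, P k -> laurent (F k)) ->
  polypart (\sum_(k <- r | P k) F k) = \sum_(k <- r | P k) polypart (F k).
Proof.
move=> LF'; elim: r => [|a r IH]; first by rewrite !big_nil polypart0.
rewrite !big_cons; case: ifP => // Pa; rewrite polypartD ?IH //; first exact: LF'.
exact: zspan_sum.
Qed.

Lemma laurent_dem i f : laurent f -> laurent (dem i f).
Proof. exact: mspan_dem. Qed.

Lemma polypart_dem i f : laurent f -> polypart (dem i f) = dem i (polypart f).
Proof.
move=> /laurent_decomp[p [v [Pp Vv -> ->]]]; rewrite raddfD /=.
by apply: polypart_unique; [apply: mspan_nonneg_dem|apply: negkeys_dem].
Qed.

Lemma polypart_foldr_dem u f : laurent f ->
  polypart (foldr (@dem int n) f u) = foldr (@dem int n) (polypart f) u.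
Proof.
move=> Lf; suff [//] : laurent (foldr (@dem int n) f u) /\
  polypart (foldr (@dem int n) f u) = foldr (@dem int n) (polypart f) u.
elim: u => //= i u [Lu IH]; split; first exact: laurent_dem.
by rewrite (polypart_dem i Lu) IH.
Qed.

Definition negexp (g : wt) : Prop := forall k, tnth g k <= 0.

(* The span of the key polynomials killed by [polypart] is stable under the    *)
(* inverse variables, so [polypart] may be applied before multiplying by them. *)
Lemma polypart_mulinv m f : mspan negexp m -> laurent f ->
  polypart (m * polypart f) = polypart (m * f).
Proof.
move=> Nm Lf.
have Lm : laurent m by apply: mspan_sub Nm.
have LM a b : laurent a -> laurent b -> laurent (a * b) by apply: mspanM.
have [p [v [Pp Vv fE ->]]] := laurent_decomp Lf.
have Lp : laurent p by apply: mspan_sub Pp.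
have Lv : laurent v by rewrite (_ : v = f - p); [exact: zspanB|rewrite fE addrC addKr].
rewrite fE mulrDr polypartD; [|exact: LM|exact: LM].
rewrite [polypart (m * v)]polypart_neg ?addr0 //.
elim: Nm {Lm} => {m} [|m [g ng ->]|a b _ IHa _ IHb].
- by rewrite mul0r; apply: zspan0.
- have [N] := ubnP (\sum_k absz (tnth g k))%N; elim: N g ng => // N IH g ng gN.
  have [/forallP g0|/forallPn[j gj]] := boolP [forall k, tnth g k == 0].
    by rewrite /xmon big1 ?mul1r // => k _; rewrite (eqP (g0 k)) expr0z.
  have gj1 : tnth g j <= -1 by have := ng j; move: gj; lia.
  pose g' : wt := [tuple tnth g k + (k == j)%:Z | k < n].
  have -> : xmon g = (xvar int j)^-1 * xmon g'.
    rewrite xinv_xmon; congr xmon; apply: eq_from_tnth => k.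
    by rewrite !tnth_mktuple addrK.
  rewrite -mulrA; apply: negkeys_xinv; apply: IH.
    by move=> k; rewrite tnth_mktuple; case: eqP => [->|_]; rewrite ?addr0 //; lia.
  move: gN; rewrite ltnS; apply: leq_trans.
  rewrite (bigD1 j) // [X in (_ < X)%N](bigD1 j) //= tnth_mktuple eqxx.
  rewrite (eq_bigr (fun k => absz (tnth g k))); first by lia.
  by move=> k /negPf kj; rewrite tnth_mktuple kj addr0.
- by rewrite mulrBl; apply: zspanB.
Qed.

End PolyPart.

(** * Root series *)

Section Series.
Variables (F : comNzRingType) (I : finType).
Implicit Types (P Q : pred I) (r : I -> F).

(** This is the complete homogeneous symmetric function of degree d of the family [r]. *)
Definition ser P r (d : nat) : F :=
  (\prod_(i | P i) \poly_(k < d.+1) (r i) ^+ k)`_d.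

Lemma coefM_congr (p p' q q' : {poly F}) D :
  (forall d, (d <= D)%N -> p`_d = p'`_d) -> (forall d, (d <= D)%N -> q`_d = q'`_d) ->
  forall d, (d <= D)%N -> (p * q)`_d = (p' * q')`_d.
Proof.
move=> pp qq d dD; rewrite !coefM; apply: eq_bigr => k _.
have kd : (k <= d)%N by rewrite -ltnS.
by rewrite pp ?qq //; lia.
Qed.

Lemma ser_trunc P r d D : (d <= D)%N ->
  (\prod_(i | P i) \poly_(k < D.+1) (r i) ^+ k)`_d = ser P r d.
Proof.
move=> dD; rewrite /ser.
suff H e : (e <= d)%N -> (\prod_(i | P i) \poly_(k < D.+1) r i ^+ k)`_e =
    (\prod_(i | P i) \poly_(k < d.+1) r i ^+ k)`_e by apply: H.
move: e; apply: (big_ind2 (fun p q : {poly F} => forall e, (e <= d)%N -> p`_e = q`_e)) => //.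
  by move=> p p' q q' pp qq e ed; apply: (coefM_congr pp qq).
by move=> i _ e ed; rewrite !coef_poly !ltnS ed (leq_trans ed dD).
Qed.

Lemma eq_ser P Q r r' d : P =1 Q -> (forall i, P i -> r i = r' i) -> ser P r d = ser Q r' d.
Proof.
move=> PQ rr; rewrite /ser (eq_bigl _ _ PQ); congr ((polyseq _)`_d); apply: eq_bigr => i.
by rewrite -PQ => Pi; rewrite rr.
Qed.

Lemma ser_none P r d : P =1 xpred0 -> ser P r d = (d == 0%N)%:R.
Proof. by move=> P0; rewrite /ser big_pred0 // coef1. Qed.

Lemma ser_split P Q r d : ser P r d =
  \sum_(k < d.+1) ser (fun i => P i && Q i) r k * ser (fun i => P i && ~~ Q i) r (d - k).
Proof.
rewrite {1}/ser (bigID Q) /= coefM; apply: eq_bigr => k _.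
have kd : (k <= d)%N by rewrite -ltnS.
by rewrite !ser_trunc // leq_subr.
Qed.

(** Multiplying the generating function by 1 - q [r j] removes the factor of j. *)
Lemma ser_rec P r j d : P j ->
  ser P r d.+1 = ser (fun i => P i && (i != j)) r d.+1 + r j * ser P r d.
Proof.
move=> Pj; rewrite -(@ser_trunc P r d d.+1) //.
rewrite {1}/ser (bigD1 j) //= coefM big_ord_recl /= subn0 coef_poly /= expr0 mul1r.
rewrite ser_trunc //; congr (_ + _).
rewrite coefM mulr_sumr; apply: eq_bigr => k _.
have := ltn_ord k; rewrite ltnS => kd.
have k1 : (k.+1 < d.+2)%N by []; have k2 : (k < d.+2)%N by apply: ltnW.
by rewrite -[bump 0 k]/(k.+1) subSS !coef_poly k1 k2 mulrA -exprS.
Qed.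

Lemma ser_scale P c r d : ser P (fun i => c * r i) d = c ^+ d * ser P r d.
Proof.
suff H D e : (e <= D)%N ->
   (\prod_(i | P i) \poly_(k < D.+1) (c * r i) ^+ k)`_e =
   c ^+ e * (\prod_(i | P i) \poly_(k < D.+1) (r i) ^+ k)`_e by apply: H.
move: e; apply: (big_ind2 (fun p q : {poly F} => forall e, (e <= D)%N -> p`_e = c ^+ e * q`_e)).
- by move=> [|e] _; rewrite !coef1 ?mulr1 ?mulr0.
- move=> p p' q q' pp qq e ed; rewrite !coefM mulr_sumr; apply: eq_bigr => k _.
  have ke : (k <= e)%N by rewrite -ltnS.
  rewrite pp ?qq; [|lia|lia].
  have -> : c ^+ e = c ^+ k * c ^+ (e - k) by rewrite -exprD subnKC.
  by rewrite mulrACA.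
- by move=> i _ e ed; rewrite !coef_poly !ltnS ed exprMn.
Qed.

End Series.

Lemma ser_rmorph (F F' : comNzRingType) (phi : {rmorphism F -> F'}) (I : finType)
  (P : pred I) (r : I -> F) d : phi (ser P r d) = ser P (fun i => phi (r i)) d.
Proof.
rewrite /ser -coef_map rmorph_prod; congr ((polyseq _)`_d); apply: eq_bigr => i _.
apply/polyP => k; rewrite coef_map /= !coef_poly; case: ifP => _; last exact: rmorph0.
exact: rmorphXn.
Qed.

Lemma ser_reindex (F : comNzRingType) (I I' : finType) (h : I' -> I) (P : pred I)
  (r : I -> F) d (Q : pred I') :
  {in Q &, injective h} -> (forall i, P i <-> exists2 i', Q i' & i = h i') ->
  ser P r d = ser Q (fun i' => r (h i')) d.
Proof.
move=> hinj PQ; rewrite /ser; congr ((polyseq _)`_d).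
rewrite -(big_imset (fun i => \poly_(k < d.+1) r i ^+ k) hinj) /=.
apply: eq_bigl => i; apply/idP/imsetP.
  by move=> /PQ[i' Qi' ->]; exists i'.
by case=> i' Qi' ->; apply/PQ; exists i'.
Qed.

Section SeriesSpan.
Variable n : nat.
Local Notation LF := (ratfun int n).
Local Notation wt := (n.-tuple int).

Definition w0t : wt := [tuple 0 | k < n].

Lemma xmon_w0t : xmon w0t = 1.
Proof. by rewrite /xmon big1 // => k _; rewrite tnth_mktuple expr0z. Qed.

Lemma addw0 (g : wt) : addw g w0t = g.
Proof. by apply: eq_from_tnth => k; rewrite !tnth_mktuple addr0. Qed.

Lemma ser_mspan (I : finType) (P : pred I) (r : I -> LF) (C : nat -> wt -> Prop) d :
  C 0%N w0t -> (forall a b g g', C a g -> C b g' -> C (a + b)%N (addw g g')) ->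
  (forall i, P i -> mspan (C 1%N) (r i)) -> mspan (C d) (ser P r d).
Proof.
move=> C0 CM Cr.
have H (p : {poly LF}) : p = \prod_(i | P i) \poly_(k < d.+1) r i ^+ k ->
    forall e, mspan (C e) p`_e.
  move=> -> {p}; apply: (big_ind (fun p : {poly LF} => forall e, mspan (C e) p`_e)).
  - by move=> [|e]; rewrite coef1; [rewrite -xmon_w0t; apply: mspan_xmon|apply: zspan0].
  - move=> p q Cp Cq e; rewrite coefM; apply: zspan_sum => k _.
    have ke : (k + (e - k) = e)%N by rewrite subnKC // -ltnS.
    by apply: mspanM (Cp k) (Cq (e - k)%N) => g g' Cg Cg'; have := CM _ _ _ _ Cg Cg'; rewrite ke.
  - move=> i Pi e; rewrite coef_poly; case: ifP => _; last exact: zspan0.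
    elim: e => [|e IH]; first by rewrite expr0 -xmon_w0t; apply: mspan_xmon.
    by rewrite exprS; apply: mspanM (Cr i Pi) IH => g g' Cg Cg'; rewrite -add1n; apply: CM.
exact: H.
Qed.

Definition unitw (j : 'I_n) (e : int) : wt := [tuple if k == j then e else 0 | k < n].

Lemma xmon_unitw j e : xmon (unitw j e) = xvar int j ^ e.
Proof.
rewrite /xmon (bigD1 j) //= big1 ?mulr1; first by rewrite tnth_mktuple eqxx.
by move=> k /negPf kj; rewrite tnth_mktuple kj expr0z.
Qed.

Lemma xvar_xmon (j : 'I_n) (k : nat) : xvar int j ^+ k = xmon (unitw j k%:Z).
Proof. by rewrite xmon_unitw exprnP. Qed.

Lemma xvarV_xmon (j : 'I_n) : (xvar int j)^-1 = xmon (unitw j (-1)).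
Proof. by rewrite xmon_unitw. Qed.

Lemma fsym_xmon (s : 'S_n) (g : wt) :
  fsym s (xmon g) = xmon [tuple tnth g ((s^-1)%g k) | k < n].
Proof.
rewrite /xmon (rmorph_prod (@fsym int n s)) /= [RHS](reindex_inj (@perm_inj _ s)) /=.
by apply: eq_bigr => k _; rewrite fsymXz fsym_xvar tnth_mktuple permK.
Qed.

Lemma mspan_fsym (s : 'S_n) (C C' : wt -> Prop) (f : LF) :
  (forall g, C g -> C' [tuple tnth g ((s^-1)%g k) | k < n]) ->
  mspan C f -> mspan C' (fsym s f).
Proof.
move=> CC; apply: (@zspan_additive _ _ _ (@fsym int n s)) => h [g /CC Cg ->].
by rewrite /= fsym_xmon; apply: mspan_xmon.
Qed.

End SeriesSpan.

(** * Cyclic rotation of the variables against the polynomial part *)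

Section LastVariable.
Variable l : nat.
Local Notation n := l.+1.
Local Notation LF := (ratfun int n).
Local Notation wt := (n.-tuple int).
Implicit Types (f y : LF) (g : wt).

Definition cyc : 'S_n := perm (@ordS_inj n).

Lemma cyc_val (k : 'I_n) : (k < l)%N -> cyc k = k.+1 :> nat.
Proof. by move=> kl; rewrite permE /= modn_small. Qed.

Lemma cyc_last : cyc ord_max = ord0.
Proof. by rewrite permE; apply: val_inj; rewrite /= modnn. Qed.

Definition last0 g : Prop := tnth g ord_max = 0.

Lemma last_neq (i : 'I_n.-1) : (i.+1 < l)%N ->
  (ord_max != lo i :> 'I_n) && (ord_max != hi i :> 'I_n).
Proof. by move=> il; rewrite -!val_eqE /= !gtn_eqF // ltnW. Qed.

Lemma last0_dem (i : 'I_n.-1) f : (i.+1 < l)%N ->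
  mspan last0 f -> mspan last0 (dem i f).
Proof.
move=> il; apply: mspan_dem => g a b g0 _ _ _.
by have /andP[? ?] := last_neq il; rewrite /last0 setlh_other.
Qed.

Lemma nnlast0_dem (i : 'I_n.-1) f : (i.+1 < l)%N ->
  mspan (fun g => nonneg g /\ last0 g) f -> mspan (fun g => nonneg g /\ last0 g) (dem i f).
Proof.
move=> il; apply: mspan_dem => g a b [ng g0]; rewrite ge_min le_max => amin amax abE.
split; last by have /andP[? ?] := last_neq il; rewrite /last0 setlh_other.
apply: nonneg_setlh => //; move: amin amax abE (ng (lo i)) (ng (hi i)).
by move: (tnth g (lo i)) (tnth g (hi i)) => x y; lia.
Qed.

Lemma cyc_dem (i j : 'I_n.-1) k f : (i.+1 < l)%N -> j = i.+1 :> nat ->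
  xvar int ord0 ^+ k * fsym cyc (dem i f) = dem j (xvar int ord0 ^+ k * fsym cyc f).
Proof.
move=> il ij.
have cl : cyc (lo i) = lo j by apply: val_inj; rewrite /= cyc_val /= ?ij // ltnW.
have ch : cyc (hi i) = hi j by apply: val_inj; rewrite /= cyc_val /= ?ij.
rewrite (dem_fsym_conj _ cl ch) dem_mulsym //.
by rewrite rmorphXn /= fsym_xvar tpermD // -val_eqE /= ij.
Qed.

(* Weights whose last exponent vanishes are obtained by the Demazure operators *)
(* that do not involve the last variable from those that decrease before it;   *)
(* such a weight with a negative entry is killed by [polypart].                *)
Lemma polypart_last0 y k : mspan last0 y ->
  mspan (fun g => nonneg g /\ last0 g) (polypart y) /\
  polypart (xvar int ord0 ^+ k * fsym cyc y) = xvar int ord0 ^+ k * fsym cyc (polypart y).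
Proof.
pose PL := mspan (fun g : wt => nonneg g /\ last0 g).
have Lc f : laurent f -> laurent (xvar int ord0 ^+ k * fsym cyc f).
  move=> Lf; apply: (@mspanM _ (fun=> True) (fun=> True)) => //.
    by rewrite xvar_xmon; apply: mspan_xmon.
  exact: mspan_fsym Lf.
pose Mok f := [/\ laurent f, PL (polypart f) &
  polypart (xvar int ord0 ^+ k * fsym cyc f) = xvar int ord0 ^+ k * fsym cyc (polypart f)].
suff H : mspan last0 y -> Mok y by move=> /H[_ ? ?].
have M0 : Mok 0.
  split; rewrite ?polypart0; [exact: zspan0|exact: zspan0|].
  by rewrite raddf0 mulr0 polypart0.
have MB f h : Mok f -> Mok h -> Mok (f - h).
  move=> [Lf Pf Ef] [Lh Ph Eh]; split; first exact: zspanB.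
    by rewrite (polypartB Lf Lh); apply: zspanB.
  rewrite fsymB mulrBr (polypartB (Lc _ Lf) (Lc _ Lh)) Ef Eh (polypartB Lf Lh).
  by rewrite fsymB mulrBr.
elim=> {y} [|y [g g0 ->]|f h _ IHf _ IHh]; [exact: M0| |exact: MB].
apply: (@dem_span_ind n (fun i : 'I_n.-1 => (i.+1 < l)%N) last0 Mok M0 MB _ _ _ g g0).
- move=> i f il [Lf Pf Ef]; have jl : (i.+1 < n.-1)%N by [].
  split; first exact: laurent_dem.
    by rewrite (polypart_dem i Lf); apply: nnlast0_dem.
  have cd h := @cyc_dem i (Ordinal jl) k h il erefl.
  apply: etrans (congr1 (@polypart n) (cd f)) _.
  apply: etrans (polypart_dem (Ordinal jl) (Lc _ Lf)) _.
  apply: etrans (congr1 (dem (Ordinal jl)) Ef) _; apply: etrans (esym (cd _)) _.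
  exact: (congr1 (fun z => xvar int ord0 ^+ k * fsym cyc z) (esym (polypart_dem i Lf))).
- move=> {g0}g i il g0 _ a b _ _.
  by have /andP[? ?] := last_neq il; rewrite /last0 setlh_other.
move=> {g0}g g0 dom; have Lg : laurent (xmon g) by apply: mspan_xmon.
have [/nonnegP ng|/negP nng] := boolP (all (fun k => 0 <= k) g).
  have Pg : mspan (@nonneg n) (xmon g) by apply: mspan_xmon.
  split; [exact: Lg|by rewrite (polypart_id Pg); apply: mspan_xmon|].
  rewrite (polypart_id Pg); apply: polypart_id; rewrite fsym_xmon xvar_xmon xmonM.
  by apply: mspan_xmon => t; rewrite !tnth_mktuple addr_ge0 //; case: ifP.
have [p0 gp0] : exists p, tnth g p < 0.
  apply/not_existsP => H; apply: (nng); apply/nonnegP => t.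
  by rewrite leNgt; apply/negP/H.
case: (@arg_maxnP _ p0 (fun p => tnth g p < 0) val gp0) => p gp pmax.
have pl : (p < l)%N.
  have : (p <= l)%N by rewrite -ltnS.
  rewrite leq_eqVlt => /orP[/eqP pl|//].
  have pE : p = ord_max by apply: val_inj.
  by move: gp; rewrite pE g0 ltxx.
(* The weight decreases before the last position, so its last negative entry stands immediately
   before it. *)
have pl1 : p.+1 = l.
  apply/eqP; rewrite eqn_leq pl leqNgt; apply/negP => pl'.
  have jl : (p < n.-1)%N by [].
  have := dom (Ordinal jl) pl'; have -> : lo (Ordinal jl) = p by apply: val_inj.
  move=> /le_lt_trans /(_ gp) /pmax /=; lia.
have Ng : negkeys (xmon g).
  apply: negkeys_xmon; exists p => // t pt.
  by have -> : t = ord_max by apply: val_inj => /=; have := ltn_ord t; lia.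
split; [exact: Lg|rewrite (polypart_neg Ng); exact: zspan0|].
rewrite (polypart_neg Ng).
rewrite [fsym _ 0]raddf0 mulr0; apply: polypart_neg.
(* The rotation moves that negative entry to the last position, out of reach of the power of the
   first variable, so this side is killed too. *)
rewrite fsym_xmon xvar_xmon xmonM; apply: negkeys_xmon; exists ord_max.
  rewrite !tnth_mktuple.
  have -> : (cyc^-1)%g ord_max = p.
    by apply: (@perm_inj _ cyc); rewrite permKV; apply: val_inj; rewrite /= cyc_val.
  by rewrite ifF ?add0r // -val_eqE /= -pl1.
by move=> t /= lt; have := ltn_ord t; lia.
Qed.

End LastVariable.

(* the longest element of the generators b, ..., b + k - 1 *)
Fixpoint w0w (b k : nat) : seq nat :=
  if k is k'.+1 then iota b k ++ w0w b k' else [::].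

Lemma w0wS b k : w0w b k.+1 = iota b k.+1 ++ w0w b k.
Proof. by []. Qed.

Lemma w0w_all b k : all (fun x => b <= x < b + k)%N (w0w b k).
Proof.
elim: k => // k IH; rewrite w0wS all_cat; apply/andP; split.
  by apply/allP => x; rewrite mem_iota.
by apply: sub_all IH => x; lia.
Qed.

Lemma ncong_drop n r u : (n.-1 <= r)%N -> ncong n (r :: u) u.
Proof.
move=> nr; rewrite /ncong /wordn /= insubN ?ltnNge ?nr //=.
exact: hecke_refl.
Qed.

(** The letter b is absorbed by idempotency. A larger letter crosses the leading cycle lowered by
    one and is absorbed by the shorter longest word. *)
Lemma w0w_left n b k r : (b <= r < b + k)%N -> ncong n (r :: w0w b k) (w0w b k).
Proof.
elim: k r => [|k IH] r br; first by move: br; lia.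
rewrite w0wS.
have [->|rb] := eqVneq r b.
  exact: (@ncong_catr _ [:: b; b] [:: b] _ (ncong_idem _ _)).
have -> : (r = b + (r - b - 1).+1)%N by lia.
have c := @ncong_cycle n b (r - b - 1) k.+1.
apply: (@ncong_trans _ ((iota b k.+1 ++ [:: b + (r - b - 1)]%N) ++ w0w b k)).
  by rewrite -cat_cons; apply/ncong_catr/c; lia.
by rewrite -catA; apply/ncong_catl/IH; lia.
Qed.

Lemma w0w_left_big n b k r : (n.-1 <= k)%N -> (b <= r)%N ->
  ncong n (r :: w0w b k) (w0w b k).
Proof.
move=> nk br; have [rk|rk] := ltnP r (b + k); first by apply: w0w_left; rewrite br.
by apply: ncong_drop; lia.
Qed.

Lemma ncong_rev n u v : ncong n u v -> ncong n (rev u) (rev v).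
Proof. by move=> /hecke_cong_rev; rewrite /ncong !wordn_rev. Qed.

Lemma w0w_catl n b k u : all (fun x => b <= x < b + k)%N u ->
  ncong n (u ++ w0w b k) (w0w b k).
Proof.
elim: u => [_|x u IH /= /andP[bx /IH c]]; first exact: ncong_refl.
by apply: ncong_trans (ncong_cons x c) _; apply: w0w_left.
Qed.

(** The word [rev W ++ W] is its own reverse. Left absorption makes it congruent to [W], and
    reversing this congruence makes it congruent to [rev W]. *)
Lemma w0w_rev n b k : ncong n (rev (w0w b k)) (w0w b k).
Proof.
have c : ncong n (rev (w0w b k) ++ w0w b k) (w0w b k).
  by apply: w0w_catl; rewrite all_rev w0w_all.
have := ncong_rev c; rewrite rev_cat revK => c'.
by apply: ncong_trans (ncong_sym c') c.
Qed.

Lemma w0w_catr n b k u : all (fun x => b <= x < b + k)%N u ->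
  ncong n (w0w b k ++ u) (w0w b k).
Proof.
move=> au; have := @w0w_catl n b k (rev u); rewrite all_rev => /(_ au)/ncong_rev.
rewrite rev_cat revK => c.
apply: ncong_trans (ncong_trans _ c) (w0w_rev n b k).
by apply/ncong_catr/ncong_sym/w0w_rev.
Qed.

Lemma w0w_right_big n b k r : (n.-1 <= k)%N -> (b <= r)%N ->
  ncong n (w0w b k ++ [:: r]) (w0w b k).
Proof.
move=> nk br; have [rk|rk] := ltnP r (b + k); first by apply: w0w_catr; rewrite /= br rk.
have nr : (n.-1 <= r)%N by lia.
by have := ncong_rev (@ncong_drop n r (rev (w0w b k)) nr); rewrite rev_cons revK -cats1.
Qed.

(** The large word absorbs the small one on its right, and the small one absorbs every in-range
    letter of the large one on its left. *)
Lemma w0w_trunc n b k : (n.-1 <= k)%N -> (b <= n.-1)%N ->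
  ncong n (w0w b k) (w0w b (n.-1 - b)).
Proof.
move=> nk bn; apply: (@ncong_trans _ (w0w b k ++ w0w b (n.-1 - b))).
  apply/ncong_sym/w0w_catr; apply: sub_all (w0w_all _ _) => x; lia.
have : all (fun x => b <= x)%N (w0w b k) by apply: sub_all (w0w_all _ _) => x; lia.
elim: (w0w b k) => [_|x u IH /= /andP[bx /IH c]]; first exact: ncong_refl.
apply: ncong_trans (ncong_cons x c) _.
have [xk|xk] := ltnP x n.-1; first by apply: w0w_left; lia.
exact: ncong_drop.
Qed.

Lemma ser_zero (F : comNzRingType) (I : finType) (P : pred I) (r : I -> F) : ser P r 0 = 1.
Proof.
rewrite /ser; apply: (big_ind (fun p : {poly F} => p`_0 = 1)).
- by rewrite coef1.
- by move=> p q p1 q1; rewrite coef0M p1 q1 mulr1.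
- by move=> i _; rewrite coef_poly expr0.
Qed.

(** * Expansion in the last variable *)

Section Expansion.
Variable l : nat.
Local Notation n := l.+1.
Local Notation LF := (ratfun int n).
Local Notation wt := (n.-tuple int).
Local Notation xv := (@xvar int n).
Local Notation PL := (mspan (fun g : wt => nonneg g /\ last0 g)).

(** With 0-based names this is h_k(1/x_j, ..., 1/x_{l-1}); the last variable x_l is left out. *)
Definition hinv (j k : nat) : LF :=
  ser (fun t : 'I_n => (j <= t < l)%N) (fun t => (xv t)^-1) k.

Lemma hinv_sym (i : 'I_n.-1) j k : (j <= i)%N -> (i.+1 < l)%N ->
  fsym (tperm (lo i) (hi i)) (hinv j k) = hinv j k.
Proof.
move=> ji il; rewrite /hinv (ser_rmorph (@fsym int n (tperm (lo i) (hi i)))) /=.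
pose s := tperm (lo i : 'I_n) (hi i).
have Ps (t : 'I_n) : (j <= s t < l)%N = (j <= t < l)%N.
  rewrite /s; case: tpermP => [->|->|//]; move: ji il => /=;
    move: (nat_of_ord i); lia.
rewrite [RHS](@ser_reindex _ _ _ s _ _ k (fun t : 'I_n => (j <= t < l)%N)).
- by apply: eq_ser => // t _; rewrite fsymV fsym_xvar.
- by move=> a b _ _; apply: perm_inj.
- move=> t; split=> [Pt|[t' Pt' ->]]; last by rewrite Ps.
  by exists (s t); [rewrite /= Ps|rewrite /s tpermK].
Qed.

Lemma hinv_rec (j : 'I_n) k : (j < l)%N ->
  hinv j k.+1 = hinv j.+1 k.+1 + (xv j)^-1 * hinv j k.
Proof.
move=> jl; rewrite /hinv (@ser_rec _ _ _ _ j); last by rewrite leqnn.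
congr (_ + _); apply: eq_ser => // t.
by rewrite -val_eqE /=; move: (nat_of_ord t); lia.
Qed.

Lemma hinv_end k : hinv l k = (k == 0%N)%:R.
Proof. by apply: ser_none => t; lia. Qed.

Lemma hinv_last (j : 'I_n) k : j.+1 = l -> hinv j k = (xv j)^-1 ^+ k.
Proof.
move=> jl; elim: k => [|k IH]; first by rewrite /hinv ser_zero expr0.
by rewrite hinv_rec ?jl // hinv_end add0r IH exprS.
Qed.

Lemma hinv_span j k : mspan (fun g : wt => negexp g /\ last0 g) (hinv j k).
Proof.
apply: (@ser_mspan _ _ _ _ (fun _ g => negexp g /\ last0 g)).
- by split; [move=> t|]; rewrite ?/last0 tnth_mktuple.
- move=> _ _ g g' [ng g0] [ng' g0']; split.
    by move=> t; rewrite tnth_mktuple; have := ng t; have := ng' t; lia.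
  by rewrite /last0 tnth_mktuple g0 g0'.
- move=> t /andP[_ tl]; rewrite xvarV_xmon; apply: mspan_xmon; split.
    by move=> u; rewrite tnth_mktuple; case: ifP.
  by rewrite /last0 tnth_mktuple ifF // -val_eqE /= gtn_eqF.
Qed.

(** Write [hinv i.+1 k] as [hinv i k] minus x_i^{-1} [hinv i k.-1] for k > 0. The functions starting
    at i are symmetric in x_i and x_{i+1}, and [dem i] kills x_i^{-1}. *)
Lemma dem_hinv (i : 'I_n.-1) k : (i.+1 < l)%N -> dem i (hinv i.+1 k) = hinv i k.
Proof.
move=> il; case: k => [|k].
  by rewrite /hinv !ser_zero; apply: dem_sym; exact: fsym1.
have E := @hinv_rec (lo i) k (ltnW il).
have {}E : hinv i.+1 k.+1 = hinv i k.+1 - hinv i k * (xv (lo i))^-1.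
  by rewrite E mulrC addrK.
apply: etrans (congr1 (dem i) E) _; rewrite raddfB /=.
rewrite (dem_sym (hinv_sym k.+1 (leqnn i) il)) (dem_mulsym _ (hinv_sym k (leqnn i) il)).
suff -> : dem i (xv (lo i))^-1 = 0 by rewrite mulr0 subr0.
apply/dem_eqP; rewrite fsymV fsym_xvar tpermL mulr0.
by rewrite !mulfV ?xvar_neq0 // subrr.
Qed.

Lemma hinv_mul_last0 j k P : mspan (@last0 l) P -> mspan (@last0 l) (hinv j k * P).
Proof.
move=> PP; apply: mspanM (hinv_span j k) PP => g g' [_ g0] g0'.
by rewrite /last0 tnth_mktuple g0 g0'.
Qed.

(** The string formula expands x_i^d into the x_i^{d-k} x_l^k with k at most d; the polynomial part
    kills exactly the terms with k > d. *)
Lemma expand_last (i : 'I_n.-1) P : i.+1 = l -> PL P ->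
  exists K0, forall K, (K0 <= K)%N ->
    dem i P = \sum_(k < K) xv ord_max ^+ k * polypart (hinv i k * P).
Proof.
move=> il; have hi_max : hi i = ord_max by apply: val_inj.
have Lh k f : PL f -> laurent (hinv i k * f).
  by move=> Pf; apply: (@mspanM _ _ _ (fun=> True)) (hinv_span i k) Pf.
elim=> {P} [|P [g [ng g0] ->]|f h Pf [K1 H1] Ph [K2 H2]]; last first.
- exists (maxn K1 K2) => K; rewrite geq_max => /andP[/H1 Hf /H2 Hh].
  rewrite raddfB /= Hf Hh -sumrB; apply: eq_bigr => k _.
  by rewrite mulrBr (polypartB (Lh k _ Pf) (Lh k _ Ph)) mulrBr.
- pose d := absz (tnth g (lo i)).
  have dE : tnth g (lo i) = d%:Z by have := ng (lo i); rewrite /d; lia.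
  exists d.+1 => K dK; have h0 : tnth g (hi i) = 0 by rewrite hi_max.
  have gE : setlh i g (0 + d%:Z) 0 = g by rewrite add0r -dE -h0 setlh_id.
  have VE k : hinv i k * xmon g = xmon (addw (unitw (lo i) (- k%:Z)) g).
    by rewrite (@hinv_last (lo i)) // exprVn exprnN -xmon_unitw xmonM.
  rewrite -{1}gE dem_xmon.
  pose F k := xmon (setlh i g (0 + (d - k)%N%:Z) (0 + k%:Z)).
  rewrite (big_ord_widen K F dK) [RHS](bigID (fun k : 'I_K => (k < d.+1)%N)) /=.
  rewrite [X in _ = _ + X]big1 ?addr0; last first.
    move=> k; rewrite -leqNgt => dk; rewrite VE polypart_neg ?mulr0 //.
    apply: negkeys_xmon; exists (lo i).
      by rewrite !tnth_mktuple eqxx dE; lia.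
    move=> t lt; have -> : t = hi i.
      by apply: val_inj => /=; move: lt (ltn_ord t) il => /=; lia.
    by rewrite !tnth_mktuple (negPf (lo_neq_hi i)) h0.
  apply: eq_bigr => k kd.
  have nn : nonneg (addw (unitw (lo i) (- k%:Z)) g).
    move=> t; rewrite !tnth_mktuple; case: eqP => [->|_]; last by rewrite add0r; apply: ng.
    by rewrite dE; move: kd; lia.
  rewrite VE polypart_id; last exact: mspan_xmon.
  rewrite xvar_xmon xmonM; congr xmon; apply: eq_from_tnth => t.
  rewrite !tnth_mktuple -hi_max; case: (t =P lo i) => [->|tl].
    by rewrite eq_sym (negPf (lo_neq_hi i)) dE; move: kd; lia.
  by case: (t =P hi i) => [->|_]; rewrite ?h0 ?add0r ?addr0.
- by exists 0%N => K _; rewrite raddf0 big1 // => k _; rewrite mulr0 polypart0 mulr0.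
Qed.

(** Downward induction on j: [dem j] passes P and the powers of the last variable, commutes with
    [polypart], and lowers the index of [hinv] by [dem_hinv]. The terms vanish for large k, and [K]
    stays free to be enlarged. *)
Lemma expand (j : nat) P : (j <= l)%N -> PL P ->
  (forall i : 'I_n.-1, (j <= i)%N -> (i.+1 < l)%N -> dem i P = P) ->
  exists K0, forall K, (K0 <= K)%N ->
    foldr (@dem int n) P (wordn n (iota j (l - j))) =
    \sum_(k < K) xv ord_max ^+ k * polypart (hinv j k * P).
Proof.
move=> jl PP; have [m mE] : exists m, m = (l - j)%N by exists (l - j)%N.
have L0 : mspan (@last0 l) P by apply: mspan_sub PP => g [].
elim: m j jl mE => [|m IH] j jl mE sP.
  have jE : j = l by lia.
  exists 1%N => K K1; rewrite -mE jE /=; case: K K1 => // K _.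
  rewrite big_ord_recl big1 => [|k _].
    rewrite addr0 expr0 mul1r hinv_end mul1r polypart_id //.
    by apply: mspan_sub PP => g [].
  by rewrite hinv_end mul0r polypart0 mulr0.
have jn : (j < n.-1)%N by rewrite /=; lia.
pose i := Ordinal jn; rewrite -mE.
have wE : wordn n (iota j m.+1) = i :: wordn n (iota j.+1 m).
  by rewrite /wordn /= insubT.
rewrite wE /=.
have [jl1|jl1] := eqVneq j.+1 l.
  have -> : m = 0%N by lia.
  exact: (@expand_last i P jl1 PP).
have jl2 : (j.+1 < l)%N by lia.
have [||K0 H] := IH j.+1 (ltnW jl2) _ _; first by lia.
  by move=> i' ji' i'l; apply: sP => //; apply: ltnW.
have mE' : (l - j.+1 = m)%N by lia.
rewrite mE' in H; exists K0 => K /H ->; rewrite raddf_sum; apply: eq_bigr => k _ /=.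
have iP : fsym (tperm (lo i) (hi i)) P = P by rewrite -(sP i (leqnn _) jl2) fsym_dem.
have xl : fsym (tperm (lo i) (hi i)) (xv ord_max ^+ k) = xv ord_max ^+ k.
  have /andP[h1 h2] := @last_neq l i jl2.
  by rewrite rmorphXn /= fsym_xvar tpermD // eq_sym.
rewrite (dem_mulsym _ xl); congr (_ * _).
have Lh : laurent (hinv j.+1 k * P) by apply: mspan_sub (hinv_mul_last0 _ _ L0).
apply: etrans (esym (polypart_dem i Lh)) _; congr polypart.
by rewrite [hinv j.+1 k * P]mulrC (dem_mulsym _ iP) (@dem_hinv i k jl2) mulrC.
Qed.

End Expansion.

(** * The operator Phi coefficientwise *)

Section PhiCoef.
Variable l : nat.
Local Notation n := l.+1.
Local Notation msh m := [multinom m (cyc l i) | i < n].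

Lemma Phi_X (m : 'X_{1..n}) :
  Phi 'X_[m] = 'X^(m ord_max) *: msym (cyc l) 'X_[m] :> {mpoly {poly int}[n]}.
Proof.
rewrite /Phi comp_mpolyX /msym mmapX /mmap1 -mul_mpolyC.
rewrite (bigD1 ord_max) // [in RHS](bigD1 ord_max) //= tnth_mktuple eqxx cyc_last.
rewrite exprMn mulrA rmorphXn; congr (_ * _).
apply: eq_bigr => i /negPf im; rewrite tnth_mktuple im.
by congr ('X__ ^+ _); rewrite permE.
Qed.

Lemma mcoeff_Phi (Q : {mpoly {poly int}[n]}) m :
  (Phi Q)@_m = Q@_(msh m) * 'X^(m (cyc l ord_max)).
Proof.
elim/mpolyind: Q => [|c m' Q _ _ IH].
  by rewrite /Phi comp_mpoly0 !mcoeff0 mul0r.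
rewrite /Phi comp_mpolyD comp_mpolyZ -!/(Phi _) mcoeffD IH Phi_X [in RHS]mcoeffD mulrDl.
congr (_ + _); rewrite !mcoeffZ mcoeff_sym !mcoeffX.
case: eqP => [->|_]; last by rewrite !mulr0 mul0r.
by rewrite !mulr1 mnmE.
Qed.

Definition lastdeg k (A : {mpoly int[n]}) := forall m, A@_m != 0 -> m ord_max = k.

Lemma mcoeff_qcoef r d (Q : {mpoly {poly int}[r]}) m : (qcoef d Q)@_m = (Q@_m)`_d.
Proof. by rewrite /qcoef mcoeff_map_mpoly. Qed.

(** [Phi] multiplies the part of degree k in the last variable by q^k, so degree d of the result
    collects part k of degree d - k. The bound on [K] keeps all these k in range. *)
Lemma qcoef_Phi (Q : {mpoly {poly int}[n]}) d (A : nat -> nat -> {mpoly int[n]})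
    (K : nat -> nat) :
  (forall e, (d < K e)%N) -> (forall k e, lastdeg k (A k e)) ->
  (forall e, qcoef e Q = \sum_(k < K e) A k e) ->
  qcoef d (Phi Q) = msym (cyc l) (\sum_(k < d.+1) A k (d - k)%N).
Proof.
move=> dK Ak QA; apply/mpolyP => m.
rewrite mcoeff_sym mcoeff_qcoef mcoeff_Phi coefMXn raddf_sum /=.
set M := msh m; have -> : m (cyc l ord_max) = M ord_max by rewrite mnmE.
have A0 k e : k != M ord_max -> (A k e)@_M = 0.
  by move=> kM; apply/eqP; apply: contraNT kM => /(Ak k e) ->.
case: ltnP => [dM|Md].
  by rewrite big1 // => k _; apply: A0; have := ltn_ord k; lia.
have Md' : (M ord_max < d.+1)%N by [].
rewrite (bigD1 (Ordinal Md')) //= big1 ?addr0; last first.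
  by move=> k; rewrite -val_eqE /= => kM; apply: A0.
rewrite -mcoeff_qcoef QA raddf_sum /=.
have MK : (M ord_max < K (d - M ord_max)%N)%N by apply: leq_ltn_trans (dK _).
rewrite (bigD1 (Ordinal MK)) //= big1 ?addr0 // => k.
by rewrite -val_eqE /= => kM; apply: A0.
Qed.

Lemma mpoly_of_mspan k (f : ratfun int n) :
  mspan (fun g => nonneg g /\ tnth g ord_max = k%:Z) f ->
  exists A, tofrac A = f /\ lastdeg k A.
Proof.
elim=> {f} [|f [g [ng gk] ->]|f h _ [A [<- dA]] _ [B [<- dB]]].
- by exists 0; split; [exact: tofrac0|move=> m; rewrite mcoeff0 eqxx].
- exists 'X_[[multinom absz (tnth g t) | t < n]]; split.
    rewrite mpolyXE_id rmorph_prod; apply: eq_bigr => t _.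
    rewrite /= mnmE tofracXn -[tofrac _]/(xvar int t) exprnP; congr (_ ^ _).
    by have := ng t; lia.
  move=> m; rewrite mcoeffX; case: (_ =P m) => [<- _|_]; last by rewrite eqxx.
  by rewrite mnmE gk.
- exists (A - B); split; first by rewrite tofracB.
  move=> m; rewrite mcoeffB; have [A0|A0 _] := eqVneq (A@_m) 0; last exact: dA.
  by rewrite A0 sub0r oppr_eq0; apply: dB.
Qed.

End PhiCoef.

(** * Rotation *)

Lemma qcoefB n d : {morph @qcoef n d : A B / A - B}.
Proof. by move=> A B; apply/mpolyP => m; rewrite !(mcoeffB, mcoeff_qcoef) coefB. Qed.

Lemma qcoefD n d : {morph @qcoef n d : A B / A + B}.
Proof. by move=> A B; apply/mpolyP => m; rewrite !(mcoeffD, mcoeff_qcoef) coefD. Qed.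

Lemma qcoef0 n d : @qcoef n d 0 = 0.
Proof. by apply/mpolyP => m; rewrite mcoeff_qcoef !mcoeff0 coef0. Qed.

Lemma qcoef1 n d : @qcoef n d 1 = (d == 0%N)%:R.
Proof.
apply/mpolyP => m; rewrite mcoeff_qcoef mcoeffMn !mcoeff1.
by case: (m == _); rewrite /= ?coef1 ?coef0 ?mul0rn.
Qed.

Lemma qcoef_monom n d (c : {poly int}) (m : 'X_{1..n}) :
  qcoef d (c *: 'X_[m]) = c`_d *: 'X_[m].
Proof.
apply/mpolyP => m'; rewrite mcoeff_qcoef !mcoeffZ !mcoeffX.
by case: eqP => _; rewrite ?mulr1 // !mulr0 coef0.
Qed.

Lemma qcoefXM n d (j : 'I_n) (A : {mpoly {poly int}[n]}) :
  qcoef d ('X_j * A) = 'X_j * qcoef d A.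
Proof.
elim/mpolyind: A => [|c m A _ _ IH]; first by rewrite mulr0 !qcoef0 mulr0.
rewrite mulrDr !qcoefD mulrDr IH qcoef_monom; congr (_ + _).
by rewrite -!scalerAr -!mpolyXD qcoef_monom.
Qed.

Lemma qcoef_msym n d (s : 'S_n) (A : {mpoly {poly int}[n]}) :
  qcoef d (msym s A) = msym s (qcoef d A).
Proof. by apply/mpolyP => m; rewrite mcoeff_qcoef !mcoeff_sym mcoeff_qcoef. Qed.

Lemma qcoef_mdem n d (i : 'I_n.-1) (A : {mpoly {poly int}[n]}) :
  qcoef d (mdem i A) = mdem i (qcoef d A).
Proof.
apply/esym/mdem_eqP; have /mdem_eqP/(congr1 (qcoef d)) := erefl (mdem i A).
by rewrite mulrBl !qcoefB !qcoefXM qcoef_msym -mulrBl.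
Qed.

Lemma qcoef_foldr_mdem n d u (A : {mpoly {poly int}[n]}) :
  qcoef d (foldr (@mdem _ n) A u) = foldr (@mdem _ n) (qcoef d A) u.
Proof. by elim: u => //= i u <-; rewrite qcoef_mdem. Qed.

Lemma foldr_dem_sum (R : idomainType) n (I : Type) (r : seq I) (F : I -> ratfun R n) u :
  foldr (@dem R n) (\sum_(k <- r) F k) u = \sum_(k <- r) foldr (@dem R n) (F k) u.
Proof. by elim: u => //= i u ->; rewrite raddf_sum. Qed.

Lemma wordn_cons n (i : 'I_n.-1) u : wordn n (nat_of_ord i :: u) = i :: wordn n u.
Proof. by rewrite /wordn /= valK. Qed.

(** Here [s] has an entry for each of the m rows, the last included, so that m is its size. *)
Definition Psi n (s : seq nat) : {set 'I_n * 'I_n} :=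
  [set ij : 'I_n * 'I_n | (ij.1 < ij.2)%N &&
    ((size s <= ij.2)%N || (ij.1 + nth 0%N s ij.1 <= ij.2)%N)].

(** The upper bound on [a] makes the longest element from [a.-1] absorb what the next row requires;
    the lower bound makes the composition built so far fit into [a] places. *)
Fixpoint valid (s : seq nat) : bool :=
  if s is a :: s' then
    [&& (0 < a)%N, (head 0%N s' <= a)%N, (a <= (head 0%N s').+1)%N & valid s']
  else true.

Lemma valid_head s : valid s -> (head 0 s <= size s)%N.
Proof. by elim: s => //= a s IH /and4P[_ _ h /IH]; lia. Qed.

Lemma mulr_reorder (F : comNzRingType) (a h s x m : F) :
  a * h * s * (x * m) = a * x * (h * (s * m)).
Proof. by ring. Qed.

Section Rotation.
Variables (B l : nat).
Local Notation n := l.+1.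
Local Notation LF := (ratfun int n).
Local Notation wt := (n.-tuple int).
Local Notation xv := (@xvar int n).
Local Notation rt := (fun ij : 'I_n * 'I_n => xv ij.1 / xv ij.2).
Local Notation wdem u f := (foldr (@dem int n) f (wordn n u)).

(** The operator word replacing the series. The bound [B], independent of the number of variables,
    keeps the words the same when variables are dropped. *)
Fixpoint Gp (s : seq nat) : {mpoly {poly int}[n]} :=
  if s is a :: s' then
    'X_ord0 * Phi (foldr (@mdem _ n) (Gp s') (wordn n (w0w a.-1 B)))
  else 1.

Lemma root_seriesE Ps d : root_series Ps d = ser (fun ij => ij \in Ps) rt d :> LF.
Proof. by []. Qed.

Lemma rt_xmon i j : xv i / xv j = xmon (addw (unitw i 1) (unitw j (-1))).
Proof. by rewrite -xmonM -xvarV_xmon xmon_unitw. Qed.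

Lemma negtail_add (g g' : wt) : negtail g -> negtail g' -> negtail (addw g g').
Proof.
move=> [p gp gt] [p' gp' gt'].
have [pp|pp|/val_inj pp] := ltngtP p p'.
- exists p'; first by rewrite tnth_mktuple gt // add0r.
  by move=> t pt; rewrite tnth_mktuple gt ?gt' //; apply: ltn_trans pt.
- exists p; first by rewrite tnth_mktuple gt' // addr0.
  by move=> t pt; rewrite tnth_mktuple gt ?gt' //; apply: ltn_trans pt.
- subst p'; exists p; first by rewrite tnth_mktuple; lia.
  by move=> t pt; rewrite tnth_mktuple gt ?gt'.
Qed.

Lemma mspan_negkeys (C : wt -> Prop) f :
  (forall g, C g -> negtail g) -> mspan C f -> negkeys f.
Proof. by move=> Cn; apply: zspan_sub => h [g /Cn ng ->]; apply: negkeys_xmon. Qed.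

(** A nonempty product of x_i/x_j with i < j has a negative last nonzero exponent, so only the
    constant term survives. *)
Lemma polypart_root_series (P : pred ('I_n * 'I_n)) d :
  (forall ij, P ij -> (ij.1 < ij.2)%N) -> polypart (ser P rt d) = (d == 0%N)%:R.
Proof.
move=> Plt; have [->|d0] := eqVneq d 0%N.
  by rewrite ser_zero -(xmon_w0t n); apply/polypart_id/mspan_xmon => t; rewrite tnth_mktuple.
apply: polypart_neg.
pose C (e : nat) (g : wt) := if e == 0%N then g = w0t n else negtail g.
have : mspan (C d) (ser P rt d).
  apply: ser_mspan => //.
  - move=> a b g g'; rewrite /C addn_eq0.
    case: eqP => [_ ->|_ ng]; case: eqP => [_ ->|_ ng'] //=.
    + by rewrite addw0.
    + suff -> : addw (w0t n) g' = g' by [].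
      by apply: eq_from_tnth => t; rewrite !tnth_mktuple add0r.
    + by rewrite addw0.
    + exact: negtail_add.
  - move=> [i j] /Plt /= ij; rewrite rt_xmon; apply: mspan_xmon; exists j.
      by rewrite !tnth_mktuple eqxx -val_eqE /= gtn_eqF.
    move=> t jt; rewrite !tnth_mktuple -!val_eqE /= !gtn_eqF //.
    exact: ltn_trans ij jt.
by apply: mspan_negkeys => g; rewrite /C (negPf d0).
Qed.

Definition gser (s : seq nat) e : LF :=
  ser (fun ij => (ij \in Psi n s) && ~~ (ij.2 == ord_max)) rt e * xmon (mu n (size s)).

Lemma laurentM f h : laurent f -> laurent h -> laurent (f * h :> LF).
Proof. exact: mspanM. Qed.

Lemma ser_laurent (P : pred ('I_n * 'I_n)) d : laurent (ser P rt d).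
Proof.
apply: (@ser_mspan _ _ _ _ (fun _ _ => True)) => // [[i j]] _.
by rewrite rt_xmon; apply: mspan_xmon.
Qed.

Lemma gser_last0 s e : (size s < n)%N -> mspan (@last0 l) (gser s e).
Proof.
move=> sn; apply: (@mspanM _ (@last0 l) (@last0 l)).
- by move=> g g' g0 g0'; rewrite /last0 tnth_mktuple g0 g0'.
- apply: (@ser_mspan _ _ _ _ (fun _ => @last0 l)).
  + by rewrite /last0 tnth_mktuple.
  + by move=> _ _ g g' g0 g0'; rewrite /last0 tnth_mktuple g0 g0'.
  + move=> [i j]; rewrite inE /= => /andP[/andP[ij _] jm].
    rewrite rt_xmon; apply: mspan_xmon; rewrite /last0 !tnth_mktuple.
    rewrite [ord_max == j]eq_sym (negPf jm) ifF // -val_eqE /= gtn_eqF //.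
    by apply: leq_trans ij _; rewrite -ltnS.
- by apply: mspan_xmon; rewrite /last0 tnth_mktuple /= ltnNge -ltnS sn.
Qed.

(* the roots in the last column only contribute monomials with negative last *)
(* exponent *)
Lemma polypart_gser s e : (size s < n)%N ->
  polypart (root_series (Psi n s) e * xmon (mu n (size s))) = polypart (gser s e).
Proof.
move=> sn; rewrite root_seriesE (@ser_split _ _ _ (fun ij => ij.2 == ord_max)) mulr_suml.
rewrite polypart_sum; last first.
  move=> k _; apply: laurentM; last exact: mspan_xmon.
  by apply: laurentM; apply: ser_laurent.
rewrite big_ord_recl /= ser_zero mul1r subn0 big1 ?addr0 // => k _.
apply: polypart_neg; rewrite -mulrA.
apply: (@mspan_negkeys (fun g => tnth g ord_max < 0)).
  by move=> g gm; exists ord_max => // t /=; rewrite ltnNge -ltnS ltn_ord.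
pose C (e : nat) (g : wt) := tnth g ord_max = - e%:Z.
apply: (@mspanM _ (C (bump 0 k)) (@last0 l)).
- by move=> g g' gE g0; rewrite tnth_mktuple gE g0 /bump; lia.
- apply: (@ser_mspan _ _ _ _ C).
  + by rewrite /C tnth_mktuple.
  + by move=> a b g g' ga gb; rewrite /C tnth_mktuple ga gb; lia.
  + move=> [i j]; rewrite inE /= => /andP[/andP[ij _] /eqP jm].
    rewrite rt_xmon; apply: mspan_xmon; rewrite /C !tnth_mktuple -jm eqxx.
    by rewrite ifF // -val_eqE /= gtn_eqF.
- exact: gser_last0.
Qed.

(** The columns j >= a of the first row are the shifts of the indices from a - 1 to l - 1, and x_0
    factors out of each root. *)
Lemma row0_series a s k : (0 < a)%N -> (a <= (size s).+1)%N ->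
  ser (fun ij => (ij \in Psi n (a :: s)) && (ij.1 == ord0)) rt k =
  xv ord0 ^+ k * fsym (cyc l) (hinv l a.-1 k).
Proof.
move=> a0 am; rewrite /hinv (ser_rmorph (@fsym int n (cyc l))) -ser_scale /=.
rewrite (@ser_reindex _ _ _ (fun t : 'I_n => (ord0, cyc l t)) _ _ _
   (fun t : 'I_n => (a.-1 <= t < l)%N)).
- by apply: eq_ser => // t _; rewrite fsymV fsym_xvar.
- by move=> t t' _ _ [] /perm_inj.
move=> [i j]; split.
  rewrite inE /= => /andP[/andP[ij h] /eqP i0]; rewrite i0 /= add0n in ij h *.
  have aj : (a <= j)%N by case/orP: h => //; apply: leq_trans.
  have j' : (j.-1 < n)%N by apply: leq_ltn_trans (leq_pred _) (ltn_ord j).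
  have jl : (j.-1 < l)%N by rewrite -ltnS prednK.
  exists (Ordinal j') => /=.
    by rewrite jl andbT -ltnS !prednK.
  by congr pair; apply: val_inj; rewrite /= cyc_val //= prednK.
case=> t /andP[at' tl] [-> ->]; rewrite inE /= cyc_val // eqxx andbT /=.
by apply/orP; right; rewrite add0n -(prednK a0).
Qed.

(** Lower rows are those of the smaller ideal moved by one in both coordinates; its last column
    would leave the range. *)
Lemma rest_series a s e :
  ser (fun ij => (ij \in Psi n (a :: s)) && ~~ (ij.1 == ord0)) rt e =
  fsym (cyc l) (ser (fun ij => (ij \in Psi n s) && ~~ (ij.2 == ord_max)) rt e).
Proof.
rewrite (ser_rmorph (@fsym int n (cyc l))) /=.
rewrite (@ser_reindex _ _ _ (fun ij : 'I_n * 'I_n => (cyc l ij.1, cyc l ij.2)) _ _ _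
   (fun ij => (ij \in Psi n s) && ~~ (ij.2 == ord_max))).
- by apply: eq_ser => // ij _; rewrite /= fsymM fsymV !fsym_xvar.
- by move=> [i j] [i' j'] _ _ [] /perm_inj -> /perm_inj ->.
move=> [i j]; split.
  rewrite inE -val_eqE /= => /andP[/andP[ij h] i0].
  have i1 : (0 < i)%N by rewrite lt0n.
  have j1 : (0 < j)%N by apply: ltn_trans ij.
  have i' : (i.-1 < n)%N by apply: leq_ltn_trans (leq_pred _) (ltn_ord i).
  have j' : (j.-1 < n)%N by apply: leq_ltn_trans (leq_pred _) (ltn_ord j).
  have jl : (j.-1 < l)%N by rewrite -ltnS prednK.
  have il : (i.-1 < l)%N by apply: leq_ltn_trans jl; rewrite -ltnS !prednK // ltnW.
  exists (Ordinal i', Ordinal j'); rewrite ?inE -?val_eqE /=.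
    move: h; rewrite -{1 2}(prednK i1) /= => h.
    by rewrite (ltn_eqF jl) andbT; move: ij h i1 j1;
      move: (nat_of_ord i) (nat_of_ord j) => x y; case: x => // x; case: y => // y /=; lia.
  by congr pair; apply: val_inj; rewrite /= cyc_val //= prednK.
case=> [[i' j']]; rewrite inE -val_eqE /= => /andP[/andP[ij h] jm] [-> ->].
have jl : (j' < l)%N by rewrite ltn_neqAle jm -ltnS ltn_ord.
have il : (i' < l)%N by apply: ltn_trans jl.
by rewrite inE /= -val_eqE /= !cyc_val //= andbT ltnS ij /= !ltnS.
Qed.

Lemma xmon_mu_rot m : (m < n)%N ->
  xmon (mu n m.+1) = xv ord0 * fsym (cyc l) (xmon (mu n m)).
Proof.
move=> mn; rewrite fsym_xmon -[xv ord0]expr1 xvar_xmon xmonM; congr xmon.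
apply: eq_from_tnth => t; rewrite !tnth_mktuple.
have [->|t0] := eqVneq t ord0.
  have -> : ((cyc l)^-1)%g ord0 = ord_max by rewrite -(cyc_last l) permK.
  by rewrite /= [(l < m)%N]ltnNge -ltnS mn.
have t1 : (0 < t)%N by move: t0; rewrite -val_eqE lt0n.
have t' : (t.-1 < n)%N by apply: leq_ltn_trans (leq_pred _) (ltn_ord t).
have -> : ((cyc l)^-1)%g t = Ordinal t'.
  have tl : (t.-1 < l)%N by rewrite -ltnS prednK.
  apply: (@perm_inj _ (cyc l)); rewrite permKV; apply: val_inj.
  by rewrite /= cyc_val //= prednK.
by rewrite add0r /= -{1}(prednK t1) ltnS.
Qed.

Lemma rot_series a s d : (0 < a)%N -> (a <= (size s).+1)%N -> (size s < n)%N ->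
  root_series (Psi n (a :: s)) d * xmon (mu n (size s).+1) =
  \sum_(k < d.+1) xv ord0 ^+ k.+1 * fsym (cyc l) (hinv l a.-1 k * gser s (d - k)).
Proof.
move=> a0 am sn.
rewrite root_seriesE (@ser_split _ _ _ (fun ij => ij.1 == ord0)) mulr_suml.
apply: eq_bigr => k _; rewrite row0_series // rest_series xmon_mu_rot //.
rewrite /gser !(fsymM _ (hinv _ _ _)) (fsymM _ (ser _ _ _)) exprSr.
exact: mulr_reorder.
Qed.

Lemma wdem_cyc u k y : all (fun x => x.+1 < l)%N u ->
  wdem (map S u) (xv ord0 ^+ k * fsym (cyc l) y) =
  xv ord0 ^+ k * fsym (cyc l) (wdem u y).
Proof.
elim: u => [//|x u IH] /= /andP[xl /IH {}IH].
have x1 : (x < n.-1)%N by apply: ltn_trans xl.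
rewrite /wordn /= !insubT /= [foldr _ _ (pmap _ (map S u))]IH.
exact: (esym (@cyc_dem l (Ordinal x1) (Ordinal xl) k (wdem u y) xl erefl)).
Qed.

Lemma wdem_hinv u j k y : all (fun x => j <= x < l.-1)%N u ->
  wdem u (hinv l j k * y) = hinv l j k * wdem u y.
Proof.
elim: u => [//|x u IH] /= /andP[/andP[jx xl] /IH {}IH].
have xl' : (x.+1 < l)%N by rewrite -ltn_predRL.
have x1 : (x < n.-1)%N by apply: ltn_trans xl'.
rewrite /wordn /= insubT /= [foldr _ _ (pmap _ u)]IH.
exact: (dem_mulsym _ (@hinv_sym l (Ordinal x1) j k jx xl')).
Qed.

Lemma wdem_last0 u y : all (fun x => x < l.-1)%N u ->
  mspan (@last0 l) y -> mspan (@last0 l) (wdem u y).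
Proof.
move=> au Ly; elim: u au => [//|x u IH] /= /andP[xl /IH {}IH].
have xl' : (x.+1 < l)%N by rewrite -ltn_predRL.
have x1 : (x < n.-1)%N by apply: ltn_trans xl'.
by rewrite /wordn /= insubT /=; apply: last0_dem.
Qed.

Lemma absorb_word (w u : seq 'I_n.-1) h :
  (forall i : 'I_n.-1, (h <= i)%N -> hecke_cong (rcons w i) w) ->
  all (fun i : 'I_n.-1 => h <= i)%N u -> hecke_cong (w ++ u) w.
Proof.
move=> ab; elim: u => [_|i u IH /= /andP[hi /IH c]]; first by rewrite cats0; apply: hecke_refl.
rewrite -cat_rcons; apply: hecke_trans (hecke_cat (ab _ hi) (hecke_refl u)) c.
Qed.

(** Induction on the rows: absorption by [w] symmetrizes the factor not coming from the first row,
    after which [polypart_last0], [polypart_mulinv] and [expand] convert the series of that row into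
    x_1 [Phi] after a longest Demazure operator. That operator has the absorption property needed
    for the remaining rows. *)
Lemma rotation s : valid s -> (size s <= n)%N -> (l <= B)%N ->
  forall w : seq 'I_n.-1,
  (forall i : 'I_n.-1, (head 0 s <= i)%N -> hecke_cong (rcons w i) w) ->
  forall d, foldr (@dem int n) (polypart (root_series (Psi n s) d * xmon (mu n (size s)))) w
     = foldr (@dem int n) (tofrac (qcoef d (Gp s))) w.
Proof.
move=> + + lB; elim: s => [|a s IH].
  move=> _ _ w _ d; congr foldr.
  have -> : mu n 0 = w0t n by apply: eq_from_tnth => t; rewrite !tnth_mktuple.
  rewrite xmon_w0t mulr1 root_seriesE polypart_root_series; last first.
    by move=> ij; rewrite inE => /andP[].
  by rewrite /= qcoef1 rmorph_nat.
move=> /= /and4P[a0 ha ah vs] sn w ab d.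
have am : (a <= (size s).+1)%N by apply: leq_trans ah _; rewrite ltnS valid_head.
have al : (a.-1 <= l)%N by rewrite -ltnS prednK //; apply: leq_trans am sn.
(* This symmetrizes the variables of [hinv l a.-1]. Raised by one, its letters are at least a, hence
   absorbed by [w]. *)
pose Wd := w0w a.-1 (l - a).
have Wd_all : all (fun x => a.-1 <= x < l.-1)%N Wd.
  by apply: sub_all (w0w_all _ _) => x; lia.
pose W := w0w a.-1 B.
pose y e := wdem Wd (gser s e).
have ly e : mspan (@last0 l) (y e).
  apply: wdem_last0; last exact: gser_last0.
  by apply: sub_all Wd_all => x /andP[].
pose P e := polypart (y e).
have PL e : mspan (fun g : wt => nonneg g /\ last0 g) (P e).
  by have [] := polypart_last0 0 (ly e).
have Lg e : laurent (gser s e) by apply: mspan_sub (gser_last0 e sn).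
have PE e : P e = wdem Wd (polypart (gser s e)) by exact: polypart_foldr_dem.
have Psym e (i : 'I_n.-1) : (a.-1 <= i)%N -> (i.+1 < l)%N -> dem i (P e) = P e.
  move=> ai il; rewrite PE; apply: (foldr_dem_cong _ (u := i :: wordn n Wd)).
  have := @w0w_left n a.-1 (l - a) i; rewrite /ncong wordn_cons.
  by apply; move: ai il a0; move: (nat_of_ord i); lia.
have hP e k : polypart (hinv l a.-1 k * y e) = polypart (hinv l a.-1 k * P e).
  apply/esym/polypart_mulinv; last by apply: mspan_sub (ly e).
  by apply: mspan_sub (hinv_span l a.-1 k) => g [].
pose Q := foldr (@mdem _ n) (Gp s) (wordn n W).
(* The longest element from a - 1 is the cycle a - 1, ..., l - 1 times [Wd]: the factor [Wd] is
   already in [P e], and the cycle is what [expand] evaluates. *)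
have QE e : tofrac (qcoef e Q) = wdem (iota a.-1 (l - a.-1)) (P e).
  rewrite /Q qcoef_foldr_mdem foldr_mdemE -(IH vs (ltnW sn)); last first.
    move=> i hi; have := @w0w_right_big n a.-1 B i lB.
    rewrite /ncong wordn_cat (wordn_cons i [::]) cats1.
    by apply; move: ah hi; move: (nat_of_ord i); lia.
  rewrite polypart_gser // (foldr_dem_cong _ (@w0w_trunc n a.-1 B lB al)) PE -foldr_cat -wordn_cat.
  congr (foldr _ _ (wordn n _)); rewrite /Wd.
  rewrite -[n.-1]/l; have [al'|al'] := ltnP a.-1 l; last first.
    by have [e1 e2] : (l - a.-1 = 0 /\ l - a = 0)%N by [lia]; rewrite e1 e2.
  by have e1 : (l - a.-1 = (l - a).+1)%N by [lia]; rewrite e1.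
have /choice[K0 HK] e := expand al (PL e) (Psym e).
(* At least d + 1 terms, as [qcoef_Phi] requires. *)
pose K e := maxn (K0 e) d.+1.
pose T k e : LF := xv ord_max ^+ k * polypart (hinv l a.-1 k * P e).
have QT e : tofrac (qcoef e Q) = \sum_(k < K e) T k e.
  by rewrite QE (HK e (K e)) // leq_maxl.
have TL k e : mspan (fun g : wt => nonneg g /\ tnth g ord_max = k%:Z) (T k e).
  have [pl _] := polypart_last0 0 (hinv_mul_last0 a.-1 k (mspan_sub (fun g => @proj2 _ _) (PL e))).
  rewrite /T xvar_xmon; apply: mspanM (mspan_xmon (C := eq (unitw ord_max k%:Z)) erefl) pl.
  move=> g g' <- [ng g0]; split.
    by move=> t; rewrite !tnth_mktuple addr_ge0 //; case: ifP.
  by rewrite !tnth_mktuple eqxx g0 addr0.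
have AT0 (ke : nat * nat) : exists A, tofrac A = T ke.1 ke.2 /\ lastdeg ke.1 A.
  exact: mpoly_of_mspan (TL ke.1 ke.2).
have [A' AT'] := choice AT0; pose A k e := A' (k, e).
have AT k e : tofrac (A k e) = T k e /\ lastdeg k (A k e) := AT' (k, e).
have QA e : qcoef e Q = \sum_(k < K e) A k e.
  apply: tofrac_inj; rewrite QT raddf_sum; apply: eq_bigr => k _.
  by rewrite /= (AT k e).1.
have PhiQ : qcoef d (Phi Q) = msym (cyc l) (\sum_(k < d.+1) A k (d - k)%N).
  apply: (@qcoef_Phi l Q d A K) => [e|k e|]; [exact: leq_maxr| |exact: QA].
  exact: (AT k e).2.
have Wab : @hecke_cong n (w ++ wordn n (map S Wd)) w.
  apply: (absorb_word ab); apply/allP => i; rewrite /wordn mem_pmap => /mapP[x].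
  move=> /mapP[z zW ->]; case: insubP => // j _ jz [->].
  rewrite jz; have /allP/(_ _ zW)/andP[az _] := Wd_all.
  by rewrite -(prednK a0) ltnS.
have S1 : root_series (Psi n (a :: s)) d * xmon (mu n (size s).+1) = _ :> LF :=
  rot_series d a0 am sn.
have LF1 k : laurent (xv ord0 ^+ k.+1 * fsym (cyc l) (hinv l a.-1 k * gser s (d - k))).
  apply: laurentM; first by rewrite xvar_xmon; apply: mspan_xmon.
  by apply: mspan_fsym (hinv_mul_last0 a.-1 k (gser_last0 (d - k) sn)).
have LF2 : laurent (root_series (Psi n (a :: s)) d * xmon (mu n (size s).+1)).
  by rewrite S1; apply: zspan_sum => k _; apply: LF1.
(* The raised [Wd] is inserted after [w], then moved inside [polypart] and the rotation. *)
rewrite -[LHS](@foldr_dem_cong int n _ _ _ Wab) foldr_cat -(polypart_foldr_dem _ LF2) S1 foldr_dem_sum.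
congr foldr.
have W1 : all (fun x => x.+1 < l)%N Wd.
  by apply: sub_all Wd_all => x /andP[_ xl]; rewrite -ltn_predRL.
under eq_bigr => k _ do rewrite wdem_cyc // wdem_hinv //.
rewrite polypart_sum; last first.
  move=> k _; apply: laurentM; first by rewrite xvar_xmon; apply: mspan_xmon.
  by apply: mspan_fsym (hinv_mul_last0 a.-1 k (ly (d - k)%N)).
rewrite -/Q qcoefXM PhiQ tofracM -[tofrac 'X_ord0]/(xv ord0) -fsym_tofrac.
rewrite !raddf_sum mulr_sumr; apply: eq_bigr => k _ /=.
have [_ ->] := polypart_last0 k.+1 (hinv_mul_last0 a.-1 k (ly (d - k)%N)).
rewrite (AT k (d - k)%N).1.
by rewrite hP /T fsymM rmorphXn /= fsym_xvar cyc_last exprS -mulrA.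
Qed.

End Rotation.

(** * The compositions met along the rotations *)

(** The trace on compositions of one row: the longest operator sends the entry at [a.-1] to the end,
    and the rotation brings it to the front increased by one. *)
Definition step (a : nat) (s : seq nat) : seq nat := (nth 0 s a.-1).+1 :: take a.-1 s.

Definition tup n (s : seq nat) : n.-tuple nat := [tuple nth 0%N s i | i < n].

Lemma nth_tup n s t : (size s <= n)%N -> nth 0%N (tup n s) t = nth 0%N s t.
Proof.
move=> sn; have [tn|nt] := ltnP t n.
  by have := tnth_nth 0%N (tup n s) (Ordinal tn); rewrite tnth_mktuple.
by rewrite !nth_default ?size_tuple // (leq_trans sn).
Qed.

Lemma fact_push (p : nat -> nat) b k : (forall t, (b < t)%N -> p t = 0%N) ->
  fact (rev (iota b k)) p =
  fun t => if (t < b)%N then p t else if t == (b + k)%N then p b else 0%N.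
Proof.
move=> p0; elim: k => [|k IH].
  by apply/funext => t /=; rewrite addn0; case: ltngtP => [//|/p0 //|->].
rewrite -addn1 iotaD rev_cat /= IH fbar_swap; last first.
  by rewrite ltnNge ltnW ?ltnS ?leq_addr //= gtn_eqF.
apply/funext => t /=; rewrite /nswap addnA addn1.
have [->|t1] := eqVneq t (b + k)%N.
  by rewrite !ltnNge !leq_addr ltnW ?ltnS ?leq_addr //= gtn_eqF // ltn_eqF.
have [->|t2] := eqVneq t (b + k).+1.
  by rewrite !ltnNge !leq_addr ltnW ?ltnS ?leq_addr //= eqxx.
by rewrite (negPf t1).
Qed.

Lemma fact_id d (T : orderType d) u (p : nat -> T) :
  (forall x, x \in u -> (p x <= p x.+1)%O) -> fact u p = p.
Proof.
elim: u => //= x u IH h; rewrite IH; first by apply: fbar_id; apply: h; rewrite mem_head.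
by move=> y yu; apply: h; rewrite inE yu orbT.
Qed.

Lemma map_val_wordn n u : map val (wordn n u) = [seq x <- u | (x < n.-1)%N].
Proof.
elim: u => //= x u IH; rewrite /wordn /=; case: insubP => [i xi ix|/negPf ->] /=; last exact: IH.
by rewrite xi ix; congr cons.
Qed.

Lemma tup_step l B a s : (0 < a)%N -> (a <= l.+1)%N -> (l <= B)%N -> (size s <= a)%N ->
  rot_up (wact (wordn l.+1 (w0w a.-1 B)) (tup l.+1 s)) = tup l.+1 (step a s).
Proof.
move=> a0 al lB sa; set b := a.-1.
have sl : (size s <= l.+1)%N by apply: leq_trans al.
have p0 t : (b < t)%N -> nth 0%N s t = 0%N.
  by move=> bt; rewrite nth_default // (leq_trans sa) // -(prednK a0).
(* The longest word absorbs [c] on the right. After [c] has pushed the entry at b to the end, the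
   entries from b on increase and the longest word fixes them. *)
pose c := rev (iota b (l - b)).
have cW : ncong l.+1 (w0w b B ++ c) (w0w b B).
  by apply: w0w_catr; rewrite all_rev; apply/allP => x; rewrite mem_iota /b; lia.
pose q t := if (t < b)%N then nth 0%N s t else if t == l then nth 0%N s b else 0%N.
have bl : (b <= l)%N by rewrite /b; lia.
have qE : nth 0%N (wact (wordn l.+1 (w0w b B)) (tup l.+1 s)) = q.
  have nE : nth 0%N (tup l.+1 s) = nth 0%N s by apply/funext => t; apply: nth_tup.
  rewrite -(wact_cong _ cW) wordn_cat wact_cat !nth_wact nE map_val_wordn.
  have -> : map val (wordn l.+1 c) = c.
    by apply: val_wordn; rewrite all_rev; apply/allP => x; rewrite mem_iota /=; lia.
  rewrite fact_push // subnKC //; apply: fact_id => x.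
  rewrite mem_filter /= => /andP[xl /(allP (w0w_all _ _))/andP[bx _]].
  by rewrite ltnNge bx /= (ltn_eqF xl).
apply: eq_from_tnth => i; rewrite !tnth_mktuple (tnth_nth 0%N) qE.
have [->|i0] := eqVneq i ord0.
  by rewrite /= /q addn1 modn_small // ltnNge bl eqxx.
have i1 : (0 < i)%N by move: i0; rewrite -val_eqE lt0n.
have iE : (ord_pred i : nat) = i.-1.
  have il := ltn_ord i; rewrite /= -(prednK i1) addSn /= modnDr modn_small //.
  by rewrite prednK // ltnW.
have il : (i.-1 < l)%N by rewrite -ltnS prednK.
rewrite iE addn0 /q (ltn_eqF il) -{3}(prednK i1) /=.
have [ib|bi] := ltnP i.-1 b; first by rewrite nth_take.
by rewrite nth_default // (leq_trans _ bi) // size_take_min geq_minl.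
Qed.

Section Etilde.
Variables (l B : nat) (E : l.+1.-tuple nat -> {mpoly {poly int}[l.+1]}).
Hypotheses (hE : is_Etilde E) (lB : (l <= B)%N).

Lemma E_word (u : seq 'I_l.+1.-1) b : E (wact u b) = foldr (@mdem _ l.+1) (E b) u.
Proof.
have [_ hs _] := hE; elim: u => //= i u IH; apply: tofrac_inj.
by rewrite mdemE -IH; exact: hs.
Qed.

Lemma size_steps s : valid s -> (size (foldr step [::] s) <= head 0 s)%N.
Proof.
case: s => //= a s /and4P[a0 _ _ _].
by rewrite size_take_min -{2}(prednK a0) ltnS geq_minl.
Qed.

Lemma E_Gp s : valid s -> (head 0 s <= l.+1)%N ->
  Gp B l s = E (tup l.+1 (foldr step [::] s)).
Proof.
have [h0 _ hr] := hE; elim: s => [_ _|a s IH] /=.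
  rewrite -h0; congr E; apply: eq_from_tnth => i.
  by rewrite tnth_mktuple (tnth_nth 0%N) nth_nseq nth_nil ltn_ord.
move=> /and4P[a0 ha _ vs] al; rewrite -(@tup_step l B) //; last first.
  exact: leq_trans (size_steps vs) ha.
by rewrite hr E_word -IH // (leq_trans ha).
Qed.

End Etilde.

(** A step adds one, and by the length bound truncation loses nothing. *)
Lemma sumn_steps s : valid s -> sumn (foldr step [::] s) = size s.
Proof.
elim: s => //= a s IH /and4P[a0 ha _ vs].
have ta := leq_trans (size_steps vs) ha; rewrite -(IH vs) addSn; congr _.+1.
move: (foldr step [::] s) ta => t ta; rewrite -{3}(cat_take_drop a.-1 t) sumn_cat addnC.
congr (_ + _)%N; have [ts|ts] := ltnP a.-1 (size t); last first.
  by rewrite nth_default // drop_oversize.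
rewrite (drop_nth 0%N ts) drop_oversize /= ?addn0 // prednK //.
Qed.

(** * The row data of Delta'(eta) and conjugate partitions *)

(** For nonempty partitions this is [nr_Delta'] completed by the entry 1 of the last row; reading
    the head of the empty list as 0 makes the recursion uniform. *)
Fixpoint aseq (eta : seq nat) : seq nat :=
  if eta is a :: eta' then
    nseq (head 0%N eta') a ++ down a (head 0%N eta').+1 ++ aseq eta'
  else [::].

Definition ispart (eta : seq nat) :=
  sorted geq eta && all (fun x => 0 < x)%N eta.

Lemma ispart_cons a eta : ispart (a :: eta) ->
  [/\ (0 < a)%N, (head 0%N eta <= a)%N & ispart eta].
Proof.
rewrite /ispart /= => /andP[pe /andP[a0 ae]]; split=> //.
  by case: eta pe {ae} => //= b eta /andP[].
by rewrite ae andbT; apply: path_sorted pe.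
Qed.

Lemma down_self a : down a a.+1 = [::].
Proof. by rewrite /down subnn. Qed.

Lemma down_cons a b : (b <= a)%N -> down a.+1 b.+1 = a.+1 :: down a b.+1.
Proof.
move=> ba; rewrite /down !subSS subSn // -[(a - b).+1]addn1 iotaD rev_cat /=.
by rewrite addSn subnKC.
Qed.

Lemma aseq_valid eta : ispart eta -> valid (aseq eta) /\ head 0%N (aseq eta) = head 0%N eta.
Proof.
elim: eta => //= a eta IH /ispart_cons[a0 ha /IH[va hE]].
set b := head 0%N eta in ha hE *; set s := aseq eta in va hE *.
have [v1 h1] : valid (down a b.+1 ++ s) /\ head 0%N (down a b.+1 ++ s) = a.
  elim: a ha a0 => [|a IHa] ha a0 //.
  have [ab|ba] := ltnP a b.
    have -> : a.+1 = b by apply/eqP; rewrite eqn_leq ab ha.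
    by rewrite down_self /=.
  rewrite down_cons //=; have [a0'|a0'] := posnP a.
    have b0 : b = 0%N by move: ba; rewrite a0'; lia.
    by rewrite a0' b0 down_self /= hE b0 va.
  by have [v h] := IHa ba a0'; rewrite v h leqnSn ltnSn.
move: (down a b.+1 ++ s) v1 h1 => X v1 h1.
elim: (b) => [//|k [v h]] /=; rewrite v h leqnn leqnSn a0.
by [].
Qed.

Lemma aseq_nr eta : ispart eta -> eta != [::] -> aseq eta = rcons (nr_Delta' eta) 1%N.
Proof.
elim: eta => // a [|b eta] IH /ispart_cons[a0 ha pe] _.
  rewrite /= cats0 /down subSS subn0; case: a a0 {ha IH} => // a _.
  by rewrite /= rev_cons subSS subn1.
have -> : aseq (a :: b :: eta) = nseq b a ++ down a b.+1 ++ aseq (b :: eta) by [].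
have -> : nr_Delta' (a :: b :: eta) = nseq b a ++ down a b.+1 ++ nr_Delta' (b :: eta) by [].
by rewrite (IH pe isT) !rcons_cat.
Qed.

Lemma Psi_Delta n eta : ispart eta ->
  Psi n (aseq eta) = Delta'ext n (size (aseq eta)) eta.
Proof.
move=> pe; apply/setP => [[i j]]; rewrite !inE /=.
have [->|ne] := eqVneq eta [::]; first by [].
case: (ltnP i j) => //= ij; congr orb; rewrite (aseq_nr pe ne) nth_rcons.
case: ltnP => // si; rewrite [nth 0 (nr_Delta' eta) i]nth_default // addn0.
by case: eqP => _; move: ij; lia.
Qed.

(** A step whose parameter exceeds the length by one just prepends a 1. *)
Lemma steps_down L b a : (b <= a)%N -> size L = b ->
  foldr step L (down a b.+1) = nseq (a - b) 1%N ++ L.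
Proof.
move=> + Lb; elim: a => [|a IH] ba.
  have b0 : b = 0%N by move: ba; lia.
  by rewrite b0 down_self subnn.
have [ab|ba'] := ltnP a b.
  have -> : a.+1 = b by apply/eqP; rewrite eqn_leq ab ba.
  by rewrite down_self subnn.
have sz : size (nseq (a - b) 1%N ++ L) = a by rewrite size_cat size_nseq Lb subnK.
rewrite down_cons //= IH // /step /= take_oversize ?sz // nth_default ?sz //.
by rewrite subSn.
Qed.

(** A step whose parameter equals the length moves the last entry to the front and increments it. *)
Lemma steps_nseq a Y Z : (0 < a)%N -> size (Y ++ Z) = a ->
  foldr step (Y ++ Z) (nseq (size Z) a) = map S Z ++ Y.
Proof.
move=> a0; elim/last_ind: Z Y => [|Z v IH] Y sz; first by rewrite cats0.
have -> : nseq (size (rcons Z v)) a = nseq (size Z) a ++ [:: a].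
  by rewrite size_rcons -addn1 nseqD.
rewrite foldr_cat /=.
have sz' : a.-1 = size (Y ++ Z) by rewrite -sz -rcons_cat size_rcons.
have -> : step a (Y ++ rcons Z v) = (v.+1 :: Y) ++ Z.
  rewrite /step -rcons_cat sz' nth_rcons ltnn eqxx -cats1 take_size_cat //.
by rewrite IH /= ?map_rcons ?cat_rcons // -sz' prednK.
Qed.

(** A new row of length a adds a box to each of a columns: the [down] part creates the a - b new
    columns, and the [nseq b a] part brings the b old ones to the front, incremented. *)
Lemma steps_aseq eta : ispart eta -> foldr step [::] (aseq eta) = conj_part eta.
Proof.
elim: eta => // a eta IH /ispart_cons[a0 ha pe].
rewrite /= -/aseq.
rewrite !foldr_cat IH //; set b := head 0%N eta; set L := conj_part eta.
have Lb : size L = b by rewrite size_map size_iota.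
rewrite (steps_down ha Lb).
have -> : nseq b a = nseq (size L) a by rewrite Lb.
rewrite steps_nseq //; last first.
  by rewrite size_cat size_nseq Lb subnK.
have ioE : iota 0 a = iota 0 b ++ iota b (a - b) by rewrite -{1}(subnKC ha) iotaD.
have -> : conj_part (a :: eta) = [seq count (fun e => j < e)%N (a :: eta) |
    j <- iota 0 b ++ iota b (a - b)] by rewrite /conj_part /= ioE.
rewrite map_cat; congr (_ ++ _).
  rewrite -map_comp; apply/eq_in_map => i; rewrite mem_iota /= => ib.
  by rewrite (leq_trans ib).
have -> : nseq (a - b) 1%N = map (fun=> 1%N) (iota b (a - b)).
  by rewrite -[X in nseq X](size_iota b); elim: (iota _ _) => //= ? ? ->.
apply/eq_in_map => i; rewrite mem_iota subnKC // => /andP[bi ia] /=.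
rewrite ia; suff -> : count (fun e => i < e)%N eta = 0%N by [].
apply/eqP; rewrite -leqn0 leqNgt -has_count; apply/hasPn => e ee.
rewrite -leqNgt; apply: leq_trans bi.
case/andP: pe => so _; case: eta so ee {IH ha ioE L Lb} @b => // x eta /= so.
rewrite inE => /orP[/eqP -> //|ee].
by have /allP/(_ _ ee) := order_path_min (rev_trans leq_trans) so.
Qed.

(** Both sides say that the box in row i and column j lies in the diagram of [la]. *)
Lemma count_lt_sorted (la : seq nat) i j : sorted geq la ->
  (i < count (fun a => j < a)%N la)%N = (j < nth 0%N la i)%N.
Proof.
elim: la i => [|x la IH] i so; first by rewrite nth_nil.
have so' := path_sorted so; rewrite /=.
have [jx|xj] := ltnP j x.
  by case: i => [|i] //=; rewrite ?jx // -IH // add1n ltnS.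
have mx := order_path_min (rev_trans leq_trans) so.
have -> : count (fun a => j < a)%N la = 0%N.
  apply/eqP; rewrite -leqn0 leqNgt -has_count; apply/hasPn => e ee.
  by rewrite -leqNgt (leq_trans _ xj) //; have /allP/(_ _ ee) := mx.
case: i => [|i] /=; first by move: xj; lia.
apply/esym/negbTE; rewrite -leqNgt; have [il|li] := ltnP i (size la).
  by rewrite (leq_trans _ xj) //; have /allP/(_ _ (mem_nth 0%N il)) := mx.
by rewrite nth_default.
Qed.

Lemma count_iota_lt v h : count (fun j => j < v)%N (iota 0 h) = minn v h.
Proof.
elim: h => [|h IH]; first by rewrite minn0.
by rewrite -addn1 iotaD count_cat IH /= add0n addn0; lia.
Qed.

Lemma nth_conj (la : seq nat) j : sorted geq la ->
  nth 0%N (conj_part la) j = count (fun a => j < a)%N la.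
Proof.
move=> so; have [jl|lj] := ltnP j (head 0%N la).
  by rewrite (nth_map 0%N) ?size_iota // nth_iota.
rewrite nth_default ?size_map ?size_iota //; apply/esym/eqP.
rewrite -leqn0 leqNgt count_lt_sorted // -leqNgt.
by case: la so lj.
Qed.

Lemma conj_ispart la : sorted geq la -> ispart (conj_part la).
Proof.
move=> so; apply/andP; split.
  apply/(sortedP 0%N) => i _; rewrite !nth_conj //; apply: sub_count => a /=.
  exact: ltn_trans.
apply/allP => x /mapP[j]; rewrite mem_iota /= add0n => jh ->.
by rewrite count_lt_sorted // nth0.
Qed.

Lemma nth_conjK (la : seq nat) i : sorted geq la ->
  nth 0%N (conj_part (conj_part la)) i = nth 0%N la i.
Proof.
move=> so; have /andP[so' _] := conj_ispart so; rewrite nth_conj // /conj_part count_map.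
rewrite (eq_count (a2 := fun j => j < nth 0%N la i)%N); last first.
  by move=> j /=; rewrite count_lt_sorted.
rewrite count_iota_lt; apply/minn_idPl.
case: la so {so'} => [|x la] so; first by rewrite nth_nil.
case: i => [|i] //=; have [il|li] := ltnP i (size la); last by rewrite nth_default.
by have /allP/(_ _ (mem_nth 0%N il)) := order_path_min (rev_trans leq_trans) so.
Qed.

Lemma head_conj (la : seq nat) : sorted geq la ->
  head 0%N (conj_part la) = count (fun a => 0 < a)%N la.
Proof. by move=> so; rewrite -nth0 nth_conj. Qed.

Lemma sumn_conjK (la : seq nat) : sorted geq la ->
  sumn (conj_part (conj_part la)) = sumn la.
Proof.
move=> so; set c := conj_part (conj_part la).
have sc : (size c <= size la)%N by rewrite size_map size_iota head_conj // count_size.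
suff -> : la = c ++ nseq (size la - size c) 0%N by rewrite sumn_cat sumn_nseq mul0n addn0.
apply: (@eq_from_nth _ 0%N); first by rewrite size_cat size_nseq subnKC.
move=> i il; rewrite nth_cat nth_nseq -(nth_conjK i so) -/c.
by case: ltnP => // ci; rewrite nth_default //; case: ifP.
Qed.

(** * Setting the last variables to zero *)

Section SetTail.
Variable R : idomainType.

Definition tailsub (l m : nat) : m.-tuple {mpoly R[l]} :=
  [tuple if insub (i : nat) is Some j then 'X_(j : 'I_l) else 0 | i < m].

(** [set_tail0] over an arbitrary coefficient domain, since [Gp] still carries q. *)
Definition stl (l m : nat) (f : {mpoly R[m]}) : {mpoly R[l]} := f \mPo tailsub l m.

Lemma comp_mpoly_comp (a b c : nat) (f : {mpoly R[a]}) (T : a.-tuple {mpoly R[b]})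
    (U : b.-tuple {mpoly R[c]}) :
  (f \mPo T) \mPo U = f \mPo [tuple tnth T i \mPo U | i < a].
Proof.
rewrite (comp_mpolyE f T) raddf_sum /= (comp_mpolyE f); apply: eq_bigr => m _.
rewrite comp_mpolyZ rmorph_prod; congr (_ *: _); apply: eq_bigr => i _.
by rewrite rmorphXn /= tnth_mktuple.
Qed.

Lemma comp_mpoly_tnthX (a b : nat) (T : a.-tuple {mpoly R[b]}) i :
  'X_i \mPo T = tnth T i.
Proof. by rewrite comp_mpolyXU (tnth_nth 0). Qed.

Lemma msym_comp (a : nat) (s : 'S_a) (f : {mpoly R[a]}) :
  msym s f = f \mPo [tuple 'X_(s i) | i < a].
Proof.
rewrite -[LHS]comp_mpoly_id msym_mPo; congr (comp_mpoly _ f).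
by apply: eq_from_tnth => i; rewrite !tnth_mktuple.
Qed.

Lemma stl_comp (l k : nat) (f : {mpoly R[k.+1]}) : (l <= k)%N ->
  stl l (stl k f) = stl l f.
Proof.
move=> lk; rewrite /stl comp_mpoly_comp; congr (comp_mpoly _ f).
apply: eq_from_tnth => i; rewrite !tnth_mktuple.
case: (insubP 'I_k (i : nat)) => [j _ ji|ik].
  by rewrite comp_mpoly_tnthX tnth_mktuple ji.
by rewrite comp_mpoly0 insubN // -leqNgt (leq_trans lk) // leqNgt.
Qed.

Lemma stl_id (l : nat) (f : {mpoly R[l]}) : stl l f = f.
Proof.
rewrite -[RHS]comp_mpoly_id /stl; congr (comp_mpoly _ f).
by apply: eq_from_tnth => i; rewrite !tnth_mktuple valK.
Qed.

Lemma stlX (k : nat) (i : 'I_k.+1) (j : 'I_k) : i = j :> nat ->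
  stl k ('X_i : {mpoly R[k.+1]}) = 'X_j.
Proof. by move=> ij; rewrite /stl comp_mpoly_tnthX tnth_mktuple ij valK. Qed.

Lemma stlX_last (k : nat) (i : 'I_k.+1) : i = k :> nat ->
  stl k ('X_i : {mpoly R[k.+1]}) = 0.
Proof.
by move=> ik; rewrite /stl comp_mpoly_tnthX tnth_mktuple insubN // ik ltnn.
Qed.

Lemma stlM l m : {morph @stl l m : f g / f * g}.
Proof. by move=> f g; rewrite /stl rmorphM. Qed.

Lemma stlB l m : {morph @stl l m : f g / f - g}.
Proof. by move=> f g; rewrite /stl raddfB. Qed.

Lemma mpolyXn_neq0 k (i : 'I_k) : 'X_i != 0 :> {mpoly R[k]}.
Proof. by rewrite -tofrac_eq0; apply: (xvar_neq0 R i). Qed.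

(** In the division-free identity for the last operator, setting the last variable to 0 leaves the
    same variable as a factor of both sides, and cancelling it gives the identity map. The other
    operators do not involve the last variable. *)
Lemma stl_mdem (k : nat) (i : 'I_k.+1.-1) (f : {mpoly R[k.+1]}) :
  stl k (mdem i f) = if insub (i : nat) is Some j then mdem (j : 'I_k.-1) (stl k f) else stl k f.
Proof.
have /mdem_eqP/(congr1 (@stl k k.+1)) := erefl (mdem i f).
rewrite !(stlM, stlB); case: insubP => [j jk ji|ik] e.
  apply/esym/mdem_eqP; move: e.
  rewrite !(@stlX _ (lo i) (lo j)) ?(@stlX _ (hi i) (hi j)) /= ?ji // => ->.
  congr (_ - _ * _); rewrite /stl msym_mPo msym_comp comp_mpoly_comp.
  congr (comp_mpoly _ f); apply: eq_from_tnth => t; rewrite !tnth_mktuple.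
  have jk1 : (j.+1 < k)%N by rewrite -ltn_predRL.
  have key (t' : 'I_k.+1) (z : 'I_k) : t' = z :> nat ->
    (if insub (t' : nat) is Some y then 'X_(y : 'I_k) else 0) = 'X_z :> {mpoly R[k]}.
    by move=> ->; rewrite valK.
  have [tk|kt] := ltnP t k.
    rewrite [insub (t : nat)]insubT /= comp_mpoly_tnthX tnth_mktuple.
    apply: key; case: tpermP => [tl|th|/eqP tl /eqP th].
    - have -> : Sub (t : nat) tk = lo j :> 'I_k by apply: val_inj; rewrite /= tl /= -ji.
      by rewrite tpermL /= -ji.
    - have -> : Sub (t : nat) tk = hi j :> 'I_k by apply: val_inj; rewrite /= th /= -ji.
      by rewrite tpermR /= -ji.
    - rewrite tpermD //.
        by apply: contra_neq tl => /(congr1 val) /= e'; apply: val_inj; rewrite /= -e' -ji.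
      by apply: contra_neq th => /(congr1 val) /= e'; apply: val_inj; rewrite /= -e' -ji.
  rewrite [insub (t : nat)]insubN -?leqNgt // comp_mpoly0 tpermD ?insubN -?leqNgt //.
    by apply: contraTneq kt => <-; rewrite -ltnNge /= -ji ltnW.
  by apply: contraTneq kt => <-; rewrite -ltnNge /= -ji.
have ik1 : i.+1 = k by move: ik (ltn_ord i) => /=; move: (nat_of_ord i); lia.
have ik' : (i < k)%N := ltn_ord i.
move: e; rewrite (@stlX _ (lo i) (Ordinal ik')) // (@stlX_last _ (hi i)) //.
by rewrite subr0 mul0r subr0 => /(mulfI (mpolyXn_neq0 _)).
Qed.

Lemma stl_foldr_mdem (k : nat) (u : seq nat) (f : {mpoly R[k.+1]}) :
  stl k (foldr (@mdem R k.+1) f (wordn k.+1 u)) =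
  foldr (@mdem R k) (stl k f) (wordn k u).
Proof.
elim: u => //= x u IH; rewrite /wordn /=.
have [xk|kx] := ltnP x k.+1.-1; last first.
  have kx' : (k.-1 <= x)%N by apply: leq_trans (leq_pred _) kx.
  by rewrite !insubN -?leqNgt //=; exact: IH.
rewrite (insubT (fun y => y < k.+1.-1)%N xk) /= stl_mdem /=; rewrite [stl k _]IH.
by case: insubP.
Qed.

End SetTail.

(** Truncating after [Phi] kills the next-to-last variable of f and sends the last to q x_1;
    truncating before exchanges these roles. Symmetry in the two reconciles them. *)
Lemma stl_Phi (k : nat) (f : {mpoly {poly int}[k.+2]}) (i : 'I_k.+2.-1) :
  i = k :> nat -> msym (tperm (lo i) (hi i)) f = f ->
  stl k.+1 (Phi f) = Phi (stl k.+1 f).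
Proof.
move=> ik fs; rewrite -{1}fs /stl /Phi msym_mPo !comp_mpoly_comp.
congr (comp_mpoly _ f); apply: eq_from_tnth => t; rewrite !tnth_mktuple.
have him : hi i = ord_max by apply: val_inj; rewrite /= ik.
case: tpermP => [->|->|/eqP tl /eqP th].
- rewrite him eqxx /= ik insubT //= => kk.
  rewrite rmorphM /= comp_mpolyC !comp_mpoly_tnthX !tnth_mktuple.
  have -> : Sub k kk = ord_max :> 'I_k.+1 by apply: val_inj.
  by rewrite eqxx insubT //=; congr (_ * 'X__); apply: val_inj.
- have -> : (lo i == ord_max) = false by rewrite -val_eqE /= ik ltn_eqF.
  rewrite him /= insubN ?ltnn // comp_mpoly0 comp_mpoly_tnthX tnth_mktuple insubN //.
  by rewrite /= ik modn_small // ltnn.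
- have tk : (t < k)%N.
    move: tl th; rewrite -!val_eqE /= ik; have := ltn_ord t.
    by move: (nat_of_ord t); lia.
  have -> : (t == ord_max) = false by rewrite -val_eqE /= ltn_eqF // ltnW.
  have tk1 : (t < k.+1)%N by apply: ltnW.
  rewrite (insubT (fun y => y < k.+1)%N tk1) /= !comp_mpoly_tnthX !tnth_mktuple.
  have -> : (Sub (t : nat) tk1 == ord_max :> 'I_k.+1) = false by rewrite -val_eqE /= ltn_eqF.
  have sk : (ordS t < k.+1)%N by rewrite /= modn_small // ltnS ltnW.
  rewrite (insubT (fun y => y < k.+1)%N sk); congr 'X__; apply: val_inj.
  by rewrite /= !modn_small // ltnS ltnW.
Qed.

(** The symmetry [stl_Phi] asks for holds because the longest word in front of each [Phi] absorbs
    the last generator. *)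
Lemma stl_Gp B k s : (k.+1 <= B)%N -> valid s -> (head 0 s <= k.+1)%N ->
  stl k.+1 (Gp B k.+1 s) = Gp B k s.
Proof.
move=> kB; elim: s => [|a s IH] /=.
  by move=> _ _; rewrite /stl comp_mpoly1.
move=> /and4P[a0 ha _ vs] ak; rewrite stlM (@stlX _ _ _ ord0) //; congr (_ * _).
have kk : (k < k.+2.-1)%N by [].
rewrite (@stl_Phi k _ (Ordinal kk)) //.
  by rewrite stl_foldr_mdem IH // (leq_trans ha).
apply: mdem_sym; apply: (foldr_mdem_cong _ (u := Ordinal kk :: _)).
have := @w0w_left_big k.+2 a.-1 B (Ordinal kk); rewrite /ncong wordn_cons.
by apply=> //=; rewrite -ltnS prednK.
Qed.

Lemma stl_Gp_word B k j s u : (k + j <= B)%N -> valid s -> (head 0 s <= k.+1)%N ->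
  stl k.+1 (foldr (@mdem _ (k + j).+1) (Gp B (k + j) s) (wordn (k + j).+1 u)) =
  foldr (@mdem _ k.+1) (Gp B k s) (wordn k.+1 u).
Proof.
move=> + vs hs; elim: j => [|j IH] kB; first by rewrite addn0 stl_id.
have e : (k + j.+1 = (k + j).+1)%N := addnS k j; rewrite {}e in kB *.
rewrite -(@stl_comp _ k.+1 (k + j).+1) ?ltnS ?leq_addr // stl_foldr_mdem stl_Gp //.
  by apply: IH; apply: ltnW.
by apply: leq_trans hs _; rewrite ltnS leq_addr.
Qed.

Lemma qcoef_stl l m d (f : {mpoly {poly int}[m]}) :
  qcoef d (stl l f) = set_tail0 l (qcoef d f).
Proof.
(* [mt] says that p is free of q with integer version p'; monomials under substitution have this
   form. *)
pose mt (p : {mpoly {poly int}[l]}) (p' : {mpoly int[l]}) :=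
  forall d c, qcoef d (c *: p) = c`_d *: p'.
have mt1 : mt 1 1.
  by move=> e c; have := qcoef_monom e c (0%MM : 'X_{1..l}); rewrite !mpolyX0.
have mt0 : mt 0 0 by move=> e c; rewrite !scaler0 qcoef0.
have mtX j p p' : mt p p' -> mt ('X_j * p) ('X_j * p').
  by move=> h e c; rewrite scalerAr qcoefXM h scalerAr.
elim/mpolyind: f => [|c mm f _ _ IH].
  by rewrite /stl /set_tail0 !comp_mpoly0 !qcoef0 comp_mpoly0.
rewrite qcoefD qcoef_monom /stl /set_tail0 !comp_mpolyD !comp_mpolyZ !comp_mpolyX.
rewrite qcoefD; congr (_ + _); last exact: IH.
suff h : mt (\prod_(i < m) tnth (tailsub _ l m) i ^+ mm i)
   (\prod_(i < m) tnth [tuple if insub (i : nat) is Some j then 'X_(j : 'I_l) else 0 | i < m] i ^+ mm i).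
  exact: h.
rewrite -[X in mt X]mulr1 -[X in mt _ X]mulr1.
have hp (i : 'I_m) r p p' : mt p p' -> mt (tnth (tailsub _ l m) i ^+ r * p)
   (tnth [tuple if insub (i : nat) is Some j then 'X_(j : 'I_l) else 0 | i < m] i ^+ r * p').
  elim: r p p' => [|r IHr] p p' h; first by rewrite !expr0 !mul1r.
  rewrite !exprSr -!mulrA; apply: IHr; rewrite !tnth_mktuple.
  by case: insub => [j|]; [apply: mtX|rewrite !mul0r].
elim: (index_enum _) => [|i r IHr]; first by rewrite !big_nil !mul1r.
by rewrite !big_cons -!mulrA; apply: hp.
Qed.

(* Values only move right, so letters beyond [l] act trivially on the way to a *)
(* weight supported on the first [l + 1] positions.                            *)
Lemma fact_filter l u (p : nat -> nat) :
  (forall t, (l < t)%N -> fact u p t = 0%N) ->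
  fact [seq x <- u | (x < l)%N] p = fact u p.
Proof.
elim: u => //= x u IH; set q := fact u p => h.
have q0 t : (l < t)%N -> q t = 0%N.
  move=> lt; apply/eqP; rewrite -leqn0 leqNgt; apply/negP => qt.
  have [le|gt] := leqP (q x.+1) (q x); last first.
    by have := h t lt; rewrite fbar_id; [lia|rewrite leEnat ltnW].
  have hs t' : (l < t')%N -> q (nswap x t') = 0%N by move=> /h; rewrite fbar_swap.
  have [tx|tx] := eqVneq t x.
    by have := hs x.+1; rewrite nswapR; move: lt qt le; rewrite tx; lia.
  have [tx1|tx1] := eqVneq t x.+1.
    by have := hs x.+1; rewrite nswapR; move: lt qt le; rewrite tx1; lia.
  by have := hs t lt; rewrite nswapD //; lia.
have -> : (if (x < l)%N then x :: [seq y <- u | (y < l)%N] else [seq y <- u | (y < l)%N])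
   = (if (x < l)%N then [:: x] else [::]) ++ [seq y <- u | (y < l)%N] by case: ifP.
rewrite fact_cat (IH q0) -/q; case: ltnP => //= lx.
apply/esym/fbar_id; rewrite leEnat.
have [xl|xl] := eqVneq x l; last by rewrite q0 //; lia.
have qx1 : q x.+1 = 0%N by apply: q0; lia.
have := h x.+1; rewrite /fbar nswapR qx1 leEnat leq0n => H; rewrite H //; lia.
Qed.

(** * Padding of weights and assembly of the two cases *)

Lemma sorted_decr n (b : n.-tuple nat) : sorted geq (decr b).
Proof. by have /dominant_sorted := decr_dominant b. Qed.

Lemma tup_conjK n (b : n.-tuple nat) :
  tup n (conj_part (conj_part (decr b))) = decr b.
Proof.
apply: eq_from_tnth => i; rewrite tnth_mktuple nth_conjK ?sorted_decr //.
by rewrite (tnth_nth 0%N).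
Qed.

Lemma decr_zero n (b : n.-tuple nat) (i : nat) :
  (head 0%N (conj_part (decr b)) <= i)%N -> nth 0%N (decr b) i = 0%N.
Proof.
rewrite head_conj ?sorted_decr // leqNgt count_lt_sorted ?sorted_decr //.
by rewrite -leqNgt leqn0 => /eqP.
Qed.

Lemma decr_pad l m (b : l.-tuple nat) : (l <= m)%N -> decr (pad m b) = tup m (decr b).
Proof.
move=> lm; apply: decr_uniq.
  apply/dominant_sorted/(sortedP 0%N) => i; rewrite size_tuple => im.
  rewrite !nth_tup ?size_tuple //; have so := sorted_decr b.
  have [il|li] := ltnP i.+1 l; first by apply: (sortedP 0%N so); rewrite size_tuple.
  by rewrite [nth _ _ i.+1]nth_default ?size_tuple.
have tupE (c : l.-tuple nat) : tup m c = c ++ nseq (m - l) 0%N :> seq nat.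
  apply: (@eq_from_nth _ 0%N); first by rewrite size_cat size_nseq !size_tuple subnKC.
  move=> i _; rewrite nth_tup ?size_tuple // nth_cat nth_nseq size_tuple.
  by case: ltnP => // li; rewrite nth_default ?size_tuple //; case: ifP.
rewrite tupE -[pad m b]/(tup m b) tupE perm_cat2r.
exact: (permEl (perm_sort _ _)).
Qed.

Lemma catalanH_Gp n B (w : hecke n.+1) eta d : ispart eta -> (n <= B)%N ->
  (size (aseq eta) <= n.+1)%N ->
  (forall i : 'I_n.+1.-1, (head 0 eta <= i)%N -> hecke_cong (rcons (repr w) i) (repr w)) ->
  catalanH (Delta'ext n.+1 (size (aseq eta)) eta) (mu n.+1 (size (aseq eta))) w d =
  qcoef d (foldr (@mdem _ n.+1) (Gp B n (aseq eta)) (repr w)).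
Proof.
move=> pe nB sn ab; have [va hd] := aseq_valid pe.
rewrite /catalanH /demw -Psi_Delta // (@rotation B n _ va sn nB); last by rewrite hd.
by rewrite -foldr_mdemE to_mpolyK qcoef_foldr_mdem.
Qed.

Theorem theorem8p11 (l : nat) (alpha : l.+1.-tuple nat)
    (E : l.+1.-tuple nat -> {mpoly {poly int}[l.+1]}) (hE : is_Etilde E) :
  let m := sumn alpha in
  let eta := conj_part (decr alpha) in
  ((m <= l.+1)%N -> forall d : nat,
     qcoef d (E alpha)
     = catalanH (Delta'ext l.+1 m eta) (mu l.+1 m) (plong alpha) d) /\
  ((l.+1 < m)%N -> forall d : nat,
     qcoef d (E alpha)
     = set_tail0 l.+1
         (catalanH (Delta' m eta) (mu m m) (plong (pad m alpha)) d)).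
Proof.
move=> m eta; have so := sorted_decr alpha.
have pe : ispart eta by apply: conj_ispart.
have [va hd] := aseq_valid pe.
have sm : size (aseq eta) = m.
  rewrite -(sumn_steps va) steps_aseq // sumn_conjK // /m.
  by apply: perm_sumn; apply: (permEl (perm_sort _ _)).
have hl : (head 0 eta <= l.+1)%N.
  by rewrite head_conj // (leq_trans (count_size _ _)) // size_tuple.
have EG B : (l <= B)%N -> Gp B l (aseq eta) = E (decr alpha).
  by move=> lB; rewrite (E_Gp hE lB va) ?hd // steps_aseq // tup_conjK.
split=> [ml|lm] d.
  rewrite -{1 2}sm (@catalanH_Gp l l) ?sm //.
    by rewrite EG // -(E_word hE) (plongP alpha).1.
  (* The head of eta counts the nonzero parts of alpha^+. Later positions hold zeros, so their
     generators fix alpha^+ and are absorbed. *)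
  move=> i hi; apply: (plongP alpha).2; rewrite !(tnth_nth 0%N).
  by rewrite !decr_zero // (leq_trans hi).
have dp : decr (pad m alpha) = tup m (decr alpha) by apply/decr_pad/ltnW.
have [pl1 pl2] := plongP (pad m alpha).
have -> : Delta' m eta = Delta'ext m m eta.
  apply/setP => [[i j]]; rewrite !inE /=.
  by have -> : (m <= j)%N = false by [rewrite leqNgt ltn_ord].
have su t : nth 0%N (pad m alpha) t = nth 0%N alpha t.
  by rewrite -[pad m alpha]/(tup m alpha) nth_tup // size_tuple ltnW.
(* Since the padded alpha vanishes beyond the first l + 1 positions, the letters using later
   positions act trivially ([fact_filter]), so the truncated word still carries alpha^+ to alpha. *)
have wE : wact (wordn l.+1 (map val (repr (plong (pad m alpha))))) (decr alpha) = alpha.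
  apply: (@eq_tuple_nth _ _ 0%N); rewrite nth_wact map_val_wordn.
  have dE : nth 0%N (decr (pad m alpha)) = nth 0%N (decr alpha).
    by apply/funext => t; rewrite dp nth_tup // size_tuple ltnW.
  have fE : fact (map val (repr (plong (pad m alpha)))) (nth 0%N (decr alpha))
      = nth 0%N alpha.
    by rewrite -dE -nth_wact pl1; apply/funext.
  rewrite fact_filter fE // => t lt; by rewrite nth_default // size_tuple.
have ab : forall i : 'I_m.-1, (head 0 eta <= i)%N ->
    hecke_cong (rcons (repr (plong (pad m alpha))) i) (repr (plong (pad m alpha))).
  move=> i hi; apply: pl2; rewrite dp !tnth_mktuple /=.
  by rewrite !decr_zero // (leq_trans hi).
move: (plong (pad m alpha)) wE ab => w wE ab {pl1 pl2 dp su}.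
have [j mE] : exists j, m = (l + j).+1 by exists (m.-1 - l)%N; move: lm; lia.
clearbody m; move: w ab wE sm lm; rewrite {}mE => w ab wE sm lm.
have := @catalanH_Gp (l + j) (l + j) w eta d pe (leqnn _); rewrite sm => ->; [|exact: leqnn|exact: ab].
rewrite -qcoef_stl -(wordn_val (repr w)) stl_Gp_word ?hd //.
by rewrite EG ?leq_addr // -(E_word hE) wE.
Qed.
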